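(* Let $f,g\in\mathrm{Diff}(\mathbb{C},0)$ be of infinite order, i.e. for every integer $k\ge1$ neither $f^k$ nor $g^k$ coincides with the identity on a neighborhood of $0$. Then there exists a $G_\delta$-dense set $\mathcal{H}\subset\mathrm{Diff}(\mathbb{C},0)$ (for the analytic topology) such that, whenever $h\in\mathcal{H}$, the group generated by $f$ and $h^{-1}\circ g\circ h$ in the group of germs $\mathrm{Diff}(\mathbb{C},0)$ is free; that is, every non-trivial reduced word $W(a,b)$ yields a local diffeomorphism $W(f,h^{-1}\circ g\circ h)$ that does not coincide with the identity on any neighborhood of $0$.
   Context: $\mathrm{Diff}(\mathbb{C},0)$ is the group of germs of holomorphic diffeomorphisms of $\mathbb{C}$ fixing $0$. $W(f,g)$ denotes the result of substituting $a=f$, $b=g$ in a reduced word in $a^{\pm1},b^{\pm1}$ and composing. Analytic topology: for $r>0$ and $h$ holomorphic near $0$, $\|h\|_r=\sup_{B(r)}|h|$ if $h$ extends holomorphically to the open disc $B(r)$ of radius $r$, and $+\infty$ otherwise; a basis of open sets is given by $\{g:\|g-f\|_r<\varepsilon\}$, $f\in\mathrm{Diff}(\mathbb{C},0)$, $r,\varepsilon>0$. A $G_\delta$-dense set is a countable intersection of open dense sets. *)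

(* Defs.v *)
From Stdlib Require Import Reals List.
From Coquelicot Require Import Coquelicot.
Open Scope R_scope.

Definition cdiff_at (f : C -> C) (z : C) : Prop :=
  exists l : C, @is_derive C_AbsRing C_NormedModule f z l.

Definition ball0 (r : R) (z : C) : Prop := Cmod z < r.

Definition holo_on_ball (r : R) (f : C -> C) : Prop :=
  forall z, ball0 r z -> cdiff_at f z.

Definition near0 (P : C -> Prop) : Prop :=
  exists r, 0 < r /\ forall z, ball0 r z -> P z.

Definition germ_eq (f g : C -> C) : Prop := near0 (fun z => f z = g z).

Definition holo_germ (f : C -> C) : Prop := exists r, 0 < r /\ holo_on_ball r f.

Definition germ_inverse (f finv : C -> C) : Prop :=
  holo_germ finv /\ finv 0%C = 0%C /\
  germ_eq (fun z => finv (f z)) (fun z => z) /\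
  germ_eq (fun z => f (finv z)) (fun z => z).

Definition is_diff (f : C -> C) : Prop :=
  holo_germ f /\ f 0%C = 0%C /\ exists finv, germ_inverse f finv.

(* basic open set {g in Diff(C,0) : ||g - f||_r < eps}; ||h||_r < eps means h
   extends holomorphically to B(r) with sup over B(r) of |h| strictly below eps *)
Definition basic_nbhd (f : C -> C) (r eps : R) (g : C -> C) : Prop :=
  is_diff g /\
  exists H : C -> C, holo_on_ball r H /\
    germ_eq H (fun z => (g z - f z)%C) /\
    exists d, d < eps /\ forall z, ball0 r z -> Cmod (H z) <= d.

(* open sets of the analytic topology (subsets of Diff(C,0), as predicates on
   representatives): unions of basic open sets *)
Definition an_open (U : (C -> C) -> Prop) : Prop :=
  forall g, U g ->
    exists f r eps, is_diff f /\ 0 < r /\ 0 < eps /\ basic_nbhd f r eps g /\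
      forall g', basic_nbhd f r eps g' -> U g'.

Definition an_dense (U : (C -> C) -> Prop) : Prop :=
  forall V, an_open V -> (exists g, V g) -> exists g, V g /\ U g.

Definition G_delta_dense (H : (C -> C) -> Prop) : Prop :=
  exists Us : nat -> (C -> C) -> Prop,
    (forall n, an_open (Us n) /\ an_dense (Us n)) /\
    forall h, H h <-> forall n, Us n h.

(* words in a^{±1}, b^{±1}: a letter is (is_b, is_inverse) *)
Definition letter := (bool * bool)%type.

Definition inverse_letters (x y : letter) : Prop :=
  fst x = fst y /\ snd x <> snd y.

Fixpoint reduced (w : list letter) : Prop :=
  match w with
  | nil => True
  | x :: w' => match w' with
               | nil => True
               | y :: _ => ~ inverse_letters x y /\ reduced w'
               end
  end.

Fixpoint eval_word (w : list letter) (A Ainv B Binv : C -> C) : C -> C :=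
  match w with
  | nil => fun z => z
  | (isb, isinv) :: w' =>
      let h := if isb then (if isinv then Binv else B)
               else (if isinv then Ainv else A) in
      fun z => h (eval_word w' A Ainv B Binv z)
  end.

Definition infinite_order (f : C -> C) : Prop :=
  forall k : nat, (1 <= k)%nat -> ~ germ_eq (Nat.iter k f) (fun z => z).

(* Main.v *)
(* For a reduced word w, the set U_w of those h for which w(f, h^{-1} g h) is
   not the identity germ is open and dense; the intersection of the U_w over
   the countably many words is the required set.

   Openness: on a ball whose radius depends only on h, the composition given by
   w is defined for all small perturbations of h, it varies continuously with
   the perturbation, and if it is the identity near 0 then it is the identity on
   the whole ball.

   Density: write w as alternating powers f^m and h^{-1} g^n h and follow the
   itinerary of one small point z0 <> 0. No power f^m, g^n has a fixed point near
   0 except 0, because f and g have infinite order. Perturb h, one syllable after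
   the other, by small multiples t of a polynomial vanishing at the finitely many
   points where h has already been used: the earlier part of the itinerary does
   not change, whereas the new point moves, and each coincidence with an old
   point excludes at most one value of t. So the end point can be kept away from
   z0.

   Holomorphic functions are only assumed to be complex differentiable at each
   point; Cauchy's formula at w comes from Goursat's bisection applied to
   F(z)/(z-w) dz, pulled back by (s, t) |-> w + s (rho e^{it} - w). *)

Require Import Defs.
From Stdlib Require Import Reals List.
From Coquelicot Require Import Coquelicot.
From Stdlib Require Import Lra Lia Psatz Wf_nat ClassicalEpsilon.
Open Scope R_scope.

(** * Goursat bisection *)

(** Two functions with the same germ may differ away from 0, and an inverse germ has many
    representatives. So words are first evaluated with a concrete inverse, [inv_on], on explicit
    discs; other representatives are compared with it afterwards, through uniqueness of inverse
    germs.

    One disc serves all perturbations because every [h + q], with [q] small on a fixed disc,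
    satisfies the same estimate [|F x - F y - lam (x - y)| <= |lam| / 2 |x - y|], where [lam] and
    the radius depend only on [h] and on the disc where [q] is controlled. Cauchy's estimate turns
    the sup bound on [q] into the Lipschitz bound required here.

    Perturbing [h] also changes its inverse, so following a single [q] is not enough: the invariants
    speak of every small perturbation with prescribed values at the finitely many points already
    used. The current point has to avoid all of these points, not only the starting one, for
    otherwise the next perturbation could not move it. *)

(** Every left end lies below every right end, so the supremum of the left ends works. Besides
    bisection, this supplies the completeness used in [C_geometric_limit]. *)
Lemma nested_intervals (s : nat -> R) (x : R) :
  0 <= x ->
  (forall n, s n <= s (S n) /\ s (S n) + x / 2 ^ S n <= s n + x / 2 ^ n) ->
  exists l, forall n, s n <= l <= s n + x / 2 ^ n.
Proof.
  intros Hx Hs.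
  assert (P2 : forall n, 0 < 2 ^ n) by (intro n; apply pow_lt; lra).
  assert (P0 : forall n, 0 <= x / 2 ^ n).
  { intro n. apply Rmult_le_pos; [lra | apply Rlt_le, Rinv_0_lt_compat, P2]. }
  assert (Hg : forall n k, s n <= s (n + k)%nat /\
                 s (n + k)%nat + x / 2 ^ (n + k) <= s n + x / 2 ^ n).
  { intros n k; induction k as [|k IH].
    - rewrite Nat.add_0_r; lra.
    - rewrite Nat.add_succ_r. destruct (Hs (n + k)%nat); lra. }
  assert (Hup : forall m n, s m <= s n + x / 2 ^ n).
  { intros m n. destruct (Nat.le_ge_cases m n) as [H|H].
    - replace n with (m + (n - m))%nat by lia.
      destruct (Hg m (n - m)%nat). specialize (P0 (m + (n - m))%nat). lra.
    - replace m with (n + (m - n))%nat by lia.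
      destruct (Hg n (m - n)%nat). specialize (P0 (n + (m - n))%nat). lra. }
  destruct (completeness (fun y => exists n, y = s n)) as [l [Hl1 Hl2]].
  - exists (s 0%nat + x / 2 ^ 0). intros y [n ->]. apply Hup.
  - exists (s 0%nat), 0%nat; reflexivity.
  - exists l. intro n; split.
    + apply Hl1. exists n; reflexivity.
    + apply Hl2. intros y [m ->]. apply Hup.
Qed.

Lemma half_large (z z1 z2 : C) :
  z = (z1 + z2)%C -> Cmod z / 2 <= Cmod z1 \/ Cmod z / 2 <= Cmod z2.
Proof.
  intros ->. pose proof (Cmod_triangle z1 z2).
  destruct (Rle_dec (Cmod (z1 + z2) / 2) (Cmod z1)); [left | right]; lra.
Qed.

Lemma pow2_small (x e : R) : 0 < e -> exists n, x / 2 ^ n < e.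
Proof.
  intro He.
  destruct (pow_lt_1_zero (/ 2)) with (y := e / (Rabs x + 1)) as [N HN].
  - rewrite Rabs_pos_eq; lra.
  - apply Rdiv_lt_0_compat; [lra | pose proof (Rabs_pos x); lra].
  - exists N. specialize (HN N (Nat.le_refl _)).
    rewrite pow_inv, Rabs_pos_eq in HN
      by (apply Rlt_le, Rinv_0_lt_compat, pow_lt; lra).
    assert (0 < / 2 ^ N) by (apply Rinv_0_lt_compat, pow_lt; lra).
    pose proof (Rabs_pos x). pose proof (Rle_abs x).
    apply Rle_lt_trans with ((Rabs x + 1) * / 2 ^ N).
    + unfold Rdiv; nra.
    + apply (Rmult_lt_compat_l (Rabs x + 1)) in HN; [|lra].
      replace ((Rabs x + 1) * (e / (Rabs x + 1))) with e in HN by (field; lra).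
      exact HN.
Qed.

(** Goursat's argument freed from integrals. Halving both sides keeps at least a quarter of [|J|],
    while the squared sum of the sides is divided by exactly four; a bound of order o(size^2) at the
    limit point then leaves only [J = 0]. *)
Lemma bisection (J : R -> R -> R -> R -> C) (a b c d : R) :
  a <= b -> c <= d ->
  (forall s1 s2 t1 t2, a <= s1 -> s1 <= s2 -> s2 <= b -> c <= t1 -> t1 <= t2 -> t2 <= d ->
     J s1 s2 t1 t2 = (J s1 ((s1 + s2) / 2)%R t1 t2 + J ((s1 + s2) / 2)%R s2 t1 t2)%C /\
     J s1 s2 t1 t2 = (J s1 s2 t1 ((t1 + t2) / 2)%R + J s1 s2 ((t1 + t2) / 2)%R t2)%C) ->
  (forall eps, 0 < eps -> forall s0 t0, a <= s0 <= b -> c <= t0 <= d ->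
     exists del, 0 < del /\
       forall s1 s2 t1 t2, a <= s1 -> s1 <= s0 -> s0 <= s2 -> s2 <= b ->
         c <= t1 -> t1 <= t0 -> t0 <= t2 -> t2 <= d ->
         s2 - s1 < del -> t2 - t1 < del ->
         Cmod (J s1 s2 t1 t2) <= eps * ((s2 - s1) + (t2 - t1)) ^ 2) ->
  J a b c d = 0%C.
Proof.
  intros Hab Hcd Hadd Hloc.
  set (K := fun (p : R * R) (n : nat) =>
              Cmod (J (fst p) (fst p + (b - a) / 2 ^ n)
                      (snd p) (snd p + (d - c) / 2 ^ n))).
  set (ok := fun (p : R * R) (n : nat) =>
               a <= fst p /\ fst p + (b - a) / 2 ^ n <= b /\
               c <= snd p /\ snd p + (d - c) / 2 ^ n <= d).
  assert (P2 : forall n, 0 < 2 ^ n) by (intro n; apply pow_lt; lra).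
  assert (Hnn : forall n x, 0 <= x -> 0 <= x / 2 ^ n).
  { intros n x Hx. apply Rmult_le_pos; [lra | apply Rlt_le, Rinv_0_lt_compat, P2]. }
  assert (Hh : forall x n, x / 2 ^ S n = x / 2 ^ n / 2).
  { intros x n. specialize (P2 n). simpl. field. lra. }
  (* The premise [ok p n] stands under the existential so that choice gives a total successor
     function; [(0, 0)] is the value for bad inputs. *)
  assert (Hstep : forall p n, exists q, ok p n ->
    ok q (S n) /\ K p n / 4 <= K q (S n) /\
    (fst p <= fst q /\ fst q + (b - a) / 2 ^ S n <= fst p + (b - a) / 2 ^ n) /\
    (snd p <= snd q /\ snd q + (d - c) / 2 ^ S n <= snd p + (d - c) / 2 ^ n)).
  { intros [s t] n. destruct (classic (ok (s, t) n)) as [Hok|]; [|exists (0, 0); tauto].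
    unfold K, ok in *; simpl fst in *; simpl snd in *.
    pose proof (Hnn n (b - a) ltac:(lra)) as Hx.
    pose proof (Hnn n (d - c) ltac:(lra)) as Hy.
    rewrite !Hh. set (x := (b - a) / 2 ^ n) in *. set (y := (d - c) / 2 ^ n) in *.
    destruct (Hadd s (s + x) t (t + y)) as [E1 _]; try lra.
    replace ((s + (s + x)) / 2) with (s + x / 2) in E1 by field.
    assert (exists s', (s' = s \/ s' = s + x / 2) /\
              Cmod (J s (s + x) t (t + y)) / 2 <= Cmod (J s' (s' + x / 2) t (t + y)))
      as (s' & Hs' & Hm).
    { destruct (half_large _ _ _ E1) as [H|H].
      - exists s; auto.
      - exists (s + x / 2). replace (s + x / 2 + x / 2) with (s + x) by field. auto. }
    destruct (Hadd s' (s' + x / 2) t (t + y)) as [_ E2]; try (destruct Hs'; lra).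
    replace ((t + (t + y)) / 2) with (t + y / 2) in E2 by field.
    assert (exists t', (t' = t \/ t' = t + y / 2) /\
              Cmod (J s' (s' + x / 2) t (t + y)) / 2 <= Cmod (J s' (s' + x / 2) t' (t' + y / 2)))
      as (t' & Ht' & Hm').
    { destruct (half_large _ _ _ E2) as [H|H].
      - exists t; auto.
      - exists (t + y / 2). replace (t + y / 2 + y / 2) with (t + y) by field. auto. }
    exists (s', t'); simpl fst; simpl snd; intros _.
    destruct Hs', Ht'; repeat split; lra. }
  set (nxt := fun p n => proj1_sig (constructive_indefinite_description _ (Hstep p n))).
  set (sq := fix sq n := match n with O => (a, c) | S n => nxt (sq n) n end).
  assert (Hok : forall n, ok (sq n) n).
  { induction n as [|n IH].
    - unfold ok; simpl; lra.
    - simpl. unfold nxt. destruct (constructive_indefinite_description _ _) as [q Hq]; simpl.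
      apply Hq, IH. }
  assert (Hsq : forall n, K (sq n) n / 4 <= K (sq (S n)) (S n) /\
    (fst (sq n) <= fst (sq (S n)) /\
     fst (sq (S n)) + (b - a) / 2 ^ S n <= fst (sq n) + (b - a) / 2 ^ n) /\
    (snd (sq n) <= snd (sq (S n)) /\
     snd (sq (S n)) + (d - c) / 2 ^ S n <= snd (sq n) + (d - c) / 2 ^ n)).
  { intro n. simpl sq. unfold nxt at 1 2 3 4 5.
    destruct (constructive_indefinite_description _ _) as [q Hq]; simpl proj1_sig.
    apply Hq, Hok. }
  destruct (nested_intervals (fun n => fst (sq n)) (b - a)) as [s0 Hs0];
    [lra | intro n; apply Hsq |].
  destruct (nested_intervals (fun n => snd (sq n)) (d - c)) as [t0 Ht0];
    [lra | intro n; apply Hsq |].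
  assert (HK : forall n, Cmod (J a b c d) / 4 ^ n <= K (sq n) n).
  { induction n as [|n IH].
    - unfold K; simpl. replace (a + (b - a) / 1) with b by field.
      replace (c + (d - c) / 1) with d by field. lra.
    - destruct (Hsq n) as [H _]. simpl.
      assert (0 < 4 ^ n) by (apply pow_lt; lra).
      replace (Cmod (J a b c d) / (4 * 4 ^ n)) with (Cmod (J a b c d) / 4 ^ n / 4)
        by (field; lra). simpl in H. lra. }
  apply Cmod_eq_0, Rle_antisym; [|apply Cmod_ge_0].
  apply Rnot_lt_le; intro Hpos.
  set (L := (b - a) + (d - c)).
  assert (HL : 0 <= L) by (unfold L; lra).
  (* With this tolerance the local bound reads [|J| <= |J| * L^2 / (2 (L^2 + 1))], a contradiction;
     the [+ 1] covers [L = 0]. *)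
  destruct (Hloc (Cmod (J a b c d) / (2 * (L ^ 2 + 1)))) with (s0 := s0) (t0 := t0)
    as (del & Hd & HJ).
  - apply Rdiv_lt_0_compat; [exact Hpos | nra].
  - specialize (Hs0 0%nat); simpl in Hs0. lra.
  - specialize (Ht0 0%nat); simpl in Ht0. lra.
  - destruct (pow2_small L del Hd) as [n Hn].
    specialize (HK n). unfold K in HK.
    destruct (Hok n) as (O1 & O2 & O3 & O4). specialize (Hs0 n). specialize (Ht0 n).
    simpl in Hs0, Ht0.
    pose proof (Hnn n (b - a) ltac:(lra)) as Hx.
    pose proof (Hnn n (d - c) ltac:(lra)) as Hy.
    replace (L / 2 ^ n) with ((b - a) / 2 ^ n + (d - c) / 2 ^ n) in Hn
      by (unfold L; specialize (P2 n); field; lra).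
    specialize (HJ (fst (sq n)) (fst (sq n) + (b - a) / 2 ^ n)
                   (snd (sq n)) (snd (sq n) + (d - c) / 2 ^ n)).
    assert (HJ' := Rle_trans _ _ _ HK (HJ ltac:(lra) ltac:(lra) ltac:(lra) ltac:(lra)
       ltac:(lra) ltac:(lra) ltac:(lra) ltac:(lra) ltac:(lra) ltac:(lra))).
    replace (fst (sq n) + (b - a) / 2 ^ n - fst (sq n) +
             (snd (sq n) + (d - c) / 2 ^ n - snd (sq n))) with (L / 2 ^ n) in HJ'
      by (unfold L; specialize (P2 n); field; lra).
    specialize (P2 n).
    replace (4 ^ n) with (2 ^ n * 2 ^ n) in HJ'
      by (rewrite <- Rpow_mult_distr; f_equal; lra).
    apply (Rmult_le_compat_r (2 ^ n * 2 ^ n)) in HJ'; [|nra].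
    replace (Cmod (J a b c d) / (2 ^ n * 2 ^ n) * (2 ^ n * 2 ^ n)) with (Cmod (J a b c d))
      in HJ' by (field; lra).
    replace (Cmod (J a b c d) / (2 * (L ^ 2 + 1)) * (L / 2 ^ n) ^ 2 * (2 ^ n * 2 ^ n))
      with (Cmod (J a b c d) * (L ^ 2 / (2 * (L ^ 2 + 1)))) in HJ' by (field; split; nra).
    assert (L ^ 2 / (2 * (L ^ 2 + 1)) < 1).
    { apply (Rmult_lt_reg_r (2 * (L ^ 2 + 1))); [nra|].
      unfold Rdiv; rewrite Rmult_assoc, Rinv_l by nra. nra. }
    nra.
Qed.

(** * Complex derivatives *)

Definition has_cderiv (f : C -> C) (z l : C) : Prop :=
  forall eps, 0 < eps -> exists del, 0 < del /\
    forall y, Cmod (y - z) < del -> Cmod (f y - f z - l * (y - z)) <= eps * Cmod (y - z).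

Lemma cdiff_atP (f : C -> C) (z : C) : cdiff_at f z <-> exists l, has_cderiv f z l.
Proof.
  split; intros [l H]; exists l.
  - destruct H as [_ H]. intros eps He.
    destruct (H z (fun P HP => HP) (mkposreal eps He)) as [[d Hd] Hy].
    exists d. split; [exact Hd|]. intros y Y. specialize (Hy y Y).
    change (Cmod (f y - f z - (y - z) * l) <= eps * Cmod (y - z))%R in Hy.
    rewrite (Cmult_comm l). exact Hy.
  - split.
    + apply is_linear_scal_l.
    + intros x Hx eps.
      assert (E : z = x)
        by exact (is_filter_lim_locally_unique (V := AbsRing_NormedModule C_AbsRing) z x Hx).
      subst x. destruct (H eps (cond_pos eps)) as (d & Hd & Hy).
      exists (mkposreal d Hd). intros y Y. specialize (Hy y Y).
      change (Cmod (f y - f z - (y - z) * l) <= eps * Cmod (y - z))%R.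
      rewrite (Cmult_comm (y - z)). exact Hy.
Qed.

Lemma has_cderiv_cont (f : C -> C) (z l : C) : has_cderiv f z l ->
  forall eps, 0 < eps -> exists del, 0 < del /\
    forall y, Cmod (y - z) < del -> Cmod (f y - f z) < eps.
Proof.
  intros H eps He. destruct (H 1 Rlt_0_1) as (d & Hd & Hy).
  pose proof (Cmod_ge_0 l).
  exists (Rmin d (eps / (Cmod l + 2))). split.
  - apply Rmin_glb_lt; [lra|]. apply Rdiv_lt_0_compat; lra.
  - intros y Y. specialize (Hy y (Rlt_le_trans _ _ _ Y (Rmin_l _ _))).
    assert (Y' := Rlt_le_trans _ _ _ Y (Rmin_r _ _)).
    apply (Rmult_lt_compat_r (Cmod l + 2)) in Y'; [|lra].
    replace (eps / (Cmod l + 2) * (Cmod l + 2)) with eps in Y' by (field; lra).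
    replace (f y - f z)%C with ((f y - f z - l * (y - z)) + l * (y - z))%C by ring.
    eapply Rle_lt_trans; [apply Cmod_triangle|]. rewrite Cmod_mult.
    pose proof (Cmod_ge_0 (y - z)). nra.
Qed.

Lemma Cmod_triangle_inv (a b : C) : Cmod a - Cmod b <= Cmod (a - b).
Proof.
  pose proof (Cmod_triangle (a - b) b). replace (a - b + b)%C with a in H by ring. lra.
Qed.

Lemma has_cderiv_plus (f g : C -> C) (z l m : C) :
  has_cderiv f z l -> has_cderiv g z m -> has_cderiv (fun x => f x + g x)%C z (l + m)%C.
Proof.
  intros Hf Hg eps He.
  destruct (Hf (eps / 2)) as (d1 & P1 & H1); [lra|].
  destruct (Hg (eps / 2)) as (d2 & P2 & H2); [lra|].
  exists (Rmin d1 d2). split; [apply Rmin_glb_lt; auto|]. intros y Hy.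
  specialize (H1 y (Rlt_le_trans _ _ _ Hy (Rmin_l _ _))).
  specialize (H2 y (Rlt_le_trans _ _ _ Hy (Rmin_r _ _))).
  replace (f y + g y - (f z + g z) - (l + m) * (y - z))%C with
    ((f y - f z - l * (y - z)) + (g y - g z - m * (y - z)))%C by ring.
  eapply Rle_trans; [apply Cmod_triangle|]. lra.
Qed.

Lemma has_cderiv_scal (k : C) (f : C -> C) (z l : C) :
  has_cderiv f z l -> has_cderiv (fun x => k * f x)%C z (k * l)%C.
Proof.
  intros Hf eps He. pose proof (Cmod_ge_0 k).
  destruct (Hf (eps / (Cmod k + 1))) as (d & P & H1); [apply Rdiv_lt_0_compat; lra|].
  exists d. split; [exact P|]. intros y Hy. specialize (H1 y Hy).
  replace (k * f y - k * f z - k * l * (y - z))%C with (k * (f y - f z - l * (y - z)))%C by ring.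
  rewrite Cmod_mult.
  apply (Rmult_le_compat_l (Cmod k + 1)) in H1; [|lra].
  replace ((Cmod k + 1) * (eps / (Cmod k + 1) * Cmod (y - z))) with (eps * Cmod (y - z))
    in H1 by (field; lra).
  pose proof (Cmod_ge_0 (f y - f z - l * (y - z))). nra.
Qed.

Lemma has_cderiv_const (k z : C) : has_cderiv (fun _ => k) z 0.
Proof.
  intros eps He. exists 1. split; [lra|]. intros y _.
  replace (k - k - 0 * (y - z))%C with (RtoC 0) by ring. rewrite Cmod_0.
  pose proof (Cmod_ge_0 (y - z)). nra.
Qed.

Lemma has_cderiv_id (z : C) : has_cderiv (fun x => x) z 1.
Proof.
  intros eps He. exists 1. split; [lra|]. intros y _.
  replace (y - z - 1 * (y - z))%C with (RtoC 0) by ring. rewrite Cmod_0.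
  pose proof (Cmod_ge_0 (y - z)). nra.
Qed.

Lemma has_cderiv_comp (f g : C -> C) (z l m : C) :
  has_cderiv g z m -> has_cderiv f (g z) l -> has_cderiv (fun x => f (g x)) z (l * m)%C.
Proof.
  intros Hg Hf eps He.
  pose proof (Cmod_ge_0 l). pose proof (Cmod_ge_0 m).
  set (e1 := eps / (2 * (Cmod m + 1))).
  assert (He1 : 0 < e1) by (apply Rdiv_lt_0_compat; lra).
  destruct (Hf e1 He1) as (d1 & P1 & H1).
  set (e2 := Rmin 1 (eps / (2 * (Cmod l + 1)))).
  assert (He2 : 0 < e2) by (apply Rmin_glb_lt; [lra | apply Rdiv_lt_0_compat; lra]).
  destruct (Hg e2 He2) as (d2 & P2 & H2).
  destruct (has_cderiv_cont _ _ _ Hg d1 P1) as (d3 & P3 & H3).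
  exists (Rmin d2 d3). split; [apply Rmin_glb_lt; auto|]. intros y Hy.
  specialize (H2 y (Rlt_le_trans _ _ _ Hy (Rmin_l _ _))).
  specialize (H3 y (Rlt_le_trans _ _ _ Hy (Rmin_r _ _))).
  specialize (H1 (g y) H3).
  replace (f (g y) - f (g z) - l * m * (y - z))%C with
    ((f (g y) - f (g z) - l * (g y - g z)) + l * (g y - g z - m * (y - z)))%C by ring.
  eapply Rle_trans; [apply Cmod_triangle|]. rewrite Cmod_mult.
  assert (Hgy : Cmod (g y - g z) <= (Cmod m + 1) * Cmod (y - z)).
  { replace (g y - g z)%C with ((g y - g z - m * (y - z)) + m * (y - z))%C by ring.
    eapply Rle_trans; [apply Cmod_triangle|]. rewrite Cmod_mult.
    assert (e2 <= 1) by apply Rmin_l. pose proof (Cmod_ge_0 (y - z)). nra. }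
  pose proof (Cmod_ge_0 (y - z)) as Hyz.
  assert (A1 : e1 * Cmod (g y - g z) <= eps / 2 * Cmod (y - z)).
  { apply Rle_trans with (e1 * ((Cmod m + 1) * Cmod (y - z))).
    - apply Rmult_le_compat_l; lra.
    - right. unfold e1. field. lra. }
  assert (A2 : Cmod l * (e2 * Cmod (y - z)) <= eps / 2 * Cmod (y - z)).
  { rewrite <- Rmult_assoc. apply Rmult_le_compat_r; [lra|].
    assert (E : e2 <= eps / (2 * (Cmod l + 1))) by apply Rmin_r.
    apply (Rmult_le_compat_l (Cmod l + 1)) in E; [|lra].
    replace ((Cmod l + 1) * (eps / (2 * (Cmod l + 1)))) with (eps / 2) in E by (field; lra).
    nra. }
  pose proof (Rmult_le_compat_l _ _ _ H H2). lra.
Qed.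

Lemma has_cderiv_inv (z : C) : z <> 0%C -> has_cderiv (fun x => / x)%C z (- / (z * z))%C.
Proof.
  intros Hz eps He.
  assert (Pz : 0 < Cmod z) by (apply Cmod_gt_0; exact Hz).
  set (c := Cmod z). fold c in Pz.
  exists (Rmin (c / 2) (eps * (c ^ 3 / 2))). split.
  { apply Rmin_glb_lt; [lra|]. apply Rmult_lt_0_compat; [lra|].
    assert (0 < c ^ 3) by (apply pow_lt; lra). lra. }
  intros y Hy.
  assert (Y1 := Rlt_le_trans _ _ _ Hy (Rmin_l _ _)).
  assert (Y2 := Rlt_le_trans _ _ _ Hy (Rmin_r _ _)).
  assert (Hyc : c / 2 <= Cmod y).
  { pose proof (Cmod_triangle_inv z y). replace (z - y)%C with (- (y - z))%C in H by ring.
    rewrite Cmod_opp in H. unfold c in *. lra. }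
  assert (Hy0 : y <> 0%C) by (apply Cmod_gt_0; lra).
  replace (/ y - / z - - / (z * z) * (y - z))%C with
    ((y - z) * ((y - z) * / (z * (z * y))))%C by (field; auto).
  rewrite 2!Cmod_mult, Cmod_inv, 2!Cmod_mult by (repeat apply Cmult_neq_0; auto).
  fold c. rewrite Rmult_comm. apply Rmult_le_compat_r; [apply Cmod_ge_0|].
  assert (0 < c * (c * Cmod y)) by (apply Rmult_lt_0_compat; [lra|apply Rmult_lt_0_compat; lra]).
  apply (Rmult_le_reg_r (c * (c * Cmod y))); [lra|].
  rewrite Rmult_assoc, Rinv_l by lra.
  assert (eps * (c ^ 3 / 2) <= eps * (c * (c * Cmod y))).
  { apply Rmult_le_compat_l; [lra|]. simpl. nra. }
  lra.
Qed.

Lemma has_cderiv_mult (f g : C -> C) (z l m : C) :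
  has_cderiv f z l -> has_cderiv g z m ->
  has_cderiv (fun x => f x * g x)%C z (l * g z + f z * m)%C.
Proof.
  intros Hf Hg eps He.
  pose proof (Cmod_ge_0 (f z)). pose proof (Cmod_ge_0 (g z)). pose proof (Cmod_ge_0 l).
  set (k := 3 * (Cmod (f z) + Cmod (g z) + Cmod l + 1)).
  assert (Hk : 0 < k) by (unfold k; lra).
  assert (Hek : 0 < eps / k) by (apply Rdiv_lt_0_compat; lra).
  destruct (Hf _ Hek) as (d1 & P1 & Hu).
  destruct (Hg _ Hek) as (d2 & P2 & Hv).
  destruct (has_cderiv_cont _ _ _ Hg (Rmin 1 (eps / k))) as (d3 & P3 & Hw);
    [apply Rmin_glb_lt; lra|].
  exists (Rmin d1 (Rmin d2 d3)). split; [repeat apply Rmin_glb_lt; auto|]. intros y Hy.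
  specialize (Hu y (Rlt_le_trans _ _ _ Hy (Rmin_l _ _))).
  specialize (Hv y (Rlt_le_trans _ _ _ Hy (Rle_trans _ _ _ (Rmin_r _ _) (Rmin_l _ _)))).
  specialize (Hw y (Rlt_le_trans _ _ _ Hy (Rle_trans _ _ _ (Rmin_r _ _) (Rmin_r _ _)))).
  assert (H3a := Rlt_le_trans _ _ _ Hw (Rmin_l _ _)).
  assert (H3b := Rlt_le_trans _ _ _ Hw (Rmin_r _ _)).
  replace (f y * g y - f z * g z - (l * g z + f z * m) * (y - z))%C with
    ((f y - f z - l * (y - z)) * g y + (l * (y - z) * (g y - g z) +
      f z * (g y - g z - m * (y - z))))%C by ring.
  eapply Rle_trans; [apply Cmod_triangle|].
  eapply Rle_trans; [apply Rplus_le_compat_l, Cmod_triangle|].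
  rewrite !Cmod_mult.
  pose proof (Cmod_ge_0 (y - z)) as Hyz. pose proof (Cmod_ge_0 (g y - g z)).
  pose proof (Cmod_ge_0 (f y - f z - l * (y - z))).
  assert (Hgy : Cmod (g y) <= Cmod (g z) + 1).
  { pose proof (Cmod_triangle_inv (g y) (g z)). lra. }
  set (Y := Cmod (y - z)) in *. set (q := eps / k) in *.
  assert (A1 : Cmod (f y - f z - l * (y - z)) * Cmod (g y) <= q * Y * (Cmod (g z) + 1)).
  { apply Rmult_le_compat; try apply Cmod_ge_0; lra. }
  assert (A2 : Cmod l * Y * Cmod (g y - g z) <= Cmod l * Y * q).
  { apply Rmult_le_compat_l; [nra | lra]. }
  assert (A3 : Cmod (f z) * Cmod (g y - g z - m * (y - z)) <= Cmod (f z) * (q * Y)).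
  { apply Rmult_le_compat_l; lra. }
  assert (E : eps * Y = q * Y * k) by (unfold q; field; lra).
  rewrite E. unfold k. assert (0 <= q * Y) by nra. nra.
Qed.

(** * Integrals of complex-valued functions *)

Definition Ccont (f : R -> C) (t : R) : Prop :=
  forall eps, 0 < eps -> exists del, 0 < del /\
    forall u, Rabs (u - t) < del -> Cmod (f u - f t) < eps.

Notation exCint := (@ex_RInt C_R_CompleteNormedModule).
Definition Cint (f : R -> C) (a b : R) : C := @RInt C_R_CompleteNormedModule f a b.

Lemma Ccont_ex_RInt (f : R -> C) (a b : R) :
  a <= b -> (forall t, a <= t <= b -> Ccont f t) -> exCint f a b.
Proof.
  intros Hab H. apply (ex_RInt_continuous (V := C_R_CompleteNormedModule)).
  rewrite Rmin_left, Rmax_right by lra.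
  intros t Ht P [d HP]. destruct (H t Ht d (cond_pos d)) as (del & Hd & Hu).
  exists (mkposreal del Hd). intros u Bu. apply HP.
  apply C_NormedModule_mixin_compat1, Hu, Bu.
Qed.

Lemma Cint_plus (f g : R -> C) (a b : R) : exCint f a b -> exCint g a b ->
  Cint (fun t => f t + g t)%C a b = (Cint f a b + Cint g a b)%C.
Proof. exact (RInt_plus (V := C_R_CompleteNormedModule) f g a b). Qed.

Lemma Cint_const (k : C) (a b : R) : Cint (fun _ => k) a b = ((b - a)%R * k)%C.
Proof.
  rewrite <- scal_R_Cmult. exact (RInt_const (V := C_R_CompleteNormedModule) a b k).
Qed.

Lemma Cint_Chasles (f : R -> C) (a b c : R) : exCint f a b -> exCint f b c ->
  Cint f a c = (Cint f a b + Cint f b c)%C.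
Proof. intros H1 H2. symmetry. exact (RInt_Chasles (V := C_R_CompleteNormedModule) f a b c H1 H2). Qed.

Lemma Cint_ext (f g : R -> C) (a b : R) : (forall t, f t = g t) -> Cint f a b = Cint g a b.
Proof. intro H. apply (RInt_ext (V := C_R_CompleteNormedModule)). intros; apply H. Qed.

Lemma is_Cint_pair (f : R -> C) (a b : R) (l1 l2 : R) :
  is_RInt (fun t => fst (f t)) a b l1 -> is_RInt (fun t => snd (f t)) a b l2 ->
  @is_RInt C_R_CompleteNormedModule f a b (l1, l2).
Proof.
  intros H1 H2.
  exact (is_RInt_fct_extend_pair (U := R_NormedModule) (V := R_NormedModule) f a b l1 l2 H1 H2).
Qed.

Lemma is_Cint_components (f : R -> C) (a b : R) : exCint f a b ->
  is_RInt (fun t => fst (f t)) a b (fst (Cint f a b)) /\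
  is_RInt (fun t => snd (f t)) a b (snd (Cint f a b)).
Proof.
  intro H. apply (RInt_correct (V := C_R_CompleteNormedModule)) in H. split.
  - exact (is_RInt_fct_extend_fst (U := R_NormedModule) (V := R_NormedModule) f a b _ H).
  - exact (is_RInt_fct_extend_snd (U := R_NormedModule) (V := R_NormedModule) f a b _ H).
Qed.

(** The integral lives in C as a real vector space, whose linearity covers real scalars only; a
    complex factor has to go through real and imaginary parts. *)
Lemma Cint_scal (k : C) (f : R -> C) (a b : R) : exCint f a b ->
  exCint (fun t => k * f t)%C a b /\ Cint (fun t => k * f t)%C a b = (k * Cint f a b)%C.
Proof.
  intro H. destruct (is_Cint_components f a b H) as [H1 H2].
  assert (HI : @is_RInt C_R_CompleteNormedModule (fun t => k * f t)%C a b (k * Cint f a b)%C).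
  { apply is_Cint_pair.
    - exact (is_RInt_minus _ _ _ _ _ _ (is_RInt_scal _ _ _ (fst k) _ H1)
               (is_RInt_scal _ _ _ (snd k) _ H2)).
    - exact (is_RInt_plus _ _ _ _ _ _ (is_RInt_scal _ _ _ (fst k) _ H2)
               (is_RInt_scal _ _ _ (snd k) _ H1)). }
  split; [eexists; exact HI | exact (is_RInt_unique _ _ _ _ HI)].
Qed.

Lemma Cint_conj (f : R -> C) (a b : R) : exCint f a b ->
  Cint (fun t => Cconj (f t)) a b = Cconj (Cint f a b).
Proof.
  intro H. destruct (is_Cint_components f a b H) as [H1 H2].
  unfold Cint; apply (is_RInt_unique (V := C_R_CompleteNormedModule)), is_Cint_pair; simpl.
  - exact H1.
  - exact (is_RInt_opp _ _ _ _ H2).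
Qed.

Lemma norm_Cmod (z : C) : @norm R_AbsRing C_R_CompleteNormedModule z = Cmod z.
Proof.
  change (sqrt (Rabs (fst z) ^ 2 + Rabs (snd z) ^ 2) = sqrt (fst z ^ 2 + snd z ^ 2)).
  rewrite !RPow_abs, !(Rabs_pos_eq _ (pow2_ge_0 _)). reflexivity.
Qed.

Lemma Cint_bound (f : R -> C) (a b M : R) : a <= b -> exCint f a b ->
  (forall t, a <= t <= b -> Cmod (f t) <= M) -> Cmod (Cint f a b) <= (b - a) * M.
Proof.
  intros Hab H HM. rewrite <- norm_Cmod.
  apply (norm_RInt_le f (fun _ => M) a b (Cint f a b)); auto.
  - intros t Ht. rewrite norm_Cmod. auto.
  - apply (RInt_correct (V := C_R_CompleteNormedModule)), H.
  - exact (is_RInt_const (V := R_NormedModule) a b M).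
Qed.

Lemma Ccont_const (k : C) (t : R) : Ccont (fun _ => k) t.
Proof.
  intros eps He. exists 1. split; [lra|]. intros u _.
  replace (k - k)%C with (RtoC 0) by ring. rewrite Cmod_0. exact He.
Qed.

Lemma Ccont_RtoC (t : R) : Ccont RtoC t.
Proof.
  intros eps He. exists eps. split; [lra|]. intros u Hu.
  rewrite <- RtoC_minus, Cmod_R. exact Hu.
Qed.

Lemma Ccont_plus (f g : R -> C) (t : R) :
  Ccont f t -> Ccont g t -> Ccont (fun u => f u + g u)%C t.
Proof.
  intros Hf Hg eps He.
  destruct (Hf (eps / 2)) as (d1 & P1 & H1); [lra|].
  destruct (Hg (eps / 2)) as (d2 & P2 & H2); [lra|].
  exists (Rmin d1 d2). split; [apply Rmin_glb_lt; auto|]. intros u Hu.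
  specialize (H1 u (Rlt_le_trans _ _ _ Hu (Rmin_l _ _))).
  specialize (H2 u (Rlt_le_trans _ _ _ Hu (Rmin_r _ _))).
  replace (f u + g u - (f t + g t))%C with ((f u - f t) + (g u - g t))%C by ring.
  eapply Rle_lt_trans; [apply Cmod_triangle|]. lra.
Qed.

Lemma Ccont_mult (f g : R -> C) (t : R) :
  Ccont f t -> Ccont g t -> Ccont (fun u => f u * g u)%C t.
Proof.
  intros Hf Hg eps He.
  pose proof (Cmod_ge_0 (f t)) as Pf. pose proof (Cmod_ge_0 (g t)) as Pg.
  set (k := Cmod (f t) + Cmod (g t) + 1).
  assert (Hk : 0 < eps / k) by (apply Rdiv_lt_0_compat; unfold k; lra).
  destruct (Hf (Rmin 1 (eps / k))) as (d1 & P1 & H1); [apply Rmin_glb_lt; lra|].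
  destruct (Hg (eps / k)) as (d2 & P2 & H2); [lra|].
  exists (Rmin d1 d2). split; [apply Rmin_glb_lt; auto|]. intros u Hu.
  specialize (H1 u (Rlt_le_trans _ _ _ Hu (Rmin_l _ _))).
  specialize (H2 u (Rlt_le_trans _ _ _ Hu (Rmin_r _ _))).
  assert (H1a := Rlt_le_trans _ _ _ H1 (Rmin_l _ _)).
  assert (H1b := Rlt_le_trans _ _ _ H1 (Rmin_r _ _)).
  replace (f u * g u - f t * g t)%C with
    ((f u - f t) * (g u - g t) + ((f u - f t) * g t + f t * (g u - g t)))%C by ring.
  eapply Rle_lt_trans; [apply Cmod_triangle|].
  eapply Rle_lt_trans; [apply Rplus_le_compat_l, Cmod_triangle|].
  rewrite !Cmod_mult.
  pose proof (Cmod_ge_0 (f u - f t)). pose proof (Cmod_ge_0 (g u - g t)).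
  set (q := eps / k) in *.
  replace eps with (q * k) by (unfold q, k; field; lra).
  unfold k. nra.
Qed.

Lemma Ccont_comp (F : C -> C) (f : R -> C) (t : R) (l : C) :
  has_cderiv F (f t) l -> Ccont f t -> Ccont (fun u => F (f u)) t.
Proof.
  intros HF Hf eps He.
  destruct (has_cderiv_cont _ _ _ HF eps He) as (d & P & H).
  destruct (Hf d P) as (d' & P' & H').
  exists d'. split; [exact P'|]. intros u Hu. apply H, H', Hu.
Qed.

Lemma Ccont_inv (f : R -> C) (t : R) : f t <> 0%C -> Ccont f t -> Ccont (fun u => / f u)%C t.
Proof. intros H. apply (Ccont_comp Cinv f t _ (has_cderiv_inv _ H)). Qed.

Lemma Ccont_opp (f : R -> C) (t : R) : Ccont f t -> Ccont (fun u => - f u)%C t.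
Proof.
  intros Hf eps He. destruct (Hf eps He) as (d & P & H). exists d. split; [exact P|].
  intros u Hu. replace (- f u - - f t)%C with (- (f u - f t))%C by ring.
  rewrite Cmod_opp. auto.
Qed.

Lemma Ccont_minus (f g : R -> C) (t : R) :
  Ccont f t -> Ccont g t -> Ccont (fun u => f u - g u)%C t.
Proof. intros Hf Hg. apply Ccont_plus; [exact Hf | apply Ccont_opp, Hg]. Qed.

Definition expi (t : R) : C := (cos t, sin t).

Lemma Cmod_expi (t : R) : Cmod (expi t) = 1.
Proof.
  unfold Cmod, expi; simpl. pose proof (sin2_cos2 t) as H. unfold Rsqr in H.
  replace (cos t * (cos t * 1) + sin t * (sin t * 1)) with 1 by lra. apply sqrt_1.
Qed.

Lemma derivable_bound_lipschitz (f f' : R -> R) (u t : R) :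
  (forall x, is_derive f x (f' x)) -> (forall x, Rabs (f' x) <= 1) ->
  Rabs (f u - f t) <= Rabs (u - t).
Proof.
  intros Hd Hb. destruct (MVT_gen f t u f') as (c & _ & E).
  - intros; apply Hd.
  - intros.
    apply continuity_pt_filterlim. apply (ex_derive_continuous (K := R_AbsRing) (V := R_NormedModule)).
    eexists; apply Hd.
  - rewrite E, Rabs_mult. rewrite <- (Rmult_1_l (Rabs (u - t))) at 2.
    apply Rmult_le_compat_r; [apply Rabs_pos | apply Hb].
Qed.

Lemma expi_lipschitz (u t : R) : Cmod (expi u - expi t) <= 2 * Rabs (u - t).
Proof.
  assert (H1 : Rabs (cos u - cos t) <= Rabs (u - t)).
  { apply derivable_bound_lipschitz with (f' := fun x => - sin x).
    - intro x. auto_derive; [exact I | ring].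
    - intro x. rewrite Rabs_Ropp. apply Rabs_le, SIN_bound. }
  assert (H2 : Rabs (sin u - sin t) <= Rabs (u - t)).
  { apply derivable_bound_lipschitz with (f' := cos).
    - intro x. auto_derive; [exact I | ring].
    - intro x. apply Rabs_le, COS_bound. }
  replace (expi u - expi t)%C with ((cos u - cos t)%R + (0, sin u - sin t)%R)%C
    by (unfold expi, Cminus, Cplus, Copp, RtoC; simpl; f_equal; ring).
  eapply Rle_trans; [apply Cmod_triangle|]. rewrite Cmod_R.
  assert (E : Cmod (0, sin u - sin t)%R = Rabs (sin u - sin t)).
  { unfold Cmod; simpl. rewrite <- sqrt_Rsqr_abs. f_equal. unfold Rsqr. ring. }
  rewrite E. lra.
Qed.

Lemma Ccont_expi (t : R) : Ccont expi t.
Proof.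
  intros eps He. exists (eps / 2). split; [lra|]. intros u Hu.
  pose proof (expi_lipschitz u t). lra.
Qed.

Lemma Cint_expi (a b : R) :
  Cint (fun t => Ci * expi t)%C a b = (expi b - expi a)%C.
Proof.
  unfold Cint; apply (is_RInt_unique (V := C_R_CompleteNormedModule)).
  apply (is_Cint_pair (fun t => Ci * expi t)%C); simpl.
  - apply (is_RInt_ext (fun t => - sin t)); [intros; simpl; ring|].
    apply (is_RInt_derive cos).
    + intros x _. auto_derive; [exact I | ring].
    + intros x _. apply (ex_derive_continuous (K := R_AbsRing) (V := R_NormedModule)).
      auto_derive; auto.
  - apply (is_RInt_ext (fun t => cos t)); [intros; simpl; ring|].
    apply (is_RInt_derive sin).
    + intros x _. auto_derive; [exact I | ring].
    + intros x _. apply (ex_derive_continuous (K := R_AbsRing) (V := R_NormedModule)).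
      auto_derive; auto.
Qed.

(** * Cauchy's formula *)

Section Cauchy.
Variables (F : C -> C) (r rho : R) (w : C).
Hypothesis HF : forall z, Cmod z < r -> exists l, has_cderiv F z l.
Hypothesis Hw : Cmod w < rho.
Hypothesis Hrho : rho < r.

(** [c] contracts the circle to [w] along segments, [s = 1] being the circle and [s = 0] the point.
    [v] is [e'/e]: since [c s t - w = s * e t], the weight in the [t] direction is independent of
    [s]. *)
Let e (t : R) : C := (rho * expi t - w)%C.
Let c (s t : R) : C := (w + s * e t)%C.
Let v (t : R) : C := (rho * (Ci * expi t) / e t)%C.

Lemma Cmod_circle (t : R) : Cmod (rho * expi t) = rho.
Proof.
  rewrite Cmod_mult, Cmod_R, Cmod_expi, Rabs_pos_eq; [ring|].
  pose proof (Cmod_ge_0 w). lra.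
Qed.

Lemma kernel_lower (t : R) : rho - Cmod w <= Cmod (e t).
Proof. unfold e. rewrite <- (Cmod_circle t) at 1. apply Cmod_triangle_inv. Qed.

Lemma kernel_neq0 (t : R) : e t <> 0%C.
Proof. apply Cmod_gt_0. pose proof (kernel_lower t). lra. Qed.

Lemma Ccont_kernel (t : R) : Ccont e t.
Proof. apply Ccont_minus; [apply Ccont_mult|]; try apply Ccont_const. apply Ccont_expi. Qed.

Lemma Ccont_weight (t : R) : Ccont v t.
Proof.
  apply Ccont_mult.
  - apply Ccont_mult; [apply Ccont_const|]. apply Ccont_mult; [apply Ccont_const|].
    apply Ccont_expi.
  - apply Ccont_inv; [apply kernel_neq0 | apply Ccont_kernel].
Qed.

Lemma weight_bound (t : R) : Cmod (v t) <= rho / (rho - Cmod w).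
Proof.
  unfold v. rewrite Cmod_div by apply kernel_neq0.
  replace (rho * (Ci * expi t))%C with (Ci * (rho * expi t))%C by ring.
  rewrite Cmod_mult, Cmod_Ci, Cmod_circle, Rmult_1_l.
  pose proof (kernel_lower t). pose proof (Cmod_ge_0 w).
  apply Rmult_le_compat_l; [lra|]. apply Rinv_le_contravar; lra.
Qed.

Lemma homotopy_in_disc (s t : R) : 0 <= s <= 1 -> Cmod (c s t) < r.
Proof.
  intro Hs. unfold c, e.
  replace (w + s * (rho * expi t - w))%C with ((1 - s)%R * w + s * (rho * expi t))%C
    by (rewrite RtoC_minus; ring).
  eapply Rle_lt_trans; [apply Cmod_triangle|].
  rewrite 2!Cmod_mult, Cmod_circle, !Cmod_R, !Rabs_pos_eq by lra. nra.
Qed.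

Lemma Ccont_homotopy_s (s t : R) : 0 <= s <= 1 -> Ccont (fun s => F (c s t)) s.
Proof.
  intro Hs. destruct (HF (c s t) (homotopy_in_disc s t Hs)) as [l Hl].
  apply (Ccont_comp F (fun s => c s t) s l Hl).
  apply Ccont_plus; [apply Ccont_const|].
  apply Ccont_mult; [apply Ccont_RtoC | apply Ccont_const].
Qed.

Lemma Ccont_homotopy_t (s t : R) : 0 <= s <= 1 -> Ccont (fun t => F (c s t)) t.
Proof.
  intro Hs. destruct (HF (c s t) (homotopy_in_disc s t Hs)) as [l Hl].
  apply (Ccont_comp F (fun t => c s t) t l Hl).
  apply Ccont_plus; [apply Ccont_const|].
  apply Ccont_mult; [apply Ccont_const | apply Ccont_kernel].
Qed.

(* The integral of F(z)/(z-w) dz over the boundary of the image of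
   [s1,s2] x [t1,t2] under c, where dz/(z-w) = ds/s + e'/e dt. *)
Let J (s1 s2 t1 t2 : R) : C :=
  (Cint (fun s => (F (c s t1) - F (c s t2)) * / s) s1 s2 +
   Cint (fun t => (F (c s2 t) - F (c s1 t)) * v t) t1 t2)%C.

Lemma ex_J_s (s1 s2 t1 t2 : R) : 0 < s1 -> s1 <= s2 -> s2 <= 1 ->
  exCint (fun s => (F (c s t1) - F (c s t2)) * / s)%C s1 s2.
Proof.
  intros. apply Ccont_ex_RInt; [lra|]. intros s Hs.
  apply Ccont_mult; [apply Ccont_minus; apply Ccont_homotopy_s; lra|].
  apply Ccont_inv; [|apply Ccont_RtoC].
  intro E. apply RtoC_inj in E. lra.
Qed.

Lemma ex_J_t (s1 s2 t1 t2 : R) : 0 <= s1 <= 1 -> 0 <= s2 <= 1 -> t1 <= t2 ->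
  exCint (fun t => (F (c s2 t) - F (c s1 t)) * v t)%C t1 t2.
Proof.
  intros. apply Ccont_ex_RInt; [lra|]. intros t Ht.
  apply Ccont_mult; [apply Ccont_minus; apply Ccont_homotopy_t; lra|].
  apply Ccont_weight.
Qed.

(** The integral along the direction being cut splits by Chasles; in the other one the value of [F]
    on the cut is inserted and cancels. *)
Lemma J_additive (s1 s s2 t1 t t2 : R) : 0 < s1 -> s1 <= s <= s2 -> s2 <= 1 ->
  t1 <= t <= t2 ->
  J s1 s2 t1 t2 = (J s1 s t1 t2 + J s s2 t1 t2)%C /\
  J s1 s2 t1 t2 = (J s1 s2 t1 t + J s1 s2 t t2)%C.
Proof.
  intros H1 Hs H2 Ht. unfold J. split.
  - rewrite (Cint_Chasles _ s1 s s2) by (apply ex_J_s; lra).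
    rewrite (Cint_ext (fun t => (F (c s2 t) - F (c s1 t)) * v t)%C
      (fun t => (F (c s t) - F (c s1 t)) * v t + (F (c s2 t) - F (c s t)) * v t)%C)
      by (intro; ring).
    rewrite Cint_plus by (apply ex_J_t; lra). ring.
  - rewrite (Cint_Chasles _ t1 t t2) by (apply ex_J_t; lra).
    rewrite (Cint_ext (fun s => (F (c s t1) - F (c s t2)) * / s)%C
      (fun s => (F (c s t1) - F (c s t)) * / s + (F (c s t) - F (c s t2)) * / s)%C)
      by (intro; ring).
    rewrite Cint_plus by (apply ex_J_s; lra). ring.
Qed.

Lemma homotopy_lipschitz (s t s0 t0 : R) : 0 <= s0 <= 1 ->
  Cmod (c s t - c s0 t0) <= 2 * rho * (Rabs (s - s0) + Rabs (t - t0)).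
Proof.
  intro Hs. unfold c.
  replace (w + s * e t - (w + s0 * e t0))%C with
    ((s - s0)%R * e t + s0 * (rho * (expi t - expi t0)))%C
    by (unfold e; rewrite RtoC_minus; ring).
  eapply Rle_trans; [apply Cmod_triangle|].
  rewrite !Cmod_mult, !Cmod_R, (Rabs_pos_eq s0), (Rabs_pos_eq rho)
    by (pose proof (Cmod_ge_0 w); lra).
  pose proof (expi_lipschitz t t0).
  assert (Cmod (e t) <= 2 * rho).
  { unfold e. eapply Rle_trans; [apply Cmod_triangle|].
    rewrite Cmod_circle, Cmod_opp. lra. }
  pose proof (Rabs_pos (s - s0)). pose proof (Rabs_pos (t - t0)).
  pose proof (Cmod_ge_0 (expi t - expi t0)). pose proof (Cmod_ge_0 w).
  assert (Rabs (s - s0) * Cmod (e t) <= Rabs (s - s0) * (2 * rho))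
    by (apply Rmult_le_compat_l; lra).
  assert (s0 * (rho * Cmod (expi t - expi t0)) <= rho * Cmod (expi t - expi t0)).
  { rewrite <- (Rmult_1_l (rho * _)) at 2. apply Rmult_le_compat_r; nra. }
  assert (rho * Cmod (expi t - expi t0) <= rho * (2 * Rabs (t - t0)))
    by (apply Rmult_le_compat_l; lra).
  lra.
Qed.

Lemma Cint_kernel' (t1 t2 : R) : t1 <= t2 ->
  Cint (fun t => rho * (Ci * expi t))%C t1 t2 = (e t2 - e t1)%C.
Proof.
  intro H. destruct (Cint_scal rho (fun t => Ci * expi t)%C t1 t2) as [_ ->].
  - apply Ccont_ex_RInt; [exact H|]. intros. apply Ccont_mult; [apply Ccont_const | apply Ccont_expi].
  - rewrite Cint_expi. unfold e. ring.
Qed.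

(** Replace [F] by its first order expansion at [c s0 t0]. The constant drops out of the
    differences, and the linear part contributes [(s2 - s1) l (e t1 - e t2)] to one integral and its
    opposite to the other. Only the remainder [E] survives. The lower bound [sg] keeps the weight
    [1/s] bounded. *)
Lemma J_local (sg : R) : 0 < sg -> forall eps, 0 < eps ->
  forall s0 t0, sg <= s0 <= 1 ->
  exists del, 0 < del /\
    forall s1 s2 t1 t2, sg <= s1 -> s1 <= s0 -> s0 <= s2 -> s2 <= 1 ->
      t1 <= t0 -> t0 <= t2 -> s2 - s1 < del -> t2 - t1 < del ->
      Cmod (J s1 s2 t1 t2) <= eps * ((s2 - s1) + (t2 - t1)) ^ 2.
Proof.
  intros Hsg eps He s0 t0 Hs0.
  pose proof (Cmod_ge_0 w) as Pw.
  set (V := rho / (rho - Cmod w)).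
  assert (HV : 0 <= V) by (apply Rmult_le_pos; [lra | apply Rlt_le, Rinv_0_lt_compat; lra]).
  assert (Hsi : 0 < / sg) by (apply Rinv_0_lt_compat; exact Hsg).
  (* A difference of two remainders is at most [eps / K * 4 rho L], and the two weights are at most
     [1/sg] and [V]; [K] makes the total exactly [eps * L^2]. *)
  set (K := 4 * rho * (/ sg + V)).
  assert (HK : 0 < K) by (unfold K; apply Rmult_lt_0_compat; lra).
  destruct (HF (c s0 t0)) as [l Hl]; [apply homotopy_in_disc; lra|].
  destruct (Hl (eps / K)) as (d & Hd & HE); [apply Rdiv_lt_0_compat; lra|].
  (* [c] is Lipschitz with constant [2 rho] for the sum of the two parameter differences, each below
     [d / (4 rho)]. *)
  exists (d / (4 * rho)). split; [apply Rdiv_lt_0_compat; lra|].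
  intros s1 s2 t1 t2 A1 A2 A3 A4 B1 B2 D1 D2.
  set (E := fun z => (F z - F (c s0 t0) - l * (z - c s0 t0))%C).
  set (L := (s2 - s1) + (t2 - t1)).
  assert (HL : 0 <= L) by (unfold L; lra).
  assert (HEb : forall s t, s1 <= s <= s2 -> t1 <= t <= t2 ->
            Cmod (E (c s t)) <= eps / K * (2 * rho * L)).
  { intros s t Hs Ht.
    assert (Hc : Cmod (c s t - c s0 t0) <= 2 * rho * L).
    { eapply Rle_trans; [apply homotopy_lipschitz; lra|].
      apply Rmult_le_compat_l; [lra|]. unfold L.
      apply Rplus_le_compat; apply Rabs_le; lra. }
    assert (HL2 : L < d / (2 * rho)).
    { unfold L. replace (d / (2 * rho)) with (d / (4 * rho) + d / (4 * rho)) by (field; lra). lra. }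
    eapply Rle_trans; [apply HE|].
    - apply Rle_lt_trans with (1 := Hc).
      apply (Rmult_lt_compat_l (2 * rho)) in HL2; [|lra].
      replace (2 * rho * (d / (2 * rho))) with d in HL2 by (field; lra). exact HL2.
    - apply Rmult_le_compat_l; [|exact Hc]. apply Rlt_le, Rdiv_lt_0_compat; lra. }
  assert (HEE : forall s t s' t', s1 <= s <= s2 -> t1 <= t <= t2 ->
            s1 <= s' <= s2 -> t1 <= t' <= t2 ->
            Cmod (E (c s t) - E (c s' t')) <= eps / K * (4 * rho * L)).
  { intros s t s' t' Hs Ht Hs' Ht'.
    eapply Rle_trans; [apply Cmod_triangle|]. rewrite Cmod_opp.
    pose proof (HEb s t Hs Ht). pose proof (HEb s' t' Hs' Ht'). lra. }
  assert (I1 : Cint (fun s => (F (c s t1) - F (c s t2)) * / s)%C s1 s2 =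
    ((s2 - s1)%R * (l * (e t1 - e t2)) +
      Cint (fun s => (F (c s t1) - F (c s t2)) * / s + - (l * (e t1 - e t2)))%C s1 s2)%C).
  { assert (X : exCint (fun s => - (l * (e t1 - e t2)) + (F (c s t1) - F (c s t2)) * / s)%C s1 s2).
    { apply Ccont_ex_RInt; [lra|]. intros s Hs. apply Ccont_plus; [apply Ccont_const|].
      apply Ccont_mult; [apply Ccont_minus; apply Ccont_homotopy_s; lra|].
      apply Ccont_inv; [|apply Ccont_RtoC]. intro H; apply RtoC_inj in H; lra. }
    assert (X0 : exCint (fun _ => l * (e t1 - e t2))%C s1 s2).
    { apply Ccont_ex_RInt; [lra|]. intros; apply Ccont_const. }
    rewrite (Cint_ext _ (fun s => l * (e t1 - e t2) +
      (- (l * (e t1 - e t2)) + (F (c s t1) - F (c s t2)) * / s))%C) by (intro; ring).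
    rewrite (Cint_plus _ _ _ _ X0 X), Cint_const. f_equal. apply Cint_ext. intro; ring. }
  assert (I2 : Cint (fun t => (F (c s2 t) - F (c s1 t)) * v t)%C t1 t2 =
    ((s2 - s1)%R * l * (e t2 - e t1) +
      Cint (fun t => (F (c s2 t) - F (c s1 t)) * v t +
               - ((s2 - s1)%R * l) * (rho * (Ci * expi t)))%C t1 t2)%C).
  { assert (X : exCint (fun t => rho * (Ci * expi t))%C t1 t2).
    { apply Ccont_ex_RInt; [lra|]. intros.
      repeat (apply Ccont_mult; [apply Ccont_const|]). apply Ccont_expi. }
    destruct (Cint_scal (- ((s2 - s1)%R * l))%C _ _ _ X) as [X1 X2].
    rewrite Cint_plus; [|apply ex_J_t; lra | exact X1].
    rewrite X2, Cint_kernel' by lra. ring. }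
  unfold J. rewrite I1, I2.
  match goal with |- Cmod (_ + ?a + (_ + ?b)) <= _ => set (R1 := a); set (R2 := b) end.
  replace ((s2 - s1)%R * (l * (e t1 - e t2)) + R1 + ((s2 - s1)%R * l * (e t2 - e t1) + R2))%C
    with (R1 + R2)%C by ring.
  eapply Rle_trans; [apply Cmod_triangle|].
  assert (HR1 : Cmod R1 <= (s2 - s1) * (eps / K * (4 * rho * L) * / sg)).
  { apply Cint_bound; [lra | |].
    - apply Ccont_ex_RInt; [lra|]. intros s Hs. apply Ccont_plus; [|apply Ccont_const].
      apply Ccont_mult; [apply Ccont_minus; apply Ccont_homotopy_s; lra|].
      apply Ccont_inv; [|apply Ccont_RtoC]. intro H; apply RtoC_inj in H; lra.
    - intros s Hs.
      assert (Hs' : RtoC s <> 0%C) by (intro H; apply RtoC_inj in H; lra).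
      replace ((F (c s t1) - F (c s t2)) * / s + - (l * (e t1 - e t2)))%C with
        ((E (c s t1) - E (c s t2)) * / s)%C by (unfold E, c; field; exact Hs').
      rewrite Cmod_mult, Cmod_inv, Cmod_R, Rabs_pos_eq by (lra || exact Hs').
      apply Rmult_le_compat; [apply Cmod_ge_0 | apply Rlt_le, Rinv_0_lt_compat; lra | |].
      + apply HEE; lra.
      + apply Rinv_le_contravar; lra. }
  assert (HR2 : Cmod R2 <= (t2 - t1) * (eps / K * (4 * rho * L) * V)).
  { apply Cint_bound; [lra | |].
    - apply Ccont_ex_RInt; [lra|]. intros t Ht. apply Ccont_plus.
      + apply Ccont_mult; [apply Ccont_minus; apply Ccont_homotopy_t; lra | apply Ccont_weight].
      + repeat (apply Ccont_mult; [apply Ccont_const|]). apply Ccont_expi.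
    - intros t Ht.
      replace ((F (c s2 t) - F (c s1 t)) * v t + - ((s2 - s1)%R * l) * (rho * (Ci * expi t)))%C
        with ((E (c s2 t) - E (c s1 t)) * v t)%C
        by (unfold E, c, v; rewrite RtoC_minus; field; apply kernel_neq0).
      rewrite Cmod_mult.
      apply Rmult_le_compat; try apply Cmod_ge_0; [apply HEE; lra | apply weight_bound]. }
  assert (P : 0 <= eps / K * (4 * rho * L)).
  { apply Rmult_le_pos; [apply Rlt_le, Rdiv_lt_0_compat; lra | apply Rmult_le_pos; lra]. }
  assert (T1 : (s2 - s1) * (eps / K * (4 * rho * L) * / sg) <= L * (eps / K * (4 * rho * L) * / sg)).
  { apply Rmult_le_compat_r; [apply Rmult_le_pos; lra | unfold L; lra]. }
  assert (T2 : (t2 - t1) * (eps / K * (4 * rho * L) * V) <= L * (eps / K * (4 * rho * L) * V)).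
  { apply Rmult_le_compat_r; [apply Rmult_le_pos; lra | unfold L; lra]. }
  replace (eps * L ^ 2) with
    (L * (eps / K * (4 * rho * L) * / sg) + L * (eps / K * (4 * rho * L) * V)).
  - lra.
  - unfold K. field. assert (0 <= V * sg) by (apply Rmult_le_pos; lra). repeat split; lra.
Qed.

(** The rectangle stops at [s = sg > 0], where [1/s] is still harmless. *)
Lemma circle_integral_homotopy (sg : R) : 0 < sg <= 1 ->
  Cint (fun t => F (rho * expi t) * v t)%C 0 (2 * PI) =
  Cint (fun t => F (c sg t) * v t)%C 0 (2 * PI).
Proof.
  intro Hsg. pose proof PI_RGT_0 as HPI.
  assert (HJ : J sg 1 0 (2 * PI) = 0%C).
  { apply (bisection J sg 1 0 (2 * PI)); [lra | lra | |].
    - intros s1 s2 t1 t2 H1 H2 H3 H4 H5 H6. apply J_additive; lra.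
    - intros eps He s0 t0 Hs0 Ht0.
      destruct (J_local sg ltac:(lra) eps He s0 t0 Hs0) as (d & Hd & H).
      exists d. split; [exact Hd|]. intros; apply H; lra. }
  unfold J in HJ.
  (* The edges [t = 0] and [t = 2 PI] have the same image, so their contributions cancel. *)
  rewrite (Cint_ext (fun s => (F (c s 0) - F (c s (2 * PI))) * / s)%C (fun _ => 0%C)) in HJ.
  2:{ intro s. unfold c, e, expi. rewrite cos_0, sin_0, cos_2PI, sin_2PI. ring. }
  rewrite Cint_const in HJ.
  rewrite (Cint_ext (fun t => (F (c 1 t) - F (c sg t)) * v t)%C
    (fun t => F (rho * expi t) * v t + (- (1)) * (F (c sg t) * v t))%C) in HJ.
  2:{ intro t. replace (c 1 t) with (rho * expi t)%C by (unfold c, e; ring). ring. }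
  assert (X : exCint (fun t => F (c sg t) * v t)%C 0 (2 * PI)).
  { apply Ccont_ex_RInt; [lra|]. intros.
    apply Ccont_mult; [apply Ccont_homotopy_t; lra | apply Ccont_weight]. }
  destruct (Cint_scal (- (1))%C _ _ _ X) as [X1 X2].
  rewrite Cint_plus, X2 in HJ; [|  |exact X1].
  - apply Ceq_minus. rewrite <- HJ. ring.
  - apply Ccont_ex_RInt; [lra|]. intros t _.
    apply Ccont_mult; [|apply Ccont_weight].
    destruct (HF (rho * expi t)%C) as [l Hl]; [rewrite Cmod_circle; lra|].
    apply (Ccont_comp F (fun t => rho * expi t)%C t l Hl).
    apply Ccont_mult; [apply Ccont_const | apply Ccont_expi].
Qed.

(** The circle is contracted towards [w], where continuity of [F] suffices. The integral of [v]
    stays unevaluated; its value is derived later from this very formula. *)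
Lemma cauchy_formula_weight :
  Cint (fun t => F (rho * expi t) * v t)%C 0 (2 * PI) = (F w * Cint v 0 (2 * PI))%C.
Proof.
  pose proof PI_RGT_0 as HPI. pose proof (Cmod_ge_0 w) as Pw.
  set (V := rho / (rho - Cmod w)).
  assert (HV : 0 < V) by (apply Rdiv_lt_0_compat; lra).
  apply Ceq_minus, Cmod_eq_0, Rle_antisym; [|apply Cmod_ge_0].
  apply le_epsilon. intros eps He. rewrite Rplus_0_l.
  destruct (HF w) as [l Hl]; [lra|].
  destruct (has_cderiv_cont _ _ _ Hl (eps / (2 * PI * V))) as (d & Hd & Hc);
    [apply Rdiv_lt_0_compat; nra|].
  (* [|e t| <= 2 rho], so the contracted circle lies within [d / 2] of [w]. *)
  set (sg := Rmin 1 (d / (4 * rho))).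
  assert (Hsg : 0 < sg <= 1).
  { split; [apply Rmin_glb_lt; [lra | apply Rdiv_lt_0_compat; lra] | apply Rmin_l]. }
  rewrite (circle_integral_homotopy sg Hsg).
  assert (Xv : exCint v 0 (2 * PI)).
  { apply Ccont_ex_RInt; [lra|]. intros; apply Ccont_weight. }
  destruct (Cint_scal (- F w)%C _ _ _ Xv) as [X1 X2].
  assert (X : exCint (fun t => F (c sg t) * v t)%C 0 (2 * PI)).
  { apply Ccont_ex_RInt; [lra|]. intros.
    apply Ccont_mult; [apply Ccont_homotopy_t; lra | apply Ccont_weight]. }
  replace (Cint (fun t => F (c sg t) * v t)%C 0 (2 * PI) - F w * Cint v 0 (2 * PI))%C
    with (Cint (fun t => F (c sg t) * v t + - F w * v t)%C 0 (2 * PI))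
    by (rewrite Cint_plus, X2 by assumption; ring).
  replace eps with ((2 * PI - 0) * (eps / (2 * PI * V) * V)) by (field; lra).
  apply Cint_bound; [lra | |].
  - apply Ccont_ex_RInt; [lra|]. intros. apply Ccont_plus.
    + apply Ccont_mult; [apply Ccont_homotopy_t; lra | apply Ccont_weight].
    + apply Ccont_mult; [apply Ccont_const | apply Ccont_weight].
  - intros t _. replace (F (c sg t) * v t + - F w * v t)%C with ((F (c sg t) - F w) * v t)%C by ring.
    rewrite Cmod_mult.
    apply Rmult_le_compat; try apply Cmod_ge_0; [|apply weight_bound].
    apply Rlt_le, Hc. unfold c. replace (w + sg * e t - w)%C with (sg * e t)%C by ring.
    rewrite Cmod_mult, Cmod_R, Rabs_pos_eq by lra.
    assert (He2 : Cmod (e t) <= 2 * rho).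
    { unfold e. eapply Rle_trans; [apply Cmod_triangle|].
      rewrite Cmod_circle, Cmod_opp. lra. }
    apply Rle_lt_trans with (d / (4 * rho) * (2 * rho)).
    + apply Rmult_le_compat; [lra | apply Cmod_ge_0 | apply Rmin_r | exact He2].
    + replace (d / (4 * rho) * (2 * rho)) with (d / 2) by (field; lra). lra.
Qed.

End Cauchy.

(** The weight [v] divided by [Ci]. With it the Cauchy formula becomes a weighted average over the
    angle, of total mass [2 PI]. *)
Definition kernel (rho : R) (w : C) (t : R) : C := (rho * expi t / (rho * expi t - w))%C.

Lemma Ccont_kernel_quotient (rho : R) (w : C) (t : R) : Cmod w < rho -> Ccont (kernel rho w) t.
Proof.
  intro Hw. apply Ccont_mult.
  - apply Ccont_mult; [apply Ccont_const | apply Ccont_expi].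
  - apply Ccont_inv; [apply (kernel_neq0 rho w Hw) | apply (Ccont_kernel rho w)].
Qed.

Lemma kernel_bound (rho : R) (w : C) (t : R) : Cmod w < rho ->
  Cmod (kernel rho w t) <= rho / (rho - Cmod w).
Proof.
  intro Hw. eapply Rle_trans; [|apply (weight_bound rho w Hw t)]. right.
  unfold kernel. rewrite <- (Rmult_1_l (Cmod _)), <- Cmod_Ci, <- Cmod_mult. f_equal.
  field. apply (kernel_neq0 rho w Hw).
Qed.

Lemma RtoC_neq0 (x : R) : x <> 0 -> RtoC x <> 0%C.
Proof. intros H E. apply RtoC_inj in E. contradiction. Qed.

Lemma Ccont_circle (F : C -> C) (r rho : R) (t : R) :
  (forall z, Cmod z < r -> exists l, has_cderiv F z l) -> 0 < rho < r ->
  Ccont (fun t => F (rho * expi t)%C) t.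
Proof.
  intros HF Hr. destruct (HF (rho * expi t)%C) as [l Hl].
  - rewrite (Cmod_circle rho 0) by (rewrite Cmod_0; lra). lra.
  - apply (Ccont_comp F (fun t => rho * expi t)%C t l Hl).
    apply Ccont_mult; [apply Ccont_const | apply Ccont_expi].
Qed.

(** For [w = 0] the weight is the constant [Ci], whose integral is immediate. This case comes first
    because the total mass of [kernel] for general [w] is deduced from it. *)
Lemma mean_value (F : C -> C) (r rho : R) :
  (forall z, Cmod z < r -> exists l, has_cderiv F z l) -> 0 < rho < r ->
  Cint (fun t => F (rho * expi t)%C) 0 (2 * PI) = ((2 * PI)%R * F 0)%C.
Proof.
  intros HF Hr. pose proof PI_RGT_0.
  assert (H0 : Cmod 0 < rho) by (rewrite Cmod_0; lra).
  assert (X : exCint (fun t => F (rho * expi t)%C) 0 (2 * PI)).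
  { apply Ccont_ex_RInt; [lra|]. intros. apply (Ccont_circle F r rho); auto. }
  pose proof (cauchy_formula_weight F r rho 0 HF H0 (proj2 Hr)) as E.
  assert (Hk : forall t, (rho * (Ci * expi t) / (rho * expi t - 0))%C = Ci).
  { intro t. field. assert (N : (rho * expi t - 0)%C <> 0%C) by apply (kernel_neq0 rho 0 H0).
    replace (rho * expi t - 0)%C with (rho * expi t)%C in N by ring. split; intro Z; apply N; rewrite Z; ring. }
  rewrite (Cint_ext _ (fun t => Ci * F (rho * expi t))%C) in E by (intro; rewrite Hk; ring).
  rewrite (proj2 (Cint_scal Ci _ _ _ X)) in E.
  rewrite (Cint_ext (fun t => rho * (Ci * expi t) / (rho * expi t - 0))%C (fun _ => Ci)) in E by (intro; apply Hk).
  rewrite Cint_const in E.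
  replace (Cint (fun t => F (rho * expi t)%C) 0 (2 * PI)) with
    (- Ci * (Ci * Cint (fun t => F (rho * expi t)%C) 0 (2 * PI)))%C.
  - rewrite E. replace (2 * PI - 0) with (2 * PI) by ring.
    replace (- Ci * (F 0 * ((2 * PI)%R * Ci)))%C with (- (Ci * Ci) * ((2 * PI)%R * F 0))%C by ring.
    replace (Ci * Ci)%C with (- (1))%C; [ring|].
    unfold Ci, Cmult, Copp, RtoC; simpl. f_equal; ring.
  - replace (- Ci * (Ci * Cint (fun t => F (rho * expi t)%C) 0 (2 * PI)))%C
      with (- (Ci * Ci) * Cint (fun t => F (rho * expi t)%C) 0 (2 * PI))%C by ring.
    replace (Ci * Ci)%C with (- (1))%C; [ring|].
    unfold Ci, Cmult, Copp, RtoC; simpl. f_equal; ring.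
Qed.

(* On the circle |zeta| = rho, the conjugate of zeta / (zeta - w) is the value
   at zeta of the holomorphic function rho^2 / (rho^2 - conj(w) z). *)
Lemma Cint_kernel_total (rho : R) (w : C) : Cmod w < rho ->
  Cint (kernel rho w) 0 (2 * PI) = (2 * PI)%R.
Proof.
  intro Hw. pose proof (Cmod_ge_0 w) as Pw. pose proof PI_RGT_0 as HPI.
  assert (X : exCint (kernel rho w) 0 (2 * PI)).
  { apply Ccont_ex_RInt; [lra|]. intros. apply Ccont_kernel_quotient, Hw. }
  set (G := fun z : C => ((rho * rho)%R * / ((rho * rho)%R + - Cconj w * z))%C).
  (* This radius exceeds [rho], does not reach the pole, of modulus [rho^2 / |w|], and makes sense
     also for [w = 0]. *)
  assert (HG : forall z, Cmod z < 2 * rho * rho / (rho + Cmod w) ->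
             exists l, has_cderiv G z l).
  { intros z Hz.
    assert (N : ((rho * rho)%R + - Cconj w * z)%C <> 0%C).
    { intro E. assert (E' : Cmod (RtoC (rho * rho)%R) = Cmod (Cconj w * z)%C).
      { f_equal. apply Ceq_minus. rewrite <- E. ring. }
      rewrite Cmod_R, Rabs_pos_eq, Cmod_mult, Cmod_conj in E' by nra.
      assert (H : Cmod z * (rho + Cmod w) < 2 * rho * rho).
      { apply (Rmult_lt_compat_r (rho + Cmod w)) in Hz; [|lra].
        replace (2 * rho * rho / (rho + Cmod w) * (rho + Cmod w)) with (2 * rho * rho) in Hz
          by (field; lra). exact Hz. }
      pose proof (Cmod_ge_0 z). nra. }
    eexists. apply has_cderiv_scal.
    apply (has_cderiv_comp (fun x => / x)%C (fun z => (rho * rho)%R + - Cconj w * z)%C).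
    - apply has_cderiv_plus; [apply has_cderiv_const | apply has_cderiv_scal, has_cderiv_id].
    - apply has_cderiv_inv, N. }
  assert (E : Cint (fun t => Cconj (kernel rho w t)) 0 (2 * PI) = ((2 * PI)%R * G 0)%C).
  { rewrite <- (mean_value G _ rho HG).
    - apply Cint_ext. intro t. unfold kernel, G.
      assert (N : (rho * expi t - w)%C <> 0%C) by apply (kernel_neq0 rho w Hw).
      rewrite Cdiv_conj by exact N. rewrite Cminus_conj.
      set (z := (rho * expi t)%C) in *.
      assert (Ez : RtoC (rho * rho)%R = (z * Cconj z)%C).
      { rewrite <- Cmod2_conj. unfold z. rewrite (Cmod_circle rho w Hw). f_equal. ring. }
      rewrite Ez.
      assert (Nz : z <> 0%C).
      { apply Cmod_gt_0. unfold z. rewrite (Cmod_circle rho w Hw). lra. }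
      assert (N' : (Cconj z - Cconj w)%C <> 0%C).
      { rewrite <- Cminus_conj. intro Z. apply N. rewrite <- (Cconj_conj (z - w)), Z.
        unfold Cconj, RtoC; simpl. f_equal; ring. }
      replace (z * Cconj z + - Cconj w * z)%C with (z * (Cconj z - Cconj w))%C by ring.
      field. auto.
    - split; [lra|]. apply (Rmult_lt_reg_r (rho + Cmod w)); [lra|].
      replace (2 * rho * rho / (rho + Cmod w) * (rho + Cmod w)) with (2 * rho * rho)
        by (field; lra). nra. }
  rewrite Cint_conj in E by exact X.
  rewrite <- (Cconj_conj (Cint _ _ _)), E.
  unfold G. replace ((rho * rho)%R + - Cconj w * 0)%C with (RtoC (rho * rho)%R) by ring.
  rewrite Cinv_r by (apply RtoC_neq0; nra).
  unfold Cconj, Cmult, RtoC; simpl. f_equal; ring.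
Qed.

Lemma cauchy_formula (F : C -> C) (r rho : R) (w : C) :
  (forall z, Cmod z < r -> exists l, has_cderiv F z l) -> Cmod w < rho -> rho < r ->
  Cint (fun t => F (rho * expi t) * kernel rho w t)%C 0 (2 * PI) = ((2 * PI)%R * F w)%C.
Proof.
  intros HF Hw Hr. pose proof (Cmod_ge_0 w) as Pw. pose proof PI_RGT_0 as HPI.
  pose proof (cauchy_formula_weight F r rho w HF Hw Hr) as E.
  assert (Hk : forall t, (rho * (Ci * expi t) / (rho * expi t - w))%C = (Ci * kernel rho w t)%C).
  { intro t. unfold kernel. field. apply (kernel_neq0 rho w Hw). }
  assert (X : exCint (kernel rho w) 0 (2 * PI)).
  { apply Ccont_ex_RInt; [lra|]. intros. apply Ccont_kernel_quotient, Hw. }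
  assert (XF : exCint (fun t => F (rho * expi t) * kernel rho w t)%C 0 (2 * PI)).
  { apply Ccont_ex_RInt; [lra|]. intros.
    apply Ccont_mult; [apply (Ccont_circle F r rho); auto; lra | apply Ccont_kernel_quotient, Hw]. }
  rewrite (Cint_ext _ (fun t => Ci * (F (rho * expi t) * kernel rho w t))%C) in E
    by (intro; rewrite Hk; ring).
  rewrite (proj2 (Cint_scal Ci _ _ _ XF)) in E.
  rewrite (Cint_ext (fun t => rho * (Ci * expi t) / (rho * expi t - w))%C
    (fun t => Ci * kernel rho w t)%C) in E by (intro; apply Hk).
  rewrite (proj2 (Cint_scal Ci _ _ _ X)), Cint_kernel_total in E by exact Hw.
  replace (F w * (Ci * (2 * PI)%R))%C with (Ci * ((2 * PI)%R * F w))%C in E by ring.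
  apply (f_equal (fun z => / Ci * z)%C) in E.
  rewrite !Cmult_assoc, Cinv_l, !Cmult_1_l in E by apply Ci_nz. exact E.
Qed.

Lemma circle_bounded (F : C -> C) (r rho : R) :
  (forall z, Cmod z < r -> exists l, has_cderiv F z l) -> 0 < rho < r ->
  exists M, 0 <= M /\ forall t, 0 <= t <= 2 * PI -> Cmod (F (rho * expi t)%C) <= M.
Proof.
  intros HF Hr. pose proof PI_RGT_0 as HPI.
  destruct (continuity_ab_maj (fun t => Cmod (F (rho * expi t)%C)) 0 (2 * PI)) as (x & Hx & _).
  - lra.
  - intros t _ eps He. destruct (Ccont_circle F r rho t HF Hr eps He) as (d & Hd & H).
    exists d. split; [exact Hd|]. intros u [_ Hu]. simpl in *. unfold R_dist in *.
    specialize (H u Hu). apply Rabs_def1.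
    + eapply Rle_lt_trans; [apply Cmod_triangle_inv | exact H].
    + assert (H' := Cmod_triangle_inv (F (rho * expi t)%C) (F (rho * expi u)%C)).
      replace (F (rho * expi t) - F (rho * expi u))%C with
        (- (F (rho * expi u) - F (rho * expi t)))%C in H' by ring.
      rewrite Cmod_opp in H'. lra.
  - exists (Cmod (F (rho * expi x)%C)). split; [apply Cmod_ge_0 | exact Hx].
Qed.

(** Subtracting the formulas at [w] and [w'] leaves the kernel [z (w - w') / ((z - w) (z - w'))].
    Both factors of the denominator are at least [rho / 2], whence the constant 4. This serves as
    Cauchy's estimate without differentiating under the integral. *)
Lemma cauchy_lipschitz (F : C -> C) (r rho M : R) (w w' : C) :
  (forall z, Cmod z < r -> exists l, has_cderiv F z l) -> 0 < rho < r ->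
  (forall z, Cmod z = rho -> Cmod (F z) <= M) ->
  Cmod w <= rho / 2 -> Cmod w' <= rho / 2 ->
  Cmod (F w - F w') <= 4 * M / rho * Cmod (w - w').
Proof.
  intros HF Hr HM Hw Hw'. pose proof PI_RGT_0 as HPI.
  assert (L : Cmod w < rho) by lra. assert (L' : Cmod w' < rho) by lra.
  assert (HX : forall w, Cmod w < rho -> forall t, Ccont (fun t => F (rho * expi t) * kernel rho w t)%C t).
  { intros. apply Ccont_mult; [apply (Ccont_circle F r rho); auto; lra | apply Ccont_kernel_quotient; auto]. }
  assert (X : forall w, Cmod w < rho -> exCint (fun t => F (rho * expi t) * kernel rho w t)%C 0 (2 * PI)).
  { intros. apply Ccont_ex_RInt; [lra|]. auto. }
  pose proof (cauchy_formula F r rho w HF L (proj2 Hr)) as E.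
  pose proof (cauchy_formula F r rho w' HF L' (proj2 Hr)) as E'.
  destruct (Cint_scal (- (1))%C _ _ _ (X w' L')) as [Y1 Y2].
  assert (D : ((2 * PI)%R * (F w - F w'))%C =
    Cint (fun t => F (rho * expi t) * kernel rho w t + - (1) * (F (rho * expi t) * kernel rho w' t))%C
      0 (2 * PI)).
  { rewrite Cint_plus, Y2, E, E' by auto. ring. }
  assert (B : Cmod ((2 * PI)%R * (F w - F w'))%C <=
              (2 * PI - 0) * (4 * M / rho * Cmod (w - w'))).
  { rewrite D. apply Cint_bound; [lra | |].
    - apply Ccont_ex_RInt; [lra|]. intros. apply Ccont_plus; [auto|].
      apply Ccont_mult; [apply Ccont_const | auto].
    - intros t _. unfold kernel. set (z := (rho * expi t)%C).
      assert (Ez : Cmod z = rho) by (apply (Cmod_circle rho w L)).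
      assert (N : (z - w)%C <> 0%C) by (apply (kernel_neq0 rho w L)).
      assert (N' : (z - w')%C <> 0%C) by (apply (kernel_neq0 rho w' L')).
      replace (F z * (z / (z - w)) + - (1) * (F z * (z / (z - w'))))%C with
        (F z * (z * (w - w') * / ((z - w) * (z - w'))))%C by (field; auto).
      rewrite !Cmod_mult, Cmod_inv, Cmod_mult, Ez by (apply Cmult_neq_0; auto).
      assert (K1 : rho / 2 <= Cmod (z - w)) by (pose proof (Cmod_triangle_inv z w); lra).
      assert (K2 : rho / 2 <= Cmod (z - w')) by (pose proof (Cmod_triangle_inv z w'); lra).
      assert (K : / (Cmod (z - w) * Cmod (z - w')) <= 4 / (rho * rho)).
      { replace (4 / (rho * rho)) with (/ (rho / 2 * (rho / 2))) by (field; lra).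
        apply Rinv_le_contravar; [nra|]. apply Rmult_le_compat; lra. }
      replace (4 * M / rho * Cmod (w - w')) with
        (M * (rho * Cmod (w - w') * (4 / (rho * rho)))) by (field; lra).
      pose proof (Cmod_ge_0 (w - w')).
      apply Rmult_le_compat; [apply Cmod_ge_0 | | apply HM, Ez |].
      + apply Rmult_le_pos; [nra|]. apply Rlt_le, Rinv_0_lt_compat. nra.
      + apply Rmult_le_compat_l; [nra | exact K]. }
  rewrite Cmod_mult, Cmod_R, Rabs_pos_eq, Rminus_0_r in B by lra.
  apply Rmult_le_reg_l with (2 * PI); lra.
Qed.

(** * Taylor coefficients, isolated zeros, identity theorem *)

Section Taylor.
Variables (F : C -> C) (r rho : R).
Hypothesis HF : forall z, Cmod z < r -> exists l, has_cderiv F z l.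
Hypothesis Hr : 0 < rho < r.

(** [T n 0] is the n-th Taylor coefficient, and [T n w] is the Taylor remainder of order n divided
    by [w^n]. *)
Let G (n : nat) (t : R) : C := (F (rho * expi t) * / (rho * expi t) ^ n)%C.
Let T (n : nat) (w : C) : C := (/ (2 * PI)%R * Cint (fun t => G n t * kernel rho w t) 0 (2 * PI))%C.

Lemma circle_neq0 (t : R) : (rho * expi t)%C <> 0%C.
Proof.
  apply Cmod_gt_0. rewrite (Cmod_circle rho 0) by (rewrite Cmod_0; lra). lra.
Qed.

Lemma Ccont_taylor (n : nat) (w : C) (t : R) : Cmod w < rho -> Ccont (fun t => G n t * kernel rho w t)%C t.
Proof.
  intro Hw. apply Ccont_mult; [|apply Ccont_kernel_quotient, Hw].
  apply Ccont_mult; [apply (Ccont_circle F r rho t HF Hr)|].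
  apply Ccont_inv; [apply Cpow_nz, circle_neq0|].
  induction n as [|n IH]; simpl.
  - apply Ccont_const.
  - apply Ccont_mult; [|exact IH]. apply Ccont_mult; [apply Ccont_const | apply Ccont_expi].
Qed.

Lemma ex_taylor (n : nat) (w : C) : Cmod w < rho -> exCint (fun t => G n t * kernel rho w t)%C 0 (2 * PI).
Proof.
  intro Hw. pose proof PI_RGT_0. apply Ccont_ex_RInt; [lra|]. intros. apply Ccont_taylor, Hw.
Qed.

Lemma twopi_neq0 : RtoC (2 * PI)%R <> 0%C.
Proof. pose proof PI_RGT_0. apply RtoC_neq0. lra. Qed.

Lemma taylor_0 (w : C) : Cmod w < rho -> T 0 w = F w.
Proof.
  intro Hw. unfold T, G.
  rewrite (Cint_ext _ (fun t => F (rho * expi t) * kernel rho w t)%C)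
    by (intro; simpl; field; exact C1_nz).
  rewrite (cauchy_formula F r rho w HF Hw (proj2 Hr)). field. apply twopi_neq0.
Qed.

(** Integrate [z / (z - w) = 1 + w / (z - w)] against [G n]; the extra factor [1/z] in [G (S n)]
    turns [kernel] into [1 / (z - w)]. *)
Lemma taylor_step (n : nat) (w : C) : Cmod w < rho -> T n w = (T n 0 + w * T (S n) w)%C.
Proof.
  intro Hw. assert (H0 : Cmod 0 < rho) by (rewrite Cmod_0; lra). unfold T.
  destruct (Cint_scal w _ _ _ (ex_taylor (S n) w Hw)) as [X1 X2].
  rewrite (Cint_ext (fun t => G n t * kernel rho w t)%C
    (fun t => G n t * kernel rho 0 t + w * (G (S n) t * kernel rho w t))%C).
  - rewrite Cint_plus, X2; [ring | apply ex_taylor, H0 | exact X1].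
  - intro t. unfold G, kernel. set (z := (rho * expi t)%C). simpl.
    assert (Nz : z <> 0%C) by apply circle_neq0.
    assert (N : (z - w)%C <> 0%C) by apply (kernel_neq0 rho w Hw).
    pose proof (Cpow_nz z n Nz).
    replace (z - 0)%C with z by ring. field. auto.
Qed.

Lemma taylor_bound : exists M, 0 <= M /\ forall n w, Cmod w < rho ->
  Cmod (T n w) <= M * / rho ^ n * (rho / (rho - Cmod w)).
Proof.
  pose proof PI_RGT_0 as HPI.
  destruct (circle_bounded F r rho HF Hr) as (M & PM & HM).
  exists M. split; [exact PM|]. intros n w Hw. unfold T.
  rewrite Cmod_mult, Cmod_inv, Cmod_R, Rabs_pos_eq by (try apply twopi_neq0; lra).
  apply (Rmult_le_reg_l (2 * PI)); [lra|]. rewrite <- Rmult_assoc, Rinv_r, Rmult_1_l by lra.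
  rewrite <- (Rminus_0_r (2 * PI)) at 2.
  apply Cint_bound; [lra | apply ex_taylor, Hw |].
  intros t Ht. rewrite Cmod_mult.
  apply Rmult_le_compat; try apply Cmod_ge_0; [|apply kernel_bound, Hw].
  unfold G. rewrite Cmod_mult, Cmod_inv, Cmod_pow by (apply Cpow_nz, circle_neq0).
  rewrite (Cmod_circle rho w Hw).
  apply Rmult_le_compat_r; [|apply HM, Ht].
  apply Rlt_le, Rinv_0_lt_compat, pow_lt. lra.
Qed.

Lemma taylor_factor (n : nat) : (forall k, (k < n)%nat -> T k 0 = 0%C) ->
  forall w, Cmod w < rho -> F w = (w ^ n * T n w)%C.
Proof.
  induction n as [|n IH]; intros H w Hw.
  - rewrite taylor_0 by exact Hw. simpl. ring.
  - rewrite (IH ltac:(intros; apply H; lia) w Hw), (taylor_step n w Hw), (H n ltac:(lia)).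
    simpl. ring.
Qed.

(** If all coefficients vanish, [F w = w^n T n w] for every n, and this is at most a constant times
    [(|w| / rho)^n]. Otherwise, for the first nonzero coefficient,
    [F w = w^n (T n 0 + w T (S n) w)], where the first term dominates near 0. *)
Lemma zero_dichotomy_circle :
  (forall w, Cmod w < rho -> F w = 0%C) \/
  (exists d, 0 < d /\ forall w, 0 < Cmod w < d -> F w <> 0%C).
Proof.
  destruct taylor_bound as (M & PM & HM).
  destruct (classic (forall n, T n 0 = 0%C)) as [A|A].
  - left. intros w Hw. apply Cmod_eq_0, Rle_antisym; [|apply Cmod_ge_0].
    apply le_epsilon. intros eps He. rewrite Rplus_0_l.
    pose proof (Cmod_ge_0 w) as Pw.
    set (k := M * (rho / (rho - Cmod w))).
    assert (Hk : 0 <= k).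
    { apply Rmult_le_pos; [lra|]. apply Rlt_le, Rdiv_lt_0_compat; lra. }
    destruct (pow_lt_1_zero (Cmod w / rho)) with (y := eps / (k + 1)) as [n Hn].
    + assert (0 <= Cmod w / rho) by (apply Rmult_le_pos; [lra | apply Rlt_le, Rinv_0_lt_compat; lra]).
      rewrite Rabs_pos_eq by lra. apply (Rmult_lt_reg_r rho); [lra|].
      replace (Cmod w / rho * rho) with (Cmod w) by (field; lra). lra.
    + apply Rdiv_lt_0_compat; lra.
    + specialize (Hn n (Nat.le_refl _)). apply Rle_lt_trans with (1 := Rle_abs _) in Hn.
      rewrite (taylor_factor n ltac:(auto) w Hw), Cmod_mult, Cmod_pow.
      specialize (HM n w Hw).
      assert (Pn : 0 <= Cmod w ^ n) by (apply pow_le; lra).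
      apply (Rmult_le_compat_l _ _ _ Pn) in HM.
      assert (Prn : 0 < rho ^ n) by (apply pow_lt; lra).
      replace (Cmod w ^ n * (M * / rho ^ n * (rho / (rho - Cmod w)))) with
        ((Cmod w / rho) ^ n * k) in HM
        by (unfold Rdiv; rewrite Rpow_mult_distr, pow_inv; unfold k; field; lra).
      assert (0 <= (Cmod w / rho) ^ n).
      { apply pow_le, Rmult_le_pos; [lra | apply Rlt_le, Rinv_0_lt_compat; lra]. }
      apply (Rmult_lt_compat_r (k + 1)) in Hn; [|lra].
      replace (eps / (k + 1) * (k + 1)) with eps in Hn by (field; lra).
      nra.
  - right. apply not_all_ex_not in A.
    destruct (dec_inh_nat_subset_has_unique_least_element (fun n => T n 0 <> 0%C))
      as (n & (Hn & Hmin) & _).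
    { intro n. destruct (classic (T n 0 <> 0%C)); auto. }
    { exact A. }
    assert (Hz : forall k, (k < n)%nat -> T k 0 = 0%C).
    { intros k Hk. apply NNPP. intro N. specialize (Hmin k N). lia. }
    (* A bound for [|T (S n) w|] on [|w| < rho / 2], where [rho / (rho - |w|) <= 2]; the [+ 1] makes
       it positive. *)
    set (q := M * / rho ^ S n * 2 + 1).
    assert (Pq : 0 < q).
    { assert (0 < / rho ^ S n) by (apply Rinv_0_lt_compat, pow_lt; lra). unfold q. nra. }
    assert (Pc : 0 < Cmod (T n 0)) by (apply Cmod_gt_0, Hn).
    exists (Rmin (rho / 2) (Cmod (T n 0) / q)). split.
    { apply Rmin_glb_lt; [lra | apply Rdiv_lt_0_compat; lra]. }
    intros w [W1 W2].
    assert (W3 := Rlt_le_trans _ _ _ W2 (Rmin_l _ _)).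
    assert (W4 := Rlt_le_trans _ _ _ W2 (Rmin_r _ _)).
    rewrite (taylor_factor n Hz w) by lra.
    apply Cmult_neq_0; [apply Cpow_nz, Cmod_gt_0, W1|].
    rewrite (taylor_step n w) by lra.
    intro E. assert (E' : Cmod (T n 0) = Cmod (w * T (S n) w)%C).
    { rewrite <- Cmod_opp. f_equal. apply Ceq_minus.
      replace (- T n 0 - w * T (S n) w)%C with (- (T n 0 + w * T (S n) w))%C by ring.
      rewrite E. ring. }
    rewrite Cmod_mult in E'. specialize (HM (S n) w ltac:(lra)).
    assert (B : Cmod (T (S n) w) <= q).
    { eapply Rle_trans; [exact HM|]. unfold q.
      assert (H1 : rho / (rho - Cmod w) <= 2).
      { apply (Rmult_le_reg_r (rho - Cmod w)); [lra|].
        replace (rho / (rho - Cmod w) * (rho - Cmod w)) with rho by (field; lra). lra. }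
      assert (0 < / rho ^ S n) by (apply Rinv_0_lt_compat, pow_lt; lra).
      assert (0 <= M * / rho ^ S n) by nra. nra. }
    apply (Rmult_lt_compat_r q) in W4; [|exact Pq].
    replace (Cmod (T n 0) / q * q) with (Cmod (T n 0)) in W4 by (field; lra).
    nra.
Qed.
End Taylor.

(** The case could depend on the circle chosen, but isolation of the zero does not mention it. Once
    isolation is refuted, [F] vanishes inside every circle of radius below [r]. *)
Lemma zero_dichotomy (F : C -> C) (r : R) : holo_on_ball r F ->
  (forall w, Cmod w < r -> F w = 0%C) \/
  (exists d, 0 < d /\ forall w, 0 < Cmod w < d -> F w <> 0%C).
Proof.
  intro H. assert (HF : forall z, Cmod z < r -> exists l, has_cderiv F z l).
  { intros z Hz. apply cdiff_atP, H, Hz. }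
  destruct (classic (exists d, 0 < d /\ forall w, 0 < Cmod w < d -> F w <> 0%C)) as [A|A];
    [right; exact A | left].
  intros w Hw. pose proof (Cmod_ge_0 w).
  destruct (zero_dichotomy_circle F r ((Cmod w + r) / 2) HF) as [B|B]; [lra | | contradiction].
  apply B. lra.
Qed.

Lemma identity_theorem (F G : C -> C) (r : R) : 0 < r -> holo_on_ball r F -> holo_on_ball r G ->
  germ_eq F G -> forall z, Cmod z < r -> F z = G z.
Proof.
  intros Hr HF HG (d & Hd & E) z Hz.
  assert (HD : holo_on_ball r (fun z => F z + (- (1)) * G z)%C).
  { intros u Hu. apply cdiff_atP.
    destruct (proj1 (cdiff_atP F u) (HF u Hu)) as [l Hl].
    destruct (proj1 (cdiff_atP G u) (HG u Hu)) as [m Hm].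
    eexists. apply has_cderiv_plus; [exact Hl | apply has_cderiv_scal, Hm]. }
  destruct (zero_dichotomy _ r HD) as [A|(d' & Hd' & A)].
  - apply Ceq_minus. rewrite <- (A z Hz). ring.
  - exfalso. set (x := Rmin d d' / 2).
    assert (Px : 0 < x) by (pose proof (Rmin_glb_lt d d' 0 Hd Hd'); unfold x; lra).
    pose proof (Rmin_l d d'). pose proof (Rmin_r d d').
    assert (Ex : Cmod (RtoC x) = x) by (rewrite Cmod_R, Rabs_pos_eq; lra).
    apply (A (RtoC x)).
    + rewrite Ex. unfold x in *. lra.
    + rewrite E by (unfold ball0; rewrite Ex; unfold x in *; lra). ring.
Qed.

(** * Local inverses *)

Lemma C_geometric_limit (u : nat -> C) (A : R) :
  (forall n, Cmod (u (S n) - u n) <= A / 2 ^ n) ->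
  exists l, forall n, Cmod (u n - l) <= 4 * A / 2 ^ n.
Proof.
  intro H.
  assert (P2 : forall n, 0 < / 2 ^ n) by (intro n; apply Rinv_0_lt_compat, pow_lt; lra).
  assert (PA : 0 <= A).
  { specialize (H 0%nat). simpl in H. pose proof (Cmod_ge_0 (u 1%nat - u 0%nat)). lra. }
  assert (Hh : forall n x, x / 2 ^ S n = x / 2 ^ n / 2).
  { intros n x. simpl. field. apply pow_nonzero. lra. }
  assert (Hc : forall p : C -> R, (forall a b, p (a - b)%C = p a - p b) ->
            (forall a, Rabs (p a) <= Cmod a) ->
            exists l, forall n, Rabs (p (u n) - l) <= 2 * A / 2 ^ n).
  { intros p Hp Hb.
    (* The steps from index n on sum to at most [2 A / 2^n], so the intervals of that half-width
       around [p (u n)] are nested. *)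
    destruct (nested_intervals (fun n => p (u n) - 2 * A / 2 ^ n) (4 * A)) as [l Hl].
    - lra.
    - intro n. specialize (H n). pose proof (Hb (u (S n) - u n)%C) as B.
      rewrite Hp in B. apply Rle_trans with (2 := H) in B. apply Rabs_le_between in B.
      rewrite !Hh. unfold Rdiv in *. specialize (P2 n). nra.
    - exists l. intro n. specialize (Hl n). apply Rabs_le.
      unfold Rdiv in *. lra. }
  destruct (Hc fst) as [l1 H1].
  - intros; reflexivity.
  - intro a. eapply Rle_trans; [apply Rmax_l | apply Rmax_Cmod].
  - destruct (Hc snd) as [l2 H2].
    + intros; reflexivity.
    + intro a. eapply Rle_trans; [apply Rmax_r | apply Rmax_Cmod].
    + exists (l1, l2). intro n. specialize (H1 n). specialize (H2 n).
      replace (u n - (l1, l2))%C with ((fst (u n) - l1)%R + Ci * (snd (u n) - l2)%R)%C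
        by (unfold Ci, Cminus, Cplus, Copp, Cmult, RtoC; simpl; f_equal; ring).
      eapply Rle_trans; [apply Cmod_triangle|].
      rewrite Cmod_mult, Cmod_Ci, !Cmod_R. unfold Rdiv in *. lra.
Qed.

(** [F - lam id] is Lipschitz with constant [|lam| / 2]. Here [lam] need not be the derivative of
    [F] at 0: perturbed functions keep the [lam] of the unperturbed one. *)
Definition near_linear (lam : C) (rho : R) (F : C -> C) : Prop :=
  forall x y, Cmod x < rho -> Cmod y < rho ->
    Cmod (F x - F y - lam * (x - y)) <= Cmod lam / 2 * Cmod (x - y).

Definition invertible_on (lam : C) (rho : R) (F : C -> C) : Prop :=
  lam <> 0%C /\ 0 < rho /\ F 0%C = 0%C /\ holo_on_ball rho F /\ near_linear lam rho F.

(** A total function chosen by [epsilon]: where no preimage exists in the disc its value is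
    unspecified. It is an inverse at least on [|y| < |lam| rho / 2], a radius common to all [F] with
    the same [lam] and [rho]. *)
Definition inv_on (rho : R) (F : C -> C) (y : C) : C :=
  epsilon (inhabits (RtoC 0)) (fun x => Cmod x < rho /\ F x = y).

Lemma near_linear_lower (lam : C) (rho : R) (F : C -> C) (x y : C) :
  near_linear lam rho F -> Cmod x < rho -> Cmod y < rho ->
  Cmod lam / 2 * Cmod (x - y) <= Cmod (F x - F y).
Proof.
  intros H Hx Hy. specialize (H x y Hx Hy).
  pose proof (Cmod_triangle_inv (lam * (x - y)) (lam * (x - y) - (F x - F y))) as T.
  replace (lam * (x - y) - (lam * (x - y) - (F x - F y)))%C with (F x - F y)%C in T by ring.
  replace (lam * (x - y) - (F x - F y))%C with (- (F x - F y - lam * (x - y)))%C in T by ring.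
  rewrite Cmod_opp, Cmod_mult in T. lra.
Qed.

Lemma near_linear_upper (lam : C) (rho : R) (F : C -> C) (x y : C) :
  near_linear lam rho F -> Cmod x < rho -> Cmod y < rho ->
  Cmod (F x - F y) <= 2 * Cmod lam * Cmod (x - y).
Proof.
  intros H Hx Hy. specialize (H x y Hx Hy).
  replace (F x - F y)%C with ((F x - F y - lam * (x - y)) + lam * (x - y))%C by ring.
  eapply Rle_trans; [apply Cmod_triangle|]. rewrite Cmod_mult.
  pose proof (Cmod_ge_0 lam). pose proof (Cmod_ge_0 (x - y)). nra.
Qed.

Lemma Cminus_eq0 (x y : C) : Cmod (x - y) <= 0 -> x = y.
Proof.
  intro H. apply Ceq_minus, Cmod_eq_0. pose proof (Cmod_ge_0 (x - y)). lra.
Qed.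

Lemma invertible_on_inj (lam : C) (rho : R) (F : C -> C) (x y : C) :
  invertible_on lam rho F -> Cmod x < rho -> Cmod y < rho -> F x = F y -> x = y.
Proof.
  intros (Hl & _ & _ & _ & H) Hx Hy E. apply Cmod_gt_0 in Hl.
  pose proof (near_linear_lower lam rho F x y H Hx Hy) as L.
  rewrite E in L. replace (F y - F y)%C with (RtoC 0) in L by ring. rewrite Cmod_0 in L.
  apply Cminus_eq0. pose proof (Cmod_ge_0 (x - y)). nra.
Qed.

(** Newton's iteration with frozen slope, [x - (F x - y) / lam], started at 0. Each step is at most
    half the previous one and the first has length [A = |y| / |lam|], so the iterates stay within
    [2 A < rho]. *)
Lemma invertible_on_surj (lam : C) (rho : R) (F : C -> C) (y : C) :
  invertible_on lam rho F -> Cmod y < Cmod lam * rho / 2 ->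
  exists x, Cmod x < rho /\ F x = y.
Proof.
  intros (Hl & Hr & F0 & _ & H) Hy. pose proof (proj1 (Cmod_gt_0 lam) Hl) as Pl.
  set (A := Cmod y / Cmod lam).
  assert (PA : 0 <= A) by (apply Rmult_le_pos; [apply Cmod_ge_0 | apply Rlt_le, Rinv_0_lt_compat, Pl]).
  assert (HA : 2 * A < rho).
  { unfold A. apply (Rmult_lt_reg_r (Cmod lam)); [exact Pl|].
    replace (2 * (Cmod y / Cmod lam) * Cmod lam) with (2 * Cmod y) by (field; lra). lra. }
  set (u := fix u n := match n with O => RtoC 0 | S n => (u n - (F (u n) - y) / lam)%C end).
  assert (P2 : forall n, 0 < 2 ^ n) by (intro n; apply pow_lt; lra).
  assert (Hu : forall n, Cmod (u n) <= 2 * A * (1 - / 2 ^ n) /\ Cmod (u (S n) - u n) <= A / 2 ^ n).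
  { induction n as [|n [IH1 IH2]].
    - simpl. rewrite Cmod_0, F0. split; [lra|].
      replace (0 - (0 - y) / lam - 0)%C with (y / lam)%C by (field; exact Hl).
      rewrite Cmod_div by exact Hl. fold A. lra.
    - assert (Pi : 0 < / 2 ^ n) by (apply Rinv_0_lt_compat, P2).
      assert (Hi : / 2 ^ S n = / 2 ^ n / 2).
      { simpl. field. specialize (P2 n). lra. }
      assert (B1 : Cmod (u (S n)) <= 2 * A * (1 - / 2 ^ S n)).
      { replace (u (S n)) with (u n + (u (S n) - u n))%C by ring.
        eapply Rle_trans; [apply Cmod_triangle|]. rewrite Hi. unfold Rdiv in *. nra. }
      split; [exact B1|].
      assert (E : (u (S (S n)) - u (S n))%C =
        (- ((F (u (S n)) - F (u n) - lam * (u (S n) - u n)) / lam))%C).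
      { change (u (S (S n))) with (u (S n) - (F (u (S n)) - y) / lam)%C.
        assert (D : (lam * (u (S n) - u n))%C = (- (F (u n) - y))%C) by (simpl; field; exact Hl).
        rewrite D. field. exact Hl. }
      rewrite E, Cmod_opp, Cmod_div by exact Hl.
      assert (K : Cmod (F (u (S n)) - F (u n) - lam * (u (S n) - u n)) <=
                  Cmod lam / 2 * Cmod (u (S n) - u n)).
      { apply H.
        - assert (0 <= / 2 ^ S n) by (rewrite Hi; lra). nra.
        - nra. }
      apply (Rmult_le_reg_r (Cmod lam)); [exact Pl|].
      unfold Rdiv at 1. rewrite Rmult_assoc, Rinv_l, Rmult_1_r by lra.
      eapply Rle_trans; [exact K|].
      unfold Rdiv in *. rewrite Hi. nra. }
  destruct (C_geometric_limit u A) as [x Hx]; [intro n; apply Hu|].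
  assert (Hx2 : Cmod x <= 2 * A).
  { apply le_epsilon. intros eps He. destruct (pow2_small (4 * A) eps He) as [n Hn].
    specialize (Hx n). destruct (Hu n) as [U _].
    assert (0 < / 2 ^ n) by (apply Rinv_0_lt_compat, P2).
    replace x with (u n + - (u n - x))%C by ring.
    eapply Rle_trans; [apply Cmod_triangle|]. rewrite Cmod_opp. nra. }
  exists x. split; [lra|].
  apply Cminus_eq0, le_epsilon. intros eps He. rewrite Rplus_0_l.
  (* The distance from [x] to the n-th iterate, [4 A / 2^n], costs a factor [2 |lam|]; the defect of
     the iterate adds [|lam| A / 2^n]; together 8 + 1. *)
  destruct (pow2_small (9 * Cmod lam * A) eps He) as [n Hn].
  specialize (Hx n). destruct (Hu n) as [U1 U2].
  assert (Pi : 0 < / 2 ^ n) by (apply Rinv_0_lt_compat, P2).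
  replace (F x - y)%C with ((F x - F (u n)) + lam * - (u (S n) - u n))%C
    by (simpl u; field; exact Hl).
  eapply Rle_trans; [apply Cmod_triangle|]. rewrite Cmod_mult, Cmod_opp.
  assert (L : Cmod (F x - F (u n)) <= 2 * Cmod lam * Cmod (x - u n)).
  { apply near_linear_upper with rho; [exact H | lra | nra]. }
  replace (x - u n)%C with (- (u n - x))%C in L by ring. rewrite Cmod_opp in L.
  unfold Rdiv in *. nra.
Qed.

Lemma inv_on_spec (lam : C) (rho : R) (F : C -> C) (y : C) :
  invertible_on lam rho F -> Cmod y < Cmod lam * rho / 2 ->
  Cmod (inv_on rho F y) < rho /\ F (inv_on rho F y) = y.
Proof.
  intros HF Hy.
  exact (epsilon_spec (inhabits (RtoC 0)) (fun x => Cmod x < rho /\ F x = y)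
           (invertible_on_surj lam rho F y HF Hy)).
Qed.

Lemma inv_on_left (lam : C) (rho : R) (F : C -> C) (x : C) :
  invertible_on lam rho F -> Cmod x < rho -> inv_on rho F (F x) = x.
Proof.
  intros HF Hx.
  destruct (epsilon_spec (inhabits (RtoC 0)) (fun u => Cmod u < rho /\ F u = F x))
    as [H1 H2]; [exists x; auto|].
  apply (invertible_on_inj lam rho F); auto.
Qed.

Lemma inv_on_lipschitz (lam : C) (rho : R) (F : C -> C) (y y' : C) :
  invertible_on lam rho F -> Cmod y < Cmod lam * rho / 2 -> Cmod y' < Cmod lam * rho / 2 ->
  Cmod (inv_on rho F y - inv_on rho F y') <= 2 / Cmod lam * Cmod (y - y').
Proof.
  intros HF Hy Hy'.
  destruct (inv_on_spec lam rho F y HF Hy) as [A1 A2].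
  destruct (inv_on_spec lam rho F y' HF Hy') as [B1 B2].
  destruct HF as (Hl & _ & _ & _ & H). apply Cmod_gt_0 in Hl.
  pose proof (near_linear_lower lam rho F _ _ H A1 B1) as L. rewrite A2, B2 in L.
  apply (Rmult_le_reg_l (Cmod lam / 2)); [lra|].
  replace (Cmod lam / 2 * (2 / Cmod lam * Cmod (y - y'))) with (Cmod (y - y')) by (field; lra).
  exact L.
Qed.

Lemma inv_on_0 (lam : C) (rho : R) (F : C -> C) :
  invertible_on lam rho F -> inv_on rho F 0%C = 0%C.
Proof.
  intro HF. pose proof HF as (_ & Hr & F0 & _).
  rewrite <- F0 at 1. apply (inv_on_left lam); [exact HF | rewrite Cmod_0; exact Hr].
Qed.

Lemma inv_on_holo (lam : C) (rho : R) (F : C -> C) :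
  invertible_on lam rho F -> holo_on_ball (Cmod lam * rho / 2) (inv_on rho F).
Proof.
  intros HF y0 Hy0. unfold ball0 in Hy0.
  destruct (inv_on_spec lam rho F y0 HF Hy0) as [A1 A2].
  pose proof HF as (Hl & Hr & _ & Hh & H). pose proof (proj1 (Cmod_gt_0 lam) Hl) as Pl.
  set (x0 := inv_on rho F y0) in *.
  destruct (proj1 (cdiff_atP F x0) (Hh x0 A1)) as [l HL].
  (* Difference quotients of [F] are bounded below by [|lam| / 2], which excludes a zero derivative;
     a small real displacement tests this. *)
  assert (Hl0 : l <> 0%C).
  { intros ->. destruct (HL (Cmod lam / 4)) as (d & Hd & K); [lra|].
    set (s := Rmin (d / 2) ((rho - Cmod x0) / 2)).
    assert (Ps : 0 < s) by (apply Rmin_glb_lt; lra).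
    assert (s <= d / 2) by apply Rmin_l. assert (s <= (rho - Cmod x0) / 2) by apply Rmin_r.
    assert (Es : Cmod (x0 + s - x0) = s).
    { replace (x0 + s - x0)%C with (RtoC s) by ring. rewrite Cmod_R, Rabs_pos_eq; lra. }
    specialize (K (x0 + s)%C ltac:(lra)).
    assert (Hx : Cmod (x0 + s) < rho).
    { eapply Rle_lt_trans; [apply Cmod_triangle|]. rewrite Cmod_R, Rabs_pos_eq; lra. }
    pose proof (near_linear_lower lam rho F _ _ H Hx A1) as L.
    replace (F (x0 + s) - F x0 - 0 * (x0 + s - x0))%C with (F (x0 + s) - F x0)%C in K by ring.
    rewrite Es in K, L. nra. }
  pose proof (proj1 (Cmod_gt_0 l) Hl0) as Pl0.
  apply cdiff_atP. exists (/ l)%C. intros eps He.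
  destruct (HL (eps * Cmod l * Cmod lam / 2)) as (d & Hd & K).
  { apply Rmult_lt_0_compat; [|lra]. apply Rmult_lt_0_compat; [|lra].
    apply Rmult_lt_0_compat; lra. }
  exists (Rmin (d * Cmod lam / 2) (Cmod lam * rho / 2 - Cmod y0)). split.
  { apply Rmin_glb_lt; [|lra]. apply Rmult_lt_0_compat; [|lra]. apply Rmult_lt_0_compat; lra. }
  intros y Hy.
  assert (Y1 := Rlt_le_trans _ _ _ Hy (Rmin_l _ _)).
  assert (Y2 := Rlt_le_trans _ _ _ Hy (Rmin_r _ _)).
  assert (Hy' : Cmod y < Cmod lam * rho / 2).
  { replace y with (y0 + (y - y0))%C by ring.
    eapply Rle_lt_trans; [apply Cmod_triangle|]. lra. }
  destruct (inv_on_spec lam rho F y HF Hy') as [B1 B2].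
  pose proof (inv_on_lipschitz lam rho F y y0 HF Hy' Hy0) as Lip.
  fold x0 in Lip |- *. set (x := inv_on rho F y) in *.
  assert (Hxd : Cmod (x - x0) < d).
  { eapply Rle_lt_trans; [exact Lip|]. apply (Rmult_lt_reg_l (Cmod lam / 2)); [lra|].
    replace (Cmod lam / 2 * (2 / Cmod lam * Cmod (y - y0))) with (Cmod (y - y0)) by (field; lra).
    lra. }
  specialize (K x Hxd). rewrite B2, A2 in K.
  replace (x - x0 - / l * (y - y0))%C with (- (/ l * (y - y0 - l * (x - x0))))%C
    by (field; exact Hl0).
  rewrite Cmod_opp, Cmod_mult, Cmod_inv by exact Hl0.
  apply (Rmult_le_reg_l (Cmod l)); [exact Pl0|].
  rewrite <- Rmult_assoc, Rinv_r, Rmult_1_l by lra.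
  eapply Rle_trans; [exact K|].
  apply Rle_trans with (eps * Cmod l * Cmod lam / 2 * (2 / Cmod lam * Cmod (y - y0))).
  - apply Rmult_le_compat_l; [|exact Lip]. apply Rlt_le.
    apply Rmult_lt_0_compat; [|lra]. apply Rmult_lt_0_compat; [|lra].
    apply Rmult_lt_0_compat; lra.
  - right. field. lra.
Qed.

Lemma invertible_on_germ_inverse (lam : C) (rho : R) (F : C -> C) :
  invertible_on lam rho F -> germ_inverse F (inv_on rho F).
Proof.
  intro HF. pose proof HF as (Hl & Hr & F0 & Hh & H). apply Cmod_gt_0 in Hl.
  assert (P : 0 < Cmod lam * rho / 2) by nra.
  repeat split.
  - exists (Cmod lam * rho / 2). split; [exact P | apply inv_on_holo, HF].
  - apply (inv_on_0 lam), HF.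
  - exists rho. split; [exact Hr|]. intros z Hz. apply (inv_on_left lam); auto.
  - exists (Cmod lam * rho / 2). split; [exact P|]. intros z Hz.
    apply (inv_on_spec lam); auto.
Qed.

Lemma invertible_on_is_diff (lam : C) (rho : R) (F : C -> C) :
  invertible_on lam rho F -> is_diff F.
Proof.
  intro HF. pose proof HF as (Hl & Hr & F0 & Hh & H). repeat split; auto.
  - exists rho. auto.
  - exists (inv_on rho F). apply (invertible_on_germ_inverse lam), HF.
Qed.

(** Strict differentiability at 0. Differentiability at 0 bounds the remainder [G] by [k / 4 * s] on
    the circle of radius [s], and [cauchy_lipschitz] turns this into Lipschitz constant [k]
    inside. *)
Lemma deriv_lipschitz (F : C -> C) (r : R) (l : C) :
  0 < r -> holo_on_ball r F -> has_cderiv F 0 l ->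
  forall k, 0 < k -> exists rho, 0 < rho <= r /\
    forall x y, Cmod x < rho -> Cmod y < rho ->
      Cmod (F x - F y - l * (x - y)) <= k * Cmod (x - y).
Proof.
  intros Hr HF Hl k Hk.
  set (G := fun z => (F z + (- l * z + - F 0))%C).
  assert (HG : forall z, Cmod z < r -> exists m, has_cderiv G z m).
  { intros z Hz. destruct (proj1 (cdiff_atP F z) (HF z Hz)) as [m Hm].
    eexists. apply has_cderiv_plus; [exact Hm|].
    apply has_cderiv_plus; [apply has_cderiv_scal, has_cderiv_id | apply has_cderiv_const]. }
  destruct (Hl (k / 4)) as (d & Hd & HD); [lra|].
  set (s := Rmin d r / 2).
  assert (Ps : 0 < s) by (pose proof (Rmin_glb_lt d r 0 Hd Hr); unfold s; lra).
  assert (Hs1 : s < d) by (pose proof (Rmin_l d r); unfold s in *; lra).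
  assert (Hs2 : s < r) by (pose proof (Rmin_r d r); unfold s in *; lra).
  exists (s / 2). split; [lra|]. intros x y Hx Hy.
  replace (F x - F y - l * (x - y))%C with (G x - G y)%C by (unfold G; ring).
  replace k with (4 * (k / 4 * s) / s) by (field; lra).
  apply (cauchy_lipschitz G r s); try lra; [exact HG|].
  intros z Hz. unfold G.
  replace (F z + (- l * z + - F 0))%C with (F z - F 0 - l * (z - 0))%C by ring.
  assert (Ez : Cmod (z - 0) = s) by (replace (z - 0)%C with z by ring; exact Hz).
  rewrite <- Ez. apply HD. lra.
Qed.

(** If the derivative vanished, so would that of the composition with the inverse germ, which is the
    identity near 0. *)
Lemma is_diff_deriv_neq0 (h : C -> C) : is_diff h ->
  exists r l, 0 < r /\ holo_on_ball r h /\ has_cderiv h 0 l /\ l <> 0%C.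
Proof.
  intros ((r & Hr & Hh) & h0 & k & (s & Hs & Hk) & k0 & (d & Hd & E) & _).
  destruct (proj1 (cdiff_atP h 0) (Hh 0%C ltac:(unfold ball0; rewrite Cmod_0; exact Hr))) as [l Hl].
  destruct (proj1 (cdiff_atP k 0) (Hk 0%C ltac:(unfold ball0; rewrite Cmod_0; exact Hs))) as [m Hm].
  exists r, l. repeat split; auto. intros ->.
  rewrite <- h0 in Hm at 1.
  destruct (has_cderiv_comp k h 0 m 0 Hl Hm (1 / 2)) as (d' & Hd' & K); [lra|].
  set (x := Rmin d d' / 2).
  assert (Px : 0 < x) by (pose proof (Rmin_glb_lt d d' 0 Hd Hd'); unfold x; lra).
  pose proof (Rmin_l d d'). pose proof (Rmin_r d d').
  assert (Ex : Cmod (RtoC x) = x) by (rewrite Cmod_R, Rabs_pos_eq; lra).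
  specialize (K (RtoC x)).
  rewrite (E (RtoC x)), (E 0%C) in K by (unfold ball0; rewrite ?Ex, ?Cmod_0; unfold x in *; lra).
  replace (x - 0 - m * 0 * (x - 0))%C with (RtoC x) in K by ring.
  replace (x - 0)%C with (RtoC x) in K by ring.
  rewrite Ex in K. unfold x in *. lra.
Qed.

(** The three constants are chosen before [q]. This uniformity gives all perturbations one disc and
    one set of Lipschitz bounds, for openness and density alike. *)
Lemma is_diff_perturb (h : C -> C) (R0 : R) : is_diff h -> 0 < R0 ->
  exists lam rho eta, 0 < rho /\ 4 * rho <= R0 /\ 0 < eta /\
    forall q, holo_on_ball R0 q -> q 0%C = 0%C -> (forall z, Cmod z < R0 -> Cmod (q z) <= eta) ->
      invertible_on lam rho (fun z => h z + q z)%C.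
Proof.
  intros Hd HR. destruct (is_diff_deriv_neq0 h Hd) as (r & lam & Hr & Hh & Hl & Hl0).
  pose proof (proj1 (Cmod_gt_0 lam) Hl0) as Pl.
  destruct (deriv_lipschitz h r lam Hr Hh Hl (Cmod lam / 4)) as (s & Hs & HL); [lra|].
  (* The budget [|lam| / 2] is shared equally by [h] and [q]. On the circle of radius [R0 / 2],
     [cauchy_lipschitz] gives [q] the constant [8 eta / R0 = |lam| / 4] on the disc of radius
     [R0 / 4]. *)
  exists lam, (Rmin s (R0 / 4)), (Cmod lam * R0 / 32).
  pose proof (Rmin_l s (R0 / 4)). pose proof (Rmin_r s (R0 / 4)).
  split; [apply Rmin_glb_lt; lra|]. split; [lra|]. split; [nra|].
  intros q Hq q0 Hb.
  split; [exact Hl0|]. split; [apply Rmin_glb_lt; lra|].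
  split; [destruct Hd as (_ & h0 & _); rewrite h0, q0; ring|]. split.
  - intros z Hz. unfold ball0 in Hz. apply cdiff_atP.
    destruct (proj1 (cdiff_atP h z) (Hh z ltac:(unfold ball0; lra))) as [a Ha].
    destruct (proj1 (cdiff_atP q z) (Hq z ltac:(unfold ball0; lra))) as [b Hb'].
    eexists. apply has_cderiv_plus; eauto.
  - intros x y Hx Hy.
    replace (h x + q x - (h y + q y) - lam * (x - y))%C with
      ((h x - h y - lam * (x - y)) + (q x - q y))%C by ring.
    eapply Rle_trans; [apply Cmod_triangle|].
    specialize (HL x y ltac:(lra) ltac:(lra)).
    assert (B : Cmod (q x - q y) <= 4 * (Cmod lam * R0 / 32) / (R0 / 2) * Cmod (x - y)).
    { apply (cauchy_lipschitz q R0 (R0 / 2)); try lra.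
      - intros z Hz. apply cdiff_atP, Hq, Hz.
      - intros z Hz. apply Hb. lra. }
    replace (4 * (Cmod lam * R0 / 32) / (R0 / 2)) with (Cmod lam / 4) in B by (field; lra).
    lra.
Qed.

(** * Germs and words *)

(** A germ together with an explicit disc and Lipschitz constant. Composing n such maps costs a
    factor [L^n] in each, so the domain of a word is known from [sg], [L] and its length. *)
Definition tame (sg L : R) (F : C -> C) : Prop :=
  holo_on_ball sg F /\ F 0%C = 0%C /\
  forall x y, Cmod x < sg -> Cmod y < sg -> Cmod (F x - F y) <= L * Cmod (x - y).

Lemma tame_bound (sg L : R) (F : C -> C) (x : C) : tame sg L F -> Cmod x < sg ->
  Cmod (F x) <= L * Cmod x.
Proof.
  intros (_ & F0 & H) Hx.
  assert (H0 : Cmod 0 < sg) by (rewrite Cmod_0; pose proof (Cmod_ge_0 x); lra).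
  specialize (H x 0%C Hx H0). rewrite F0 in H.
  replace (F x - 0)%C with (F x) in H by ring. replace (x - 0)%C with x in H by ring. exact H.
Qed.

Lemma tame_weaken (sg L sg' L' : R) (F : C -> C) : tame sg L F -> sg' <= sg -> L <= L' ->
  tame sg' L' F.
Proof.
  intros (Hh & F0 & H) Hs HL. repeat split; auto.
  - intros z Hz. apply Hh. unfold ball0 in *. lra.
  - intros x y Hx Hy. eapply Rle_trans; [apply H; lra|].
    apply Rmult_le_compat_r; [apply Cmod_ge_0 | exact HL].
Qed.

Lemma tame_comp (sg tau L M : R) (F G : C -> C) : 0 <= L -> 0 < M -> M * tau <= sg ->
  tame sg L F -> tame tau M G -> tame tau (L * M) (fun z => F (G z)).
Proof.
  intros PL PM Hts HF HG.
  assert (Ht : forall z, Cmod z < tau -> Cmod (G z) < sg).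
  { intros z Hz. eapply Rle_lt_trans; [apply (tame_bound tau M G); assumption|].
    apply Rlt_le_trans with (2 := Hts). apply Rmult_lt_compat_l; assumption. }
  pose proof HF as (Fh & F0 & Fl). pose proof HG as (Gh & G0 & Gl). repeat split.
  - intros z Hz. apply cdiff_atP.
    destruct (proj1 (cdiff_atP G z) (Gh z Hz)) as [m Hm].
    destruct (proj1 (cdiff_atP F (G z)) (Fh (G z) (Ht z Hz))) as [l Hl].
    eexists. apply (has_cderiv_comp F G); eassumption.
  - rewrite G0. exact F0.
  - intros x y Hx Hy.
    eapply Rle_trans; [apply Fl; auto|]. rewrite Rmult_assoc.
    apply Rmult_le_compat_l; [exact PL | apply Gl; assumption].
Qed.

Definition compose (Fs : list (C -> C)) (z : C) : C := fold_right (fun F x => F x) z Fs.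

Lemma tame_compose (sg L : R) (Fs : list (C -> C)) : 0 < sg -> 1 <= L ->
  (forall F, In F Fs -> tame sg L F) ->
  tame (sg / L ^ length Fs) (L ^ length Fs) (compose Fs).
Proof.
  intros Hs HL. induction Fs as [|F Fs IH]; intro H; simpl.
  - repeat split.
    + intros z _. apply cdiff_atP. eexists. apply has_cderiv_id.
    + intros x y _ _. right. simpl. ring.
  - assert (P : 1 <= L ^ length Fs) by (apply pow_R1_Rle; lra).
    apply (tame_weaken (sg / L ^ length Fs) (L * L ^ length Fs)).
    + apply (tame_comp sg (sg / L ^ length Fs) L (L ^ length Fs) F (compose Fs)); try lra.
      * right. field. lra.
      * apply H. left. reflexivity.
      * apply IH. intros; apply H. right. assumption.
    + apply Rmult_le_compat_l; [lra|]. apply Rinv_le_contravar; [lra | nra].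
    + lra.
Qed.

Definition tame_close (sg L d : R) (F G : C -> C) : Prop :=
  tame sg L F /\ tame sg L G /\ forall z, Cmod z < sg -> Cmod (F z - G z) <= d.

(** Adding one map turns an error [x] into at most [L x + d]; as [L >= 1], [n L^n d] satisfies this
    recursion. *)
Lemma compose_close (sg L d : R) (Fs Gs : list (C -> C)) : 0 < sg -> 1 <= L -> 0 <= d ->
  Forall2 (tame_close sg L d) Fs Gs ->
  forall z, Cmod z < sg / L ^ length Fs ->
    Cmod (compose Fs z - compose Gs z) <= INR (length Fs) * L ^ length Fs * d.
Proof.
  intros Hs HL Hd H. induction H as [|F G Fs Gs (HF & HG & HD) HH IH]; intros z Hz.
  - simpl. replace (z - z)%C with (RtoC 0) by ring. rewrite Cmod_0. lra.
  - assert (P : 1 <= L ^ length Fs) by (apply pow_R1_Rle; lra).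
    assert (HzF : Cmod z < sg / L ^ length Fs).
    { apply Rlt_le_trans with (1 := Hz). simpl.
      apply Rmult_le_compat_l; [lra|]. apply Rinv_le_contravar; [lra | nra]. }
    specialize (IH z HzF).
    assert (EL : length Gs = length Fs) by (symmetry; apply (Forall2_length HH)).
    assert (Hin : (forall F, In F Fs -> tame sg L F) /\ (forall F, In F Gs -> tame sg L F)).
    { clear -HH. induction HH as [|F G Fs Gs (HF & HG & _) HH [I1 I2]].
      - split; intros ? [].
      - split; intros K [<-|HK]; auto. }
    destruct Hin as [I1 I2].
    assert (B : forall Ks, length Ks = length Fs -> (forall F, In F Ks -> tame sg L F) ->
              Cmod (compose Ks z) < sg).
    { intros Ks E IK. pose proof (tame_compose sg L Ks Hs HL IK) as T. rewrite E in T.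
      pose proof (tame_bound _ _ _ _ T HzF) as T'.
      apply (Rmult_lt_compat_l (L ^ length Fs)) in HzF; [|lra].
      replace (L ^ length Fs * (sg / L ^ length Fs)) with sg in HzF by (field; lra). lra. }
    pose proof (B Fs eq_refl I1) as BF. pose proof (B Gs EL I2) as BG.
    change (compose (F :: Fs) z) with (F (compose Fs z)).
    change (compose (G :: Gs) z) with (G (compose Gs z)).
    replace (F (compose Fs z) - G (compose Gs z))%C with
      ((F (compose Fs z) - F (compose Gs z)) + (F (compose Gs z) - G (compose Gs z)))%C by ring.
    eapply Rle_trans; [apply Cmod_triangle|].
    destruct HF as (_ & _ & Fl). specialize (Fl _ _ BF BG). specialize (HD _ BG).
    change (length (F :: Fs)) with (S (length Fs)). rewrite S_INR. simpl pow.
    pose proof (pos_INR (length Fs)).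
    apply (Rmult_le_compat_l L) in IH; [|lra].
    assert (1 <= L * L ^ length Fs) by nra.
    assert (d <= L * L ^ length Fs * d) by nra.
    lra.
Qed.

(** * Calculus of germs fixing 0 *)

Definition germ_fix0 (F : C -> C) : Prop := holo_germ F /\ F 0%C = 0%C.

Lemma germ_tame (F : C -> C) : germ_fix0 F -> exists sg L, 0 < sg /\ 1 <= L /\ tame sg L F.
Proof.
  intros [(r & Hr & Hh) F0].
  destruct (proj1 (cdiff_atP F 0) (Hh 0%C ltac:(unfold ball0; rewrite Cmod_0; exact Hr))) as [l Hl].
  destruct (deriv_lipschitz F r l Hr Hh Hl 1 Rlt_0_1) as (s & Hs & H).
  pose proof (Cmod_ge_0 l).
  exists s, (1 + Cmod l). repeat split; try lra; auto.
  - intros z Hz. apply Hh. unfold ball0 in *. lra.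
  - intros x y Hx Hy.
    replace (F x - F y)%C with ((F x - F y - l * (x - y)) + l * (x - y))%C by ring.
    eapply Rle_trans; [apply Cmod_triangle|]. rewrite Cmod_mult.
    specialize (H x y Hx Hy). lra.
Qed.

Lemma tame_germ (sg L : R) (F : C -> C) : 0 < sg -> tame sg L F -> germ_fix0 F.
Proof. intros Hs (Hh & F0 & _). split; [exists sg; auto | exact F0]. Qed.

Lemma germ_fix0_id : germ_fix0 (fun z => z).
Proof.
  split; [|reflexivity]. exists 1. split; [lra|]. intros z _. apply cdiff_atP.
  eexists. apply has_cderiv_id.
Qed.

Lemma near0_and (P Q : C -> Prop) : near0 P -> near0 Q -> near0 (fun z => P z /\ Q z).
Proof.
  intros (r & Hr & HP) (s & Hs & HQ). exists (Rmin r s). split; [apply Rmin_glb_lt; auto|].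
  intros z Hz. unfold ball0 in *. pose proof (Rmin_l r s). pose proof (Rmin_r r s).
  split; [apply HP | apply HQ]; unfold ball0; lra.
Qed.

Lemma near0_impl (P Q : C -> Prop) : (forall z, P z -> Q z) -> near0 P -> near0 Q.
Proof. intros H (r & Hr & HP). exists r. auto. Qed.

Lemma near0_comp (P : C -> Prop) (F : C -> C) : germ_fix0 F -> near0 P -> near0 (fun z => P (F z)).
Proof.
  intros HF (r & Hr & HP). destruct (germ_tame F HF) as (s & L & Hs & HL & HT).
  exists (Rmin s (r / L)). split; [apply Rmin_glb_lt; [exact Hs | apply Rdiv_lt_0_compat; lra]|].
  intros z Hz. unfold ball0 in *. pose proof (Rmin_l s (r / L)). pose proof (Rmin_r s (r / L)).
  apply HP. unfold ball0. eapply Rle_lt_trans; [apply (tame_bound s L F); [exact HT | lra]|].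
  apply Rlt_le_trans with (L * (r / L)); [apply Rmult_lt_compat_l; lra|].
  right. field. lra.
Qed.

Lemma germ_fix0_comp (F G : C -> C) : germ_fix0 F -> germ_fix0 G -> germ_fix0 (fun z => F (G z)).
Proof.
  intros [(r & Hr & Fh) F0] HG. pose proof HG as [(s & Hs & Gh) G0].
  split; [|rewrite G0; exact F0].
  destruct (near0_comp (fun z => cdiff_at F z) G HG) as (t & Ht & HT); [exists r; auto|].
  exists (Rmin s t). split; [apply Rmin_glb_lt; auto|].
  intros z Hz. unfold ball0 in *. pose proof (Rmin_l s t). pose proof (Rmin_r s t).
  destruct (proj1 (cdiff_atP G z) (Gh z ltac:(unfold ball0; lra))) as [m Hm].
  destruct (proj1 (cdiff_atP F (G z)) (HT z ltac:(unfold ball0; lra))) as [l Hl].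
  apply cdiff_atP. eexists. apply (has_cderiv_comp F G); eassumption.
Qed.

Lemma germ_fix0_iter (n : nat) (F : C -> C) : germ_fix0 F -> germ_fix0 (Nat.iter n F).
Proof.
  intro H. induction n as [|n IH]; [exact germ_fix0_id | exact (germ_fix0_comp F _ H IH)].
Qed.

Lemma germ_eq_refl (F : C -> C) : germ_eq F F.
Proof. exists 1. split; [lra | auto]. Qed.

Lemma germ_eq_sym (F G : C -> C) : germ_eq F G -> germ_eq G F.
Proof. apply near0_impl. auto. Qed.

Lemma germ_eq_trans (F G H : C -> C) : germ_eq F G -> germ_eq G H -> germ_eq F H.
Proof.
  intros A B. refine (near0_impl _ _ _ (near0_and _ _ A B)). intros z [-> ->]. reflexivity.
Qed.

Lemma germ_eq_comp (F F' G G' : C -> C) : germ_fix0 G -> germ_eq F F' -> germ_eq G G' ->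
  germ_eq (fun z => F (G z)) (fun z => F' (G' z)).
Proof.
  intros HG HF HGG. refine (near0_impl _ _ _ (near0_and _ _ (near0_comp _ G HG HF) HGG)).
  intros z [A B]. rewrite A, B. reflexivity.
Qed.

(** Near 0, [K (F (K' z))] equals both [K' z] and [K z]. Allowing different representatives [F],
    [F'] lets [inv_on] be exchanged for any other inverse germ. *)
Lemma germ_inverse_unique (F F' K K' : C -> C) :
  germ_fix0 F' -> germ_eq F F' -> germ_inverse F K -> germ_inverse F' K' -> germ_eq K K'.
Proof.
  intros HF E (Kh & K0 & K1 & K2) (Kh' & K0' & K1' & K2').
  assert (A : germ_eq (fun z => K (F (K' z))) K').
  { exact (near0_comp (fun z => K (F z) = z) K' (conj Kh' K0') K1). }
  apply germ_eq_trans with (2 := A).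
  assert (B : germ_eq (fun z => F (K' z)) (fun z => z)).
  { apply germ_eq_trans with (2 := K2').
    apply (germ_eq_comp F F' K' K' (conj Kh' K0') E (germ_eq_refl _)). }
  apply germ_eq_sym.
  refine (near0_impl _ _ _ B). intros z Hz. rewrite Hz. reflexivity.
Qed.

Lemma is_diff_inverse (f finv : C -> C) : is_diff f -> germ_inverse f finv -> is_diff finv.
Proof.
  intros (Hf & f0 & _) (Hk & k0 & E1 & E2). repeat split; auto.
  exists f. repeat split; auto.
Qed.

Lemma iter_inverse (n : nat) (f k : C -> C) : germ_fix0 f -> germ_fix0 k ->
  germ_eq (fun z => k (f z)) (fun z => z) ->
  germ_eq (fun z => Nat.iter n k (Nat.iter n f z)) (fun z => z).
Proof.
  intros Hf Hk E. induction n as [|n IH]; [apply germ_eq_refl|].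
  apply germ_eq_trans with (2 := IH).
  assert (A := near0_comp _ (Nat.iter n f) (germ_fix0_iter n f Hf) E).
  refine (near0_impl _ _ _ A). intros z Hz.
  change (Nat.iter (S n) f z) with (f (Nat.iter n f z)).
  rewrite Nat.iter_succ_r, Hz. reflexivity.
Qed.

Lemma infinite_order_inverse (f finv : C -> C) : is_diff f -> germ_inverse f finv ->
  infinite_order f -> infinite_order finv.
Proof.
  intros (Hf & f0 & _) (Hk & k0 & E1 & E2) H n Hn E. apply (H n Hn).
  apply germ_eq_trans with (fun z => Nat.iter n f (Nat.iter n finv z)).
  - apply (germ_eq_comp (Nat.iter n f) (Nat.iter n f) (fun z => z) (Nat.iter n finv)).
    + apply germ_fix0_id.
    + apply germ_eq_refl.
    + apply germ_eq_sym, E.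
  - apply iter_inverse; [split; auto | split; auto | exact E2].
Qed.

Definition moving_germ (F : C -> C) : Prop :=
  germ_fix0 F /\ exists rho, 0 < rho /\
    (forall x y, Cmod x < rho -> Cmod y < rho -> F x = F y -> x = y) /\
    (forall x, Cmod x < rho -> x <> 0%C -> F x <> x).

(** Infinite order excludes that [f^n - id] vanishes identically on a disc, so its zero at 0 is
    isolated. Injectivity comes from the iterated inverse germ. *)
Lemma moving_iter (f : C -> C) (n : nat) : is_diff f -> infinite_order f -> (1 <= n)%nat ->
  moving_germ (Nat.iter n f).
Proof.
  intros (Hf & f0 & k & Hk & k0 & E1 & E2) Hinf Hn.
  assert (HF : germ_fix0 (Nat.iter n f)) by (apply germ_fix0_iter; split; auto).
  split; [exact HF|].
  destruct (iter_inverse n f k) as (a & Ha & A); [split; auto | split; auto | exact E1 |].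
  pose proof HF as [(r & Hr & Fh) _].
  assert (HD : holo_on_ball r (fun z => Nat.iter n f z + (- (1)) * z)%C).
  { intros z Hz. apply cdiff_atP. destruct (proj1 (cdiff_atP _ z) (Fh z Hz)) as [l Hl].
    eexists. apply has_cderiv_plus; [exact Hl | apply has_cderiv_scal, has_cderiv_id]. }
  destruct (zero_dichotomy _ r HD) as [Z|(d & Hd & Z)].
  - exfalso. apply (Hinf n Hn). exists r. split; [exact Hr|]. intros z Hz.
    apply Ceq_minus. rewrite <- (Z z Hz). ring.
  - exists (Rmin a d). pose proof (Rmin_l a d). pose proof (Rmin_r a d).
    split; [apply Rmin_glb_lt; auto|]. split.
    + intros x y Hx Hy E. rewrite <- (A x) by (unfold ball0; lra).
      rewrite <- (A y) by (unfold ball0; lra). rewrite E. reflexivity.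
    + intros x Hx Nx E. apply (Z x).
      * split; [apply Cmod_gt_0, Nx | lra].
      * rewrite E. ring.
Qed.

(* A syllable (b, F) stands for F when b is false and for its conjugate
   h^{-1} F h when b is true. *)
Definition syllable := (bool * (C -> C))%type.

Definition syl_map (h k : C -> C) (x : syllable) (z : C) : C :=
  if fst x then k (snd x (h z)) else snd x z.

Definition syl_eval (h k : C -> C) (s : list syllable) : C -> C := compose (map (syl_map h k) s).

Fixpoint alternating (s : list syllable) : Prop :=
  match s with
  | nil => True
  | x :: s' => match s' with nil => True | y :: _ => fst x <> fst y end /\ alternating s'
  end.

Lemma germ_fix0_syl (h k : C -> C) (x : syllable) : germ_fix0 h -> germ_fix0 k ->
  germ_fix0 (snd x) -> germ_fix0 (syl_map h k x).
Proof.
  intros Hh Hk Hx. unfold syl_map. destruct (fst x); [|exact Hx].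
  apply (germ_fix0_comp k (fun z => snd x (h z)) Hk), germ_fix0_comp; assumption.
Qed.

Lemma germ_fix0_syl_eval (h k : C -> C) (s : list syllable) : germ_fix0 h -> germ_fix0 k ->
  List.Forall (fun x => germ_fix0 (snd x)) s -> germ_fix0 (syl_eval h k s).
Proof.
  intros Hh Hk H. induction H as [|x s Hx _ IH]; [exact germ_fix0_id|].
  apply (germ_fix0_comp (syl_map h k x) (syl_eval h k s)); [|exact IH].
  apply germ_fix0_syl; assumption.
Qed.

(** Runs of one letter merge into a power with positive exponent, inverse letters having base [finv]
    or [ginv]. Inside a run of conjugates [h (k z) = z] holds only near 0, so the conclusion is an
    equality of germs. *)
Lemma word_syllables (f finv g ginv : C -> C) :
  (forall l : letter, germ_fix0
    (if fst l then if snd l then ginv else g else if snd l then finv else f)) ->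
  (forall (l : letter) n, (1 <= n)%nat -> moving_germ (Nat.iter n
    (if fst l then if snd l then ginv else g else if snd l then finv else f))) ->
  forall w : list letter, w <> nil -> reduced w ->
  exists s, s <> nil /\ alternating s /\ List.Forall (fun x => moving_germ (snd x)) s /\
    forall h k, germ_fix0 h -> germ_inverse h k ->
      germ_eq (eval_word w f finv (fun z => k (g (h z))) (fun z => k (ginv (h z))))
              (syl_eval h k s).
Proof.
  set (base := fun l : letter => if fst l then if snd l then ginv else g
                                 else if snd l then finv else f).
  intros Hbase Hmov w Hw Hred.
  assert (Hev : forall (l : letter) w h k z,
    eval_word (l :: w) f finv (fun z => k (g (h z))) (fun z => k (ginv (h z))) z =
    syl_map h k (fst l, base l)
      (eval_word w f finv (fun z => k (g (h z))) (fun z => k (ginv (h z))) z)).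
  { intros [[] []] w0 h k z; reflexivity. }
  (* The first syllable is kept as an explicit power of the head letter, so that one more copy of
     that letter just raises the exponent. The default of [hd] is never reached. *)
  assert (Main : exists n s, alternating ((fst (hd (false, false) w),
                    Nat.iter (S n) (base (hd (false, false) w))) :: s) /\
    List.Forall (fun x => moving_germ (snd x)) s /\
    forall h k, germ_fix0 h -> germ_inverse h k ->
      germ_eq (eval_word w f finv (fun z => k (g (h z))) (fun z => k (ginv (h z))))
              (syl_eval h k ((fst (hd (false, false) w),
                    Nat.iter (S n) (base (hd (false, false) w))) :: s))).
  { induction w as [|l w IH]; [contradiction|].
    destruct w as [|l' w].
    - exists 0%nat, nil. simpl hd. repeat split; auto. intros h k _ _.
      exists 1. split; [lra|]. intros z _. rewrite Hev. reflexivity.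
    - destruct Hred as [Hll Hred].
      destruct (IH ltac:(discriminate) Hred) as (n & s & Halt & Hs & E). clear IH.
      simpl hd in *.
      destruct (Bool.bool_dec (fst l) (fst l')) as [Efst|Nfst].
      (* Reducedness: neighbours of the same type are not inverse to each other, hence equal. *)
      + assert (El : l = l').
        { destruct l as [a b], l' as [a' b']; simpl in *. subst a'. f_equal.
          destruct (Bool.bool_dec b b') as [|N]; [assumption|].
          exfalso. apply Hll. split; [reflexivity | exact N]. }
        subst l'. exists (S n), s. split; [exact Halt|]. split; [exact Hs|].
        intros h k Hh Hk. specialize (E h k Hh Hk).
        pose proof Hk as (Kh & K0 & K1 & K2). assert (Hk0 : germ_fix0 k) by (split; auto).
        assert (Hs' : germ_fix0 (syl_eval h k s)).
        { apply germ_fix0_syl_eval; auto. revert Hs. apply Forall_impl. intros x [Hx _]. exact Hx. }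
        assert (HW : germ_fix0 (syl_eval h k ((fst l, Nat.iter (S n) (base l)) :: s))).
        { apply germ_fix0_syl_eval; auto. constructor.
          - apply germ_fix0_iter, Hbase.
          - revert Hs. apply Forall_impl. intros x [Hx _]. exact Hx. }
        apply germ_eq_trans with
          (fun z => syl_map h k (fst l, base l)
             (syl_eval h k ((fst l, Nat.iter (S n) (base l)) :: s) z)).
        { refine (near0_impl _ _ _ E). intros z Hz. rewrite Hev, Hz. reflexivity. }
        change (germ_eq (fun z => syl_map h k (fst l, base l)
                   (syl_map h k (fst l, Nat.iter (S n) (base l)) (syl_eval h k s z)))
                 (fun z => syl_map h k (fst l, Nat.iter (S (S n)) (base l)) (syl_eval h k s z))).
        refine (near0_comp (fun x => syl_map h k (fst l, base l)
          (syl_map h k (fst l, Nat.iter (S n) (base l)) x) =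
          syl_map h k (fst l, Nat.iter (S (S n)) (base l)) x) (syl_eval h k s) Hs' _).
        unfold syl_map; simpl fst; simpl snd. destruct (fst l).
        * assert (B : germ_fix0 (fun z => Nat.iter (S n) (base l) (h z))).
          { apply germ_fix0_comp; [apply germ_fix0_iter, Hbase | exact Hh]. }
          refine (near0_impl _ _ _ (near0_comp _ _ B K2)). intros z Hz. cbv beta in Hz.
          change (k (base l (h (k (Nat.iter (S n) (base l) (h z))))) =
                  k (base l (Nat.iter (S n) (base l) (h z)))).
          rewrite Hz. reflexivity.
        * exists 1. split; [lra | reflexivity].
      + exists 0%nat, ((fst l', Nat.iter (S n) (base l')) :: s). split; [|split].
        * split; [exact Nfst | exact Halt].
        * constructor; [apply Hmov; lia | exact Hs].
        * intros h k Hh Hk. refine (near0_impl _ _ _ (E h k Hh Hk)).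
          intros z Hz. rewrite Hev, Hz. reflexivity. }
  destruct Main as (n & s & Halt & Hs & E).
  exists ((fst (hd (false, false) w), Nat.iter (S n) (base (hd (false, false) w))) :: s).
  split; [discriminate|]. split; [exact Halt|]. split; [|exact E].
  constructor; [apply Hmov; lia | exact Hs].
Qed.

(** * Making a word nontrivial by a small perturbation *)

Definition root_poly (D : list C) (z : C) : C := fold_right (fun d x => (z - d) * x)%C 1%C D.

Lemma root_poly_holo (D : list C) (z : C) : exists l, has_cderiv (root_poly D) z l.
Proof.
  induction D as [|d D [l IH]].
  - exists 0%C. apply has_cderiv_const.
  - eexists. apply (has_cderiv_mult (fun z => z - d)%C (root_poly D)); [|exact IH].
    apply has_cderiv_plus; [apply has_cderiv_id | apply has_cderiv_const].
Qed.

Lemma root_poly_root (D : list C) (d : C) : In d D -> root_poly D d = 0%C.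
Proof.
  induction D as [|a D IH]; [intros []|]. intros [->|H]; simpl.
  - ring.
  - rewrite (IH H). ring.
Qed.

Lemma root_poly_neq0 (D : list C) (x : C) : ~ In x D -> root_poly D x <> 0%C.
Proof.
  induction D as [|a D IH]; intro H; simpl; [exact C1_nz|].
  apply Cmult_neq_0.
  - intro E. apply H. left. symmetry. apply Ceq_minus, E.
  - apply IH. intro K. apply H. right. exact K.
Qed.

Lemma root_poly_bounded (D : list C) (R0 : R) : 0 < R0 ->
  exists M, 0 < M /\ forall z, Cmod z < R0 -> Cmod (root_poly D z) <= M.
Proof.
  intro HR. induction D as [|d D (M & HM & IH)].
  - exists 1. split; [lra|]. intros z _. simpl. rewrite Cmod_1. lra.
  - pose proof (Cmod_ge_0 d). exists ((R0 + Cmod d) * M). split; [nra|].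
    intros z Hz. simpl. rewrite Cmod_mult.
    apply Rmult_le_compat; try apply Cmod_ge_0; [|apply IH, Hz].
    eapply Rle_trans; [apply Cmod_triangle|]. rewrite Cmod_opp. lra.
Qed.

(** Each element of the list excludes at most one [t], so any [t] below the least positive excluded
    value will do. *)
Lemma avoid_list (A : Type) (l : list A) (B : A -> R -> Prop) :
  (forall d t t', B d t -> B d t' -> t = t') ->
  forall tau, 0 < tau -> exists t, 0 < t < tau /\ forall d, In d l -> ~ B d t.
Proof.
  intros HB tau Ht.
  assert (exists tau', 0 < tau' <= tau /\ forall t, 0 < t < tau' -> forall d, In d l -> ~ B d t)
    as (tau' & Ht' & H).
  { induction l as [|a l (tau' & Ht' & IH)].
    - exists tau. split; [lra|]. intros t _ d [].
    - destruct (classic (exists t, 0 < t /\ B a t)) as [(t0 & P0 & B0)|N].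
      + exists (Rmin tau' t0). pose proof (Rmin_l tau' t0). pose proof (Rmin_r tau' t0).
        split; [split; [apply Rmin_glb_lt|]; lra|].
        intros t Htt d [<-|Hd] Bd.
        * pose proof (HB a t t0 Bd B0). lra.
        * apply (IH t ltac:(lra) d Hd Bd).
      + exists tau'. split; [exact Ht'|]. intros t Htt d [<-|Hd] Bd.
        * apply N. exists t. split; [lra | exact Bd].
        * apply (IH t Htt d Hd Bd). }
  exists (tau' / 2). split; [lra|]. apply H. lra.
Qed.

(** As in [basic_nbhd], the sup bound is strictly below [eta]. The slack [eta - d] always allows
    another perturbation, so finitely many can be made in succession. *)
Definition small_on (R0 eta : R) (q : C -> C) : Prop :=
  holo_on_ball R0 q /\ q 0%C = 0%C /\
  exists d, d < eta /\ forall z, Cmod z < R0 -> Cmod (q z) <= d.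

Lemma small_on_perturb (R0 eta : R) (q : C -> C) (D : list C) : 0 < R0 ->
  small_on R0 eta q -> In (RtoC 0) D ->
  exists tau, 0 < tau /\ forall t, 0 < t < tau ->
    small_on R0 eta (fun z => q z + t * root_poly D z)%C.
Proof.
  intros HR (Hq & q0 & d & Hd & Hb) HD.
  destruct (root_poly_bounded D R0 HR) as (M & HM & HP).
  exists ((eta - d) / M). split; [apply Rdiv_lt_0_compat; lra|].
  intros t Ht. repeat split.
  - intros z Hz. apply cdiff_atP. destruct (proj1 (cdiff_atP q z) (Hq z Hz)) as [l Hl].
    destruct (root_poly_holo D z) as [m Hm].
    eexists. apply has_cderiv_plus; [exact Hl | apply has_cderiv_scal, Hm].
  - rewrite q0, root_poly_root by exact HD. ring.
  - exists (d + t * M). split.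
    + destruct Ht as [_ Ht]. apply (Rmult_lt_compat_r M) in Ht; [|exact HM].
      replace ((eta - d) / M * M) with (eta - d) in Ht by (field; lra). lra.
    + intros z Hz. eapply Rle_trans; [apply Cmod_triangle|].
      rewrite Cmod_mult, Cmod_R, Rabs_pos_eq by lra.
      specialize (Hb z Hz). specialize (HP z Hz).
      apply Rplus_le_compat; [exact Hb|]. apply Rmult_le_compat_l; lra.
Qed.

(** * Itinerary of one point under successive perturbations *)

Section Itinerary.
Variables (h0 : C -> C) (R0 eta rho sg L : R) (lam z0 : C) (N : nat).
Let H (q : C -> C) (z : C) : C := (h0 z + q z)%C.
Let K (q : C -> C) : C -> C := inv_on rho (H q).
Let W (q : C -> C) (s : list syllable) : C := syl_eval (H q) (K q) s z0.
Let good (F : C -> C) : Prop :=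
  tame sg L F /\
  (forall x y, Cmod x < sg -> Cmod y < sg -> F x = F y -> x = y) /\
  (forall x, Cmod x < sg -> x <> 0%C -> F x <> x).

Hypothesis HR : 0 < R0.
Hypothesis Heta : 0 < eta.
Hypothesis Hinv : forall q, small_on R0 eta q -> invertible_on lam rho (H q).
Hypothesis Hsg : 0 < sg.
Hypothesis Hsg1 : sg <= rho.
Hypothesis Hsg2 : sg <= Cmod lam * rho / 2.
Hypothesis HL : 1 <= L.
Hypothesis HtH : forall q, small_on R0 eta q -> tame sg L (H q).
Hypothesis Hz0 : z0 <> 0%C.
(** Uniform in [q], so the point can be followed while the conjugator changes. The radius [sg / L^3]
    leaves room for the three maps of a conjugated syllable. *)
Hypothesis HW : forall q s, small_on R0 eta q -> List.Forall (fun x => good (snd x)) s ->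
  (length s <= N)%nat -> Cmod (W q s) < sg / L ^ 3.

(* In the following two invariants D lists the points at which the conjugator
   is already prescribed; the first one is for words ending with a power of f,
   the second one for words ending with a conjugated power of g, where the
   prescribed data is the image under the conjugator of the current point. *)
Definition state_f (s : list syllable) (q : C -> C) (D : list C) (x : C) : Prop :=
  small_on R0 eta q /\ (forall d, In d D -> Cmod d < sg) /\ In (RtoC 0) D /\
  (s = nil \/ In z0 D) /\ ~ In x D /\
  forall q', small_on R0 eta q' -> (forall d, In d D -> q' d = q d) -> W q' s = x.

Definition state_g (s : list syllable) (q : C -> C) (D : list C) (y : C) : Prop :=
  small_on R0 eta q /\ (forall d, In d D -> Cmod d < sg) /\ In (RtoC 0) D /\
  In z0 D /\ (forall d, In d D -> H q d <> y) /\
  forall q', small_on R0 eta q' -> (forall d, In d D -> q' d = q d) -> H q' (W q' s) = y.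

Lemma small_radius : 0 < sg / L ^ 3 /\ L * (sg / L ^ 3) <= sg /\ L * (L * (sg / L ^ 3)) <= sg.
Proof.
  assert (P : 1 <= L ^ 3) by (apply pow_R1_Rle; lra).
  replace (L * (sg / L ^ 3)) with (sg / (L * L)) by (field; lra).
  replace (L * (sg / (L * L))) with (sg / L) by (field; lra).
  assert (E : forall a, 1 <= a -> sg / a <= sg).
  { intros a Ha. apply (Rmult_le_reg_r a); [lra|].
    replace (sg / a * a) with sg by (field; lra). nra. }
  split; [apply Rdiv_lt_0_compat; lra|]. split; apply E; nra.
Qed.

Lemma tame_small (F : C -> C) (x : C) : tame sg L F -> Cmod x < sg / L ^ 3 ->
  Cmod x < sg /\ Cmod (F x) < L * (sg / L ^ 3) /\ Cmod (F x) < sg.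
Proof.
  intros HF Hx. destruct small_radius as (P1 & P2 & _).
  assert (Hx' : Cmod x < sg) by nra.
  pose proof (tame_bound sg L F x HF Hx') as B.
  assert (Cmod (F x) < L * (sg / L ^ 3)) by nra. lra.
Qed.

(** As [x] is not in [D], the perturbation really moves its image under the conjugator. The new data
    is [F (H q1 x)], before the inverse conjugator is applied: the position of its preimage still
    depends on the perturbation, and [step_f] exploits this freedom. *)
Lemma step_g (s : list syllable) (q : C -> C) (D : list C) (x : C) (F : C -> C) :
  state_f s q D x -> List.Forall (fun x => good (snd x)) s -> (length s <= N)%nat -> good F ->
  exists q1 D1 y1, state_g ((true, F) :: s) q1 D1 y1.
Proof.
  intros (Hq & HD & D0 & Dz & Dx & HWx) Hs Hlen (Ft & Finj & Ffix).
  set (p := root_poly D).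
  assert (Px : p x <> 0%C) by (apply root_poly_neq0, Dx).
  assert (Hx : Cmod x < sg / L ^ 3) by (rewrite <- (HWx q Hq ltac:(auto)); auto).
  destruct small_radius as (S1 & S2 & S3).
  destruct (small_on_perturb R0 eta q D HR Hq D0) as (tau & Htau & Hper).
  (* Since [F] is injective and [p x <> 0], the image equals a prescribed value [H q d] for at most
     one [t]. The value at the new point [x] is avoided because [F] has no nonzero fixed point. *)
  destruct (avoid_list C D (fun d t => Cmod (H q x + t * p x) < sg /\
              F (H q x + t * p x)%C = H q d)) with (tau := tau) as (t & Ht & Hav).
  { intros d t t' [A1 A2] [B1 B2].
    assert (E : (H q x + t * p x = H q x + t' * p x)%C).
    { apply Finj; auto. rewrite A2, B2. reflexivity. }
    apply RtoC_inj, Ceq_minus.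
    replace (t - t')%C with (((H q x + t * p x) - (H q x + t' * p x)) * / p x)%C by (field; exact Px).
    rewrite E. ring. }
  { exact Htau. }
  set (q1 := fun z => (q z + t * root_poly D z)%C) in *.
  specialize (Hper t Ht). fold q1 in Hper.
  assert (Hq1 : forall d, In d D -> q1 d = q d).
  { intros d Hd. unfold q1. rewrite root_poly_root by exact Hd. ring. }
  assert (E1 : H q1 x = (H q x + t * p x)%C) by (unfold H, q1, p; ring).
  destruct (tame_small (H q1) x (HtH q1 Hper) Hx) as (X1 & X2 & X3).
  pose proof (Hinv q1 Hper) as I1.
  assert (x0 : x <> 0%C) by (intros ->; contradiction).
  assert (Ny : H q1 x <> 0%C).
  { intro E. apply x0. apply (invertible_on_inj lam rho (H q1)); auto; try lra.
    - rewrite Cmod_0. lra.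
    - rewrite E. destruct I1 as (_ & _ & I0 & _). symmetry. exact I0. }
  exists q1, (x :: D), (F (H q1 x)). split; [exact Hper|]. split.
  { intros d [<-|Hd]; [exact X1 | apply HD, Hd]. }
  split; [right; exact D0|]. split.
  (* For the empty word [x] is [z0] itself, which enters the list only now. *)
  { destruct Dz as [->|Dz]; [left | right; exact Dz].
    rewrite <- (HWx q Hq ltac:(auto)). reflexivity. }
  split.
  - intros d [<-|Hd] E.
    + apply (Ffix (H q1 x)); auto.
    + apply (Hav d Hd). rewrite <- E1. split; [exact X3|]. rewrite <- E.
      unfold H. rewrite Hq1 by exact Hd. reflexivity.
  - intros q' Hq' Hag.
    assert (EW : W q' s = x).
    { apply HWx; [exact Hq'|]. intros d Hd. rewrite Hag by (right; exact Hd). apply Hq1, Hd. }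
    change (H q' (K q' (F (H q' (W q' s)))) = F (H q1 x)). rewrite EW.
    assert (E2 : H q' x = H q1 x) by (unfold H; rewrite Hag by (left; reflexivity); reflexivity).
    rewrite E2. apply (inv_on_spec lam rho (H q')); [apply Hinv, Hq'|].
    pose proof (tame_bound sg L F _ Ft X3). nra.
Qed.

(** Here the prescribed data is [y], and the perturbation moves its preimage [x1]. The preimage is
    outside [D], because the conjugator keeps its values on [D] and these differ from [y]. *)
Lemma step_f (s : list syllable) (q : C -> C) (D : list C) (y : C) (F : C -> C) :
  state_g s q D y -> List.Forall (fun x => good (snd x)) s -> (length s <= N)%nat -> good F ->
  exists q1 D1 x1, In z0 D1 /\ state_f ((false, F) :: s) q1 D1 x1.
Proof.
  intros (Hq & HD & D0 & Dz & Dy & HWy) Hs Hlen (Ft & Finj & Ffix).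
  set (p := root_poly D).
  destruct small_radius as (S1 & S2 & S3).
  destruct (small_on_perturb R0 eta q D HR Hq D0) as (tau & Htau & Hper).
  (* If the new end point were [d], the preimage of [y] would be the unique [c] with [F c = d]; then
     [H q c + t p c = y] with [p c <> 0] determines [t]. *)
  destruct (avoid_list C D (fun d t => exists c, Cmod c < sg /\ F c = d /\ p c <> 0%C /\
              (H q c + t * p c)%C = y)) with (tau := tau) as (t & Ht & Hav).
  { intros d t t' (c & A1 & A2 & A3 & A4) (c' & B1 & B2 & B3 & B4).
    assert (c' = c) by (apply Finj; auto; rewrite A2, B2; reflexivity). subst c'.
    apply RtoC_inj, Ceq_minus.
    replace (t - t')%C with (((H q c + t * p c) - (H q c + t' * p c)) * / p c)%C
      by (field; exact A3).
    rewrite A4, B4. ring. }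
  { exact Htau. }
  set (q1 := fun z => (q z + t * root_poly D z)%C) in *.
  specialize (Hper t Ht). fold q1 in Hper.
  assert (Hq1 : forall d, In d D -> q1 d = q d).
  { intros d Hd. unfold q1. rewrite root_poly_root by exact Hd. ring. }
  set (x1 := W q1 s).
  assert (Hx1 : Cmod x1 < sg / L ^ 3) by (apply HW; auto).
  destruct (tame_small F x1 Ft Hx1) as (X1 & X2 & X3).
  assert (Hy : H q1 x1 = y) by (apply HWy; auto).
  assert (Dx1 : ~ In x1 D).
  { intro Hd. apply (Dy x1 Hd). rewrite <- Hy. unfold H. rewrite Hq1 by exact Hd. reflexivity. }
  assert (Nx1 : x1 <> 0%C) by (intro E; apply Dx1; rewrite E; exact D0).
  exists q1, (x1 :: D), (F x1). split; [right; exact Dz|].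
  split; [exact Hper|]. split.
  { intros d [<-|Hd]; [exact X1 | apply HD, Hd]. }
  split; [right; exact D0|]. split; [right; right; exact Dz|]. split.
  - intros [E|Hd].
    + apply (Ffix x1 X1 Nx1). symmetry. exact E.
    + apply (Hav _ Hd). exists x1. split; [exact X1|]. split; [reflexivity|].
      split; [apply root_poly_neq0, Dx1|]. rewrite <- Hy. unfold H, q1, p. ring.
  - intros q' Hq' Hag.
    assert (Hy' : H q' (W q' s) = y).
    { apply HWy; [exact Hq'|]. intros d Hd. rewrite Hag by (right; exact Hd). apply Hq1, Hd. }
    change (F (W q' s) = F x1). f_equal.
    apply (invertible_on_inj lam rho (H q')); [apply Hinv, Hq' | | lra |].
    + pose proof (HW q' s Hq' Hs Hlen). nra.
    + rewrite Hy', <- Hy. unfold H. rewrite Hag by (left; reflexivity). reflexivity.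
Qed.

Lemma zero_small : small_on R0 eta (fun _ => 0%C).
Proof.
  repeat split.
  - intros z _. apply cdiff_atP. eexists. apply has_cderiv_const.
  - exists 0. split; [exact Heta|]. intros z _. rewrite Cmod_0. lra.
Qed.

Lemma start_state : state_f nil (fun _ => 0%C) (RtoC 0 :: nil) z0.
Proof.
  split; [exact zero_small|]. split.
  { intros d [<-|[]]. rewrite Cmod_0. exact Hsg. }
  split; [left; reflexivity|]. split; [left; reflexivity|]. split.
  - intros [E|[]]. apply Hz0. symmetry. exact E.
  - intros; reflexivity.
Qed.

(** Nothing has to be perturbed: the conjugator has not acted yet, and [F z0] differs from [z0] and
    0 by the properties of [F]. *)
Lemma first_step_f (F : C -> C) : good F ->
  exists q1 D1 x1, In z0 D1 /\ state_f ((false, F) :: nil) q1 D1 x1.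
Proof.
  intros (Ft & Finj & Ffix).
  destruct small_radius as (S1 & S2 & S3).
  assert (Hz : Cmod z0 < sg / L ^ 3).
  { apply (HW (fun _ => 0%C) nil zero_small); [constructor | simpl; lia]. }
  assert (Hz' : Cmod z0 < sg) by nra.
  exists (fun _ => 0%C), (z0 :: RtoC 0 :: nil), (F z0). split; [left; reflexivity|].
  split; [exact zero_small|]. split.
  { intros d [<-|[<-|[]]]; [exact Hz' | rewrite Cmod_0; exact Hsg]. }
  split; [right; left; reflexivity|]. split; [right; left; reflexivity|]. split.
  - intros [E|[E|[]]].
    + apply (Ffix z0 Hz' Hz0). symmetry. exact E.
    + apply Hz0, Finj; [exact Hz' | rewrite Cmod_0; exact Hsg |].
      destruct Ft as (_ & F0 & _). rewrite F0. symmetry. exact E.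
  - intros; reflexivity.
Qed.

Lemma itinerary (s : list syllable) : s <> nil -> alternating s ->
  List.Forall (fun x => good (snd x)) s -> (length s <= N)%nat ->
  exists q D x, In z0 D /\
    if fst (hd (false, fun z => z) s) then state_g s q D x else state_f s q D x.
Proof.
  induction s as [|[b F] s IH]; intros Hne Halt Hs Hlen; [contradiction|].
  apply Forall_cons_iff in Hs. destruct Hs as [HF Hs]. simpl in HF.
  assert (Hlen' : (length s <= N)%nat) by (simpl in Hlen; lia).
  destruct Halt as [Hb Halt]. simpl hd. simpl fst.
  destruct s as [|[b' F'] s].
  - destruct b.
    + destruct (step_g nil _ _ _ F start_state Hs Hlen' HF) as (q & D & y & Hst).
      exists q, D, y. split; [apply Hst | exact Hst].
    + apply first_step_f, HF.
  - destruct (IH ltac:(discriminate) Halt Hs Hlen') as (q & D & x & Dz & Hst).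
    simpl in Hb, Hst. destruct b, b'; try (exfalso; apply Hb; reflexivity).
    + destruct (step_g _ _ _ _ F Hst Hs Hlen' HF) as (q1 & D1 & y1 & Hst1).
      exists q1, D1, y1. split; [apply Hst1 | exact Hst1].
    + apply (step_f _ _ _ _ F Hst Hs Hlen' HF).
Qed.

(** [z0] belongs to [D], which the end point avoids. After a conjugated syllable this is read
    through the conjugator: a return to [z0] would give [H q z0 = y]. *)
Lemma itinerary_moves (s : list syllable) : s <> nil -> alternating s ->
  List.Forall (fun x => good (snd x)) s -> (length s <= N)%nat ->
  exists q, small_on R0 eta q /\ W q s <> z0.
Proof.
  intros Hne Halt Hs Hlen.
  destruct (itinerary s Hne Halt Hs Hlen) as (q & D & x & Dz & Hst).
  exists q. destruct (fst _).
  - destruct Hst as (Hq & _ & _ & _ & Dy & HWy). split; [exact Hq|].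
    intro E. apply (Dy z0 Dz). rewrite <- E at 1. apply HWy; auto.
  - destruct Hst as (Hq & _ & _ & _ & Dx & HWx). split; [exact Hq|].
    rewrite (HWx q Hq ltac:(auto)). intros ->. contradiction.
Qed.
End Itinerary.

Lemma invertible_on_tame (lam : C) (rho sg L : R) (F : C -> C) : invertible_on lam rho F ->
  sg <= rho -> sg <= Cmod lam * rho / 2 -> 2 * Cmod lam <= L -> 2 / Cmod lam <= L ->
  tame sg L F /\ tame sg L (inv_on rho F).
Proof.
  intros HF H1 H2 H3 H4. pose proof HF as (Hl & Hr & F0 & Fh & FL). split.
  - apply (tame_weaken rho (2 * Cmod lam)); auto. repeat split; auto.
    intros x y Hx Hy. apply near_linear_upper with rho; auto.
  - apply (tame_weaken (Cmod lam * rho / 2) (2 / Cmod lam)); auto. repeat split.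
    + apply inv_on_holo, HF.
    + apply (inv_on_0 lam), HF.
    + intros x y Hx Hy. apply inv_on_lipschitz; auto.
Qed.

Lemma syl_map_tame (h k : C -> C) (x : syllable) (sg L : R) : 0 < sg -> 1 <= L ->
  tame sg L h -> tame sg L k -> tame sg L (snd x) ->
  tame (sg / L ^ 3) (L ^ 3) (syl_map h k x).
Proof.
  intros Hs HL Hh Hk Hx.
  assert (P : 1 <= L ^ 3) by (apply pow_R1_Rle; lra).
  unfold syl_map. destruct x as [[] F]; simpl fst in *; simpl snd in *.
  - pose proof (tame_compose sg L (k :: F :: h :: nil) Hs HL) as T.
    apply T. intros G [<-|[<-|[<-|[]]]]; assumption.
  - apply (tame_weaken sg L); [exact Hx | |].
    + apply (Rmult_le_reg_r (L ^ 3)); [lra|].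
      replace (sg / L ^ 3 * L ^ 3) with sg by (field; lra). nra.
    + simpl in *. nra.
Qed.

Lemma moving_list (s : list syllable) : List.Forall (fun x => moving_germ (snd x)) s ->
  forall tau M, 0 < tau -> exists sg L, 0 < sg <= tau /\ 1 <= L /\ M <= L /\
    List.Forall (fun x => tame sg L (snd x) /\
      (forall u v, Cmod u < sg -> Cmod v < sg -> snd x u = snd x v -> u = v) /\
      (forall u, Cmod u < sg -> u <> 0%C -> snd x u <> u)) s.
Proof.
  intros H tau M Ht. induction H as [|x s (Hx & r & Hr & Hinj & Hfix) _ (sg & L & Hs & HL & HM & IH)].
  - exists tau, (Rmax 1 M). pose proof (Rmax_l 1 M). pose proof (Rmax_r 1 M).
    repeat split; try lra; auto.
  - destruct (germ_tame _ Hx) as (a & A & Ha & HA & HT).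
    exists (Rmin sg (Rmin r a)), (Rmax L A).
    pose proof (Rmin_l sg (Rmin r a)). pose proof (Rmin_r sg (Rmin r a)).
    pose proof (Rmin_l r a). pose proof (Rmin_r r a).
    pose proof (Rmax_l L A). pose proof (Rmax_r L A).
    split; [split; [repeat apply Rmin_glb_lt; lra | lra]|]. split; [lra|]. split; [lra|].
    constructor.
    + split; [apply (tame_weaken a A); auto; lra|]. split.
      * intros u v Hu Hv. apply Hinj; lra.
      * intros u Hu. apply Hfix. lra.
    + revert IH. apply List.Forall_impl. intros y (T1 & T2 & T3).
      split; [apply (tame_weaken sg L); auto; lra|]. split.
      * intros u v Hu Hv. apply T2; lra.
      * intros u Hu. apply T3. lra.
Qed.

Lemma syl_eval_tame (h k : C -> C) (s : list syllable) (sg L : R) : 0 < sg -> 1 <= L ->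
  tame sg L h -> tame sg L k -> List.Forall (fun x => tame sg L (snd x)) s ->
  tame (sg / L ^ 3 / (L ^ 3) ^ length s) ((L ^ 3) ^ length s) (syl_eval h k s).
Proof.
  intros Hs HL Hh Hk Hx. assert (P : 1 <= L ^ 3) by (apply pow_R1_Rle; lra).
  rewrite <- (length_map (syl_map h k) s).
  apply (tame_compose (sg / L ^ 3) (L ^ 3)); [apply Rdiv_lt_0_compat; lra | exact P |].
  intros F HF. apply in_map_iff in HF. destruct HF as (x & <- & Hin).
  apply syl_map_tame; auto. rewrite List.Forall_forall in Hx. apply Hx, Hin.
Qed.

Theorem nontrivial_perturbation (h0 : C -> C) (s : list syllable) (R0 eta : R) :
  is_diff h0 -> s <> nil -> alternating s -> List.Forall (fun x => moving_germ (snd x)) s ->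
  0 < R0 -> 0 < eta ->
  exists q k, small_on R0 eta q /\ is_diff (fun z => h0 z + q z)%C /\
    germ_inverse (fun z => h0 z + q z)%C k /\
    ~ germ_eq (syl_eval (fun z => h0 z + q z)%C k s) (fun z => z).
Proof.
  intros Hd Hne Halt Hs HR Heta.
  destruct (is_diff_perturb h0 R0 Hd HR) as (lam & rho & eta0 & Hrho & _ & Heta0 & Hinv0).
  set (e := Rmin eta eta0).
  assert (He : 0 < e) by (apply Rmin_glb_lt; auto).
  assert (Hinv : forall q, small_on R0 e q -> invertible_on lam rho (fun z => h0 z + q z)%C).
  { intros q (Hq & q0 & d & Hde & Hb). apply Hinv0; auto. intros z Hz.
    specialize (Hb z Hz). pose proof (Rmin_r eta eta0). unfold e in Hde. lra. }
  assert (Hl : lam <> 0%C).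
  { apply (Hinv (fun _ => 0%C)). apply (zero_small R0 e He). }
  apply Cmod_gt_0 in Hl.
  assert (Htau : 0 < Rmin rho (Cmod lam * rho / 2)) by (apply Rmin_glb_lt; nra).
  destruct (moving_list s Hs (Rmin rho (Cmod lam * rho / 2))
              (Rmax (2 * Cmod lam) (2 / Cmod lam)) Htau)
    as (sg & L & Hsg & HL & HM & Hgood).
  pose proof (Rmin_l rho (Cmod lam * rho / 2)). pose proof (Rmin_r rho (Cmod lam * rho / 2)).
  pose proof (Rmax_l (2 * Cmod lam) (2 / Cmod lam)).
  pose proof (Rmax_r (2 * Cmod lam) (2 / Cmod lam)).
  assert (Htame : forall q, small_on R0 e q -> tame sg L (fun z => h0 z + q z)%C /\
            tame sg L (inv_on rho (fun z => h0 z + q z)%C)).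
  { intros q Hq. apply (invertible_on_tame lam rho); auto; lra. }
  assert (P : 1 <= L ^ 3) by (apply pow_R1_Rle; lra).
  assert (PN : forall n, 1 <= (L ^ 3) ^ n) by (intro n; apply pow_R1_Rle; lra).
  assert (Ps : 0 < sg / L ^ 3) by (apply Rdiv_lt_0_compat; lra).
  (* On this disc every word with at most [length s] syllables is tame for every admissible [q]. If
     it were the identity near 0, the identity theorem would force it to fix [z0]. *)
  set (tau := sg / L ^ 3 / (L ^ 3) ^ length s).
  assert (Pt : 0 < tau) by (apply Rdiv_lt_0_compat; [lra | specialize (PN (length s)); lra]).
  set (z0 := RtoC (tau / 2)).
  assert (Ez0 : Cmod z0 = tau / 2) by (unfold z0; rewrite Cmod_R, Rabs_pos_eq; lra).
  destruct (itinerary_moves h0 R0 e rho sg L lam z0 (length s)) with (s := s)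
    as (q & Hq & Hmove); auto; try lra.
  - intros q Hq. exact (proj1 (Htame q Hq)).
  - apply Cmod_gt_0. lra.
  - intros q s' Hq Hs' Hlen.
    destruct (Htame q Hq) as [T1 T2].
    assert (T : tame (sg / L ^ 3 / (L ^ 3) ^ length s') ((L ^ 3) ^ length s')
              (syl_eval (fun z => h0 z + q z)%C (inv_on rho (fun z => h0 z + q z)%C) s')).
    { apply syl_eval_tame; auto; try lra. revert Hs'. apply List.Forall_impl. intros x Hx. apply Hx. }
    assert (Hle : (L ^ 3) ^ length s' <= (L ^ 3) ^ length s) by (apply Rle_pow; auto).
    pose proof (PN (length s')) as Pn. pose proof (PN (length s)) as Pn'.
    assert (Hz : Cmod z0 < sg / L ^ 3 / (L ^ 3) ^ length s').
    { rewrite Ez0. apply Rlt_le_trans with tau; [lra|].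
      apply Rmult_le_compat_l; [lra|]. apply Rinv_le_contravar; lra. }
    eapply Rle_lt_trans; [apply (tame_bound _ _ _ _ T Hz)|].
    apply (Rmult_lt_compat_l ((L ^ 3) ^ length s')) in Hz; [|lra].
    replace ((L ^ 3) ^ length s' * (sg / L ^ 3 / (L ^ 3) ^ length s')) with (sg / L ^ 3)
      in Hz by (field; lra). exact Hz.
  - exists q, (inv_on rho (fun z => h0 z + q z)%C).
    split.
    { destruct Hq as (Hq & q0 & d & Hde & Hb). repeat split; auto.
      exists d. split; [|exact Hb]. pose proof (Rmin_l eta eta0). unfold e in Hde. lra. }
    split; [apply (invertible_on_is_diff lam rho), Hinv, Hq|].
    split; [apply (invertible_on_germ_inverse lam), Hinv, Hq|].
    intro E. apply Hmove.
    destruct (Htame q Hq) as [T1 T2].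
    assert (T : tame tau ((L ^ 3) ^ length s)
              (syl_eval (fun z => h0 z + q z)%C (inv_on rho (fun z => h0 z + q z)%C) s)).
    { apply syl_eval_tame; auto; try lra. revert Hgood. apply List.Forall_impl. intros x Hx. apply Hx. }
    apply (identity_theorem _ (fun z => z) tau Pt (proj1 T)); [|exact E | lra].
    intros z _. apply cdiff_atP. eexists. apply has_cderiv_id.
Qed.

(** * Open dense sets of conjugators *)

Definition syl_germ_eq (x y : syllable) : Prop :=
  fst x = fst y /\ germ_fix0 (snd x) /\ germ_eq (snd x) (snd y).

Lemma syl_eval_germ_eq (h h' k k' : C -> C) (s s' : list syllable) :
  germ_fix0 h -> germ_fix0 k -> germ_eq h h' -> germ_eq k k' ->
  Forall2 syl_germ_eq s s' -> germ_eq (syl_eval h k s) (syl_eval h' k' s').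
Proof.
  intros Hh Hk Eh Ek H.
  enough (HW : germ_fix0 (syl_eval h k s) /\ germ_eq (syl_eval h k s) (syl_eval h' k' s'))
    by apply HW.
  induction H as [|[b F] [b' F'] s s' (Eb & HF & EF) _ [IH1 IH2]].
  - split; [exact germ_fix0_id | apply germ_eq_refl].
  - simpl in Eb, HF, EF. subst b'. split.
    + exact (germ_fix0_comp _ (syl_eval h k s) (germ_fix0_syl h k (b, F) Hh Hk HF) IH1).
    + apply (germ_eq_comp (syl_map h k (b, F)) (syl_map h' k' (b, F'))
               (syl_eval h k s) (syl_eval h' k' s') IH1); [|exact IH2].
      destruct b; [|exact EF].
      apply (germ_eq_comp k k' (fun z => F (h z)) (fun z => F' (h' z))).
      * apply germ_fix0_comp; assumption.
      * exact Ek.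
      * apply (germ_eq_comp F F' h h'); assumption.
Qed.

Lemma germ_tame_list (s : list syllable) : List.Forall (fun x => germ_fix0 (snd x)) s ->
  forall tau M, 0 < tau -> exists sg L, 0 < sg <= tau /\ 1 <= L /\ M <= L /\
    List.Forall (fun x => tame sg L (snd x)) s.
Proof.
  intros H tau M Ht. induction H as [|x s Hx _ (sg & L & Hs & HL & HM & IH)].
  - exists tau, (Rmax 1 M). pose proof (Rmax_l 1 M). pose proof (Rmax_r 1 M).
    repeat split; try lra; auto.
  - destruct (germ_tame _ Hx) as (a & A & Ha & HA & HT).
    exists (Rmin sg a), (Rmax L A).
    pose proof (Rmin_l sg a). pose proof (Rmin_r sg a).
    pose proof (Rmax_l L A). pose proof (Rmax_r L A).
    split; [split; [apply Rmin_glb_lt; lra | lra]|]. split; [lra|]. split; [lra|].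
    constructor.
    + apply (tame_weaken a A); auto; lra.
    + revert IH. apply List.Forall_impl. intros y T. apply (tame_weaken sg L); auto; lra.
Qed.

Lemma tame_close_refl (sg L d : R) (F : C -> C) : 0 <= d -> tame sg L F -> tame_close sg L d F F.
Proof.
  intros Hd H. split; [exact H|]. split; [exact H|]. intros z _.
  replace (F z - F z)%C with (RtoC 0) by ring. rewrite Cmod_0. exact Hd.
Qed.

(** [compose_close] is used twice: for the three maps of a conjugated syllable, giving [3 L^3 d],
    and along the list of syllables. *)
Lemma syl_eval_close (sg L d : R) (h h' k k' : C -> C) (s : list syllable) :
  0 < sg -> 1 <= L -> 0 <= d -> tame_close sg L d h h' -> tame_close sg L d k k' ->
  List.Forall (fun x => tame sg L (snd x)) s ->
  forall z, Cmod z < sg / L ^ 3 / (L ^ 3) ^ length s ->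
    Cmod (syl_eval h k s z - syl_eval h' k' s z) <=
      INR (length s) * (L ^ 3) ^ length s * (3 * L ^ 3 * d).
Proof.
  intros Hs HL Hd Hh Hk Hx z Hz.
  assert (P : 1 <= L ^ 3) by (apply pow_R1_Rle; lra).
  rewrite <- (length_map (syl_map h k) s) in Hz |- *.
  apply (compose_close (sg / L ^ 3) (L ^ 3)); auto.
  - apply Rdiv_lt_0_compat; lra.
  - nra.
  - clear Hz. induction Hx as [|[b F] s HF _ IH]; [constructor|].
    constructor; [|exact IH]. simpl in HF. split; [|split].
    + apply syl_map_tame; auto; [apply Hh | apply Hk].
    + apply syl_map_tame; auto; [apply Hh | apply Hk].
    + intros x Hxs. destruct b.
      * replace (3 * L ^ 3 * d) with
          (INR (length (k :: F :: h :: nil)) * L ^ length (k :: F :: h :: nil) * d)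
          by (simpl; ring).
        apply (compose_close sg L d (k :: F :: h :: nil) (k' :: F :: h' :: nil)); auto.
        constructor; [exact Hk|]. constructor; [apply tame_close_refl; auto|].
        constructor; [exact Hh | constructor].
      * change (Cmod (F x - F x) <= 3 * L ^ 3 * d).
        replace (F x - F x)%C with (RtoC 0) by ring. rewrite Cmod_0. nra.
Qed.

Lemma basic_nbhd_refl (h : C -> C) (r eps : R) : is_diff h -> 0 < eps -> basic_nbhd h r eps h.
Proof.
  intros Hd He. split; [exact Hd|]. exists (fun _ => 0%C). repeat split.
  - intros z _. apply cdiff_atP. eexists. apply has_cderiv_const.
  - exists 1. split; [lra|]. intros z _. ring.
  - exists 0. split; [exact He|]. intros z _. rewrite Cmod_0. lra.
Qed.

(** A nontrivial word displaces some [z0] of a disc on which all nearby words are defined. A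
    perturbation changes the value there by less than this displacement, and a word that is the
    identity near 0 would fix [z0]. *)
Lemma syl_eval_nontrivial_nbhd (h k : C -> C) (s : list syllable) :
  is_diff h -> germ_inverse h k -> List.Forall (fun x => germ_fix0 (snd x)) s ->
  ~ germ_eq (syl_eval h k s) (fun z => z) ->
  exists eps, 0 < eps /\ forall h', basic_nbhd h 1 eps h' ->
    exists k', germ_inverse h' k' /\ ~ germ_eq (syl_eval h' k' s) (fun z => z).
Proof.
  intros Hd Hk Hs HN.
  destruct (is_diff_perturb h 1 Hd Rlt_0_1) as (lam & rho & eta & Hrho & Hrho1 & Heta & Hinv).
  (* Written as the zero perturbation, [h] gets from [is_diff_perturb] the same [lam] and [rho] as
     its neighbours. *)
  set (h0 := fun z => (h z + 0)%C).
  assert (I0 : invertible_on lam rho h0).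
  { apply (Hinv (fun _ => 0%C)); [|reflexivity|].
    - intros z _. apply cdiff_atP. eexists. apply has_cderiv_const.
    - intros z _. rewrite Cmod_0. lra. }
  assert (Hl : 0 < Cmod lam) by (apply Cmod_gt_0, I0).
  assert (Htau : 0 < Rmin rho (Cmod lam * rho / 2)) by (apply Rmin_glb_lt; nra).
  destruct (germ_tame_list s Hs (Rmin rho (Cmod lam * rho / 2))
              (Rmax (2 * Cmod lam) (2 / Cmod lam)) Htau) as (sg & L & Hsg & HL & HM & HT).
  pose proof (Rmin_l rho (Cmod lam * rho / 2)) as M1.
  pose proof (Rmin_r rho (Cmod lam * rho / 2)) as M2.
  pose proof (Rmax_l (2 * Cmod lam) (2 / Cmod lam)) as M3.
  pose proof (Rmax_r (2 * Cmod lam) (2 / Cmod lam)) as M4.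
  assert (Htame : forall F, invertible_on lam rho F -> tame sg L F /\ tame sg L (inv_on rho F)).
  { intros F HF. apply (invertible_on_tame lam rho); auto; lra. }
  assert (P : 1 <= L ^ 3) by (apply pow_R1_Rle; lra).
  set (n := length s).
  assert (PN : 1 <= (L ^ 3) ^ n) by (apply pow_R1_Rle; lra).
  set (tau := sg / L ^ 3 / (L ^ 3) ^ n).
  assert (Pt : 0 < tau).
  { apply Rdiv_lt_0_compat; [apply Rdiv_lt_0_compat; lra | lra]. }
  set (k0 := inv_on rho h0).
  assert (Eh : germ_eq h h0).
  { exists 1. split; [lra|]. intros z _. unfold h0. ring. }
  assert (Hh : germ_fix0 h) by (destruct Hd as (Hd1 & Hd2 & _); split; auto).
  assert (Hh0 : germ_fix0 h0) by (apply (tame_germ sg L); [lra | exact (proj1 (Htame h0 I0))]).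
  assert (Hk' : germ_fix0 k) by (destruct Hk as (Hk1 & Hk2 & _); split; auto).
  assert (Ek : germ_eq k k0).
  { apply (germ_inverse_unique h h0); auto. apply (invertible_on_germ_inverse lam), I0. }
  assert (Hss : Forall2 syl_germ_eq s s).
  { clear -Hs. induction Hs; constructor; auto.
    split; [reflexivity|]. split; [assumption | apply germ_eq_refl]. }
  assert (exists z0, Cmod z0 < tau /\ syl_eval h0 k0 s z0 <> z0) as (z0 & Hz0 & Nz0).
  { apply NNPP. intro A. apply HN.
    apply germ_eq_trans with (syl_eval h0 k0 s).
    - apply syl_eval_germ_eq; auto.
    - exists tau. split; [exact Pt|]. intros z Hz. apply NNPP. intro B. apply A.
      exists z. auto. }
  set (D := Cmod (syl_eval h0 k0 s z0 - z0)).
  assert (PD : 0 < D).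
  { apply Cmod_gt_0. intro E. apply Nz0, Ceq_minus, E. }
  set (A := INR n * (L ^ 3) ^ n * (3 * L ^ 3 * L)).
  assert (PA : 0 <= A).
  { unfold A. pose proof (pos_INR n). apply Rmult_le_pos; nra. }
  (* Conjugator and inverse change by at most [L * eps], hence the word by at most [A * eps < D]. *)
  set (eps := Rmin eta (D / (A + 1))).
  assert (Pe : 0 < eps) by (apply Rmin_glb_lt; [lra | apply Rdiv_lt_0_compat; lra]).
  exists eps. split; [exact Pe|].
  intros h' (Hd' & q & Hq & (r & Hr & Eq) & d & Hde & Hb).
  assert (q0 : q 0%C = 0%C).
  { rewrite Eq by (unfold ball0; rewrite Cmod_0; exact Hr).
    destruct Hd as (_ & -> & _), Hd' as (_ & -> & _). ring. }
  assert (He1 : eps <= eta) by apply Rmin_l.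
  assert (He2 : eps <= D / (A + 1)) by apply Rmin_r.
  set (F := fun z => (h z + q z)%C).
  assert (IF : invertible_on lam rho F).
  { apply Hinv; auto. intros z Hz. specialize (Hb z Hz). lra. }
  assert (Eh' : germ_eq F h').
  { exists r. split; [exact Hr|]. intros z Hz. unfold F. rewrite Eq by exact Hz. ring. }
  pose proof Hd' as (Hh' & h'0 & k' & Hk1).
  exists k'. split; [exact Hk1|]. intro E.
  destruct (Htame h0 I0) as [Th0 Tk0]. destruct (Htame F IF) as [TF TK].
  assert (EkF : germ_eq (inv_on rho F) k').
  { apply (germ_inverse_unique F h'); auto; [split; auto|].
    apply (invertible_on_germ_inverse lam), IF. }
  assert (E' : germ_eq (syl_eval F (inv_on rho F) s) (fun z => z)).
  { apply germ_eq_trans with (2 := E). apply syl_eval_germ_eq; auto.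
    - apply (tame_germ sg L); [lra | exact TF].
    - apply (tame_germ sg L); [lra | exact TK]. }
  assert (TW : tame tau ((L ^ 3) ^ n) (syl_eval F (inv_on rho F) s)).
  { apply syl_eval_tame; auto; lra. }
  assert (Efix : syl_eval F (inv_on rho F) s z0 = z0).
  { apply (identity_theorem _ (fun z => z) tau Pt (proj1 TW)); [|exact E' | exact Hz0].
    intros z _. apply cdiff_atP. eexists. apply has_cderiv_id. }
  assert (Hclose : Cmod (syl_eval h0 k0 s z0 - syl_eval F (inv_on rho F) s z0) <=
            INR n * (L ^ 3) ^ n * (3 * L ^ 3 * (L * eps))).
  { assert (Hqb : forall x, Cmod x < rho -> Cmod (q x) <= eps).
    { intros x Hx. assert (Cmod x < 1) by lra. specialize (Hb x H). lra. }
    apply (syl_eval_close sg L (L * eps)); auto; try lra; try nra.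
    - split; [exact Th0|]. split; [exact TF|]. intros z Hz. unfold h0, F.
      replace (h z + 0 - (h z + q z))%C with (- q z)%C by ring. rewrite Cmod_opp.
      specialize (Hqb z ltac:(lra)). nra.
    - split; [exact Tk0|]. split; [exact TK|]. intros y Hy.
      assert (Hy' : Cmod y < Cmod lam * rho / 2) by lra.
      destruct (inv_on_spec lam rho h0 y I0 Hy') as [A1 A2].
      destruct (inv_on_spec lam rho F y IF Hy') as [B1 B2].
      unfold k0. set (x := inv_on rho F y) in *.
      (* Both preimages of [y] lie in the disc of radius [rho], and [h0 x] misses [y] by exactly
         [q x]; the lower Lipschitz bound of [h0] compares the inverses. *)
      pose proof (near_linear_lower lam rho h0 _ _ (proj2 (proj2 (proj2 (proj2 I0)))) A1 B1) as LL.
      rewrite A2 in LL.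
      replace (y - h0 x)%C with (q x) in LL by (rewrite <- B2; unfold h0, F; ring).
      specialize (Hqb x B1).
      assert (LL' : Cmod (inv_on rho h0 y - x) <= 2 / Cmod lam * eps).
      { apply (Rmult_le_reg_l (Cmod lam / 2)); [lra|].
        replace (Cmod lam / 2 * (2 / Cmod lam * eps)) with eps by (field; lra). lra. }
      nra. }
  rewrite Efix in Hclose. fold D in Hclose.
  replace (INR n * (L ^ 3) ^ n * (3 * L ^ 3 * (L * eps))) with (A * eps) in Hclose
    by (unfold A; ring).
  apply (Rmult_le_compat_l (A + 1)) in He2; [|lra].
  replace ((A + 1) * (D / (A + 1))) with D in He2 by (field; lra).
  lra.
Qed.

(** Two binary digits per letter; every other ending is read as the empty word. This surjection
    indexes the sets by natural numbers. *)
Fixpoint decode_word (p : positive) : list letter :=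
  match p with
  | xO (xO p) => (false, false) :: decode_word p
  | xO (xI p) => (false, true) :: decode_word p
  | xI (xO p) => (true, false) :: decode_word p
  | xI (xI p) => (true, true) :: decode_word p
  | _ => nil
  end.

Lemma decode_word_surj (w : list letter) : exists p, decode_word p = w.
Proof.
  induction w as [|[[] []] w [p IH]].
  - exists xH. reflexivity.
  - exists (xI (xI p)). simpl. rewrite IH. reflexivity.
  - exists (xI (xO p)). simpl. rewrite IH. reflexivity.
  - exists (xO (xI p)). simpl. rewrite IH. reflexivity.
  - exists (xO (xO p)). simpl. rewrite IH. reflexivity.
Qed.

(** One syllable per letter, without merging: this reproduces [eval_word] pointwise for arbitrary
    [h] and [k], and openness asks for no alternation. The merged form serves density. *)
Definition letter_syllables (f finv g ginv : C -> C) (w : list letter) : list syllable :=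
  map (fun l : letter => (fst l, if fst l then if snd l then ginv else g
                                 else if snd l then finv else f)) w.

Lemma eval_word_syllables (f finv g ginv h k : C -> C) (w : list letter) (z : C) :
  eval_word w f finv (fun z => k (g (h z))) (fun z => k (ginv (h z))) z =
  syl_eval h k (letter_syllables f finv g ginv w) z.
Proof.
  induction w as [|[[] []] w IH]; [reflexivity | ..]; simpl; rewrite IH; reflexivity.
Qed.

Definition nontrivial_at (f finv g ginv : C -> C) (w : list letter) (h : C -> C) : Prop :=
  is_diff h /\ exists k, germ_inverse h k /\
    ~ germ_eq (syl_eval h k (letter_syllables f finv g ginv w)) (fun z => z).

(** * The open dense set of a single word *)

Section Generic.
Variables (f finv g ginv : C -> C).
Hypothesis Hf : is_diff f.
Hypothesis Hg : is_diff g.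
Hypothesis Hfi : germ_inverse f finv.
Hypothesis Hgi : germ_inverse g ginv.
Hypothesis Of : infinite_order f.
Hypothesis Og : infinite_order g.

Lemma letter_is_diff (l : letter) :
  is_diff (if fst l then if snd l then ginv else g else if snd l then finv else f).
Proof.
  destruct l as [[] []]; simpl; auto.
  - apply (is_diff_inverse g); auto.
  - apply (is_diff_inverse f); auto.
Qed.

Lemma letter_infinite_order (l : letter) :
  infinite_order (if fst l then if snd l then ginv else g else if snd l then finv else f).
Proof.
  destruct l as [[] []]; simpl; auto.
  - apply (infinite_order_inverse g); auto.
  - apply (infinite_order_inverse f); auto.
Qed.

Lemma is_diff_germ_fix0 (h : C -> C) : is_diff h -> germ_fix0 h.
Proof. intros (H & H0 & _). split; assumption. Qed.

Lemma letter_syllables_germ (w : list letter) :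
  List.Forall (fun x => germ_fix0 (snd x)) (letter_syllables f finv g ginv w).
Proof.
  apply List.Forall_map, List.Forall_forall. intros l _.
  apply is_diff_germ_fix0, letter_is_diff.
Qed.

Lemma nontrivial_at_open (w : list letter) : an_open (nontrivial_at f finv g ginv w).
Proof.
  intros h (Hd & k & Hk & HN).
  destruct (syl_eval_nontrivial_nbhd h k _ Hd Hk (letter_syllables_germ w) HN) as (eps & He & H).
  exists h, 1, eps. split; [exact Hd|]. split; [lra|]. split; [exact He|]. split.
  - apply basic_nbhd_refl; auto.
  - intros h' Hh'. split; [apply Hh' | apply H, Hh'].
Qed.

(** The open set contains a basic neighbourhood in which [h1] has sup bound [d < eps]; adding [q] of
    size below [eps - d] stays inside. The germ [h1] itself may not extend to radius [r]; only [G],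
    extending [h1 - f0], and [q] must. *)
Lemma nontrivial_at_dense (w : list letter) : w <> nil -> reduced w -> an_dense (nontrivial_at f finv g ginv w).
Proof.
  intros Hw Hr V HV [h1 Hh1].
  destruct (HV h1 Hh1) as (f0 & r & eps & Hf0 & Hr0 & He & (Hd1 & G & HG & EG & d & Hde & Hb) & Hsub).
  destruct (word_syllables f finv g ginv) with (w := w) as (s & Hne & Halt & Hs & Hev); auto.
  { intro l. apply is_diff_germ_fix0, letter_is_diff. }
  { intros l n Hn. apply moving_iter; [apply letter_is_diff | apply letter_infinite_order | exact Hn]. }
  destruct (nontrivial_perturbation h1 s r (eps - d)) as (q & k & (Hq & q0 & d' & Hd' & Hb') & Hdq & Hk & HN);
    auto; try lra.
  exists (fun z => h1 z + q z)%C. split.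
  - apply Hsub. split; [exact Hdq|]. exists (fun z => G z + q z)%C. split; [|split].
    + intros z Hz. apply cdiff_atP.
      destruct (proj1 (cdiff_atP G z) (HG z Hz)) as [a Ha].
      destruct (proj1 (cdiff_atP q z) (Hq z Hz)) as [b Hb2].
      eexists. apply has_cderiv_plus; eassumption.
    + refine (near0_impl _ _ _ EG). intros z Hz. rewrite Hz. ring.
    + exists (d + d'). split; [lra|]. intros z Hz.
      eapply Rle_trans; [apply Cmod_triangle|].
      specialize (Hb z Hz). specialize (Hb' z Hz). lra.
  - split; [exact Hdq|]. exists k. split; [exact Hk|]. intro E. apply HN.
    apply germ_eq_trans with (2 := E).
    apply germ_eq_trans with (1 := germ_eq_sym _ _ (Hev _ k (is_diff_germ_fix0 _ Hdq) Hk)).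
    exists 1. split; [lra|]. intros z _. apply eval_word_syllables.
Qed.
End Generic.

(** The whole group is the set assigned to codes of empty or non-reduced words. *)
Lemma is_diff_open : an_open is_diff.
Proof.
  intros h Hd. exists h, 1, 1. split; [exact Hd|]. split; [lra|]. split; [lra|]. split.
  - apply basic_nbhd_refl; [exact Hd | lra].
  - intros h' Hh'. apply Hh'.
Qed.

Lemma is_diff_dense : an_dense is_diff.
Proof.
  intros V HV [h Hh]. exists h. split; [exact Hh|].
  destruct (HV h Hh) as (f0 & r & eps & _ & _ & _ & Hn & _). apply Hn.
Qed.

Theorem theorem4p1 (f g : C -> C) :
  is_diff f -> is_diff g -> infinite_order f -> infinite_order g ->
  exists H : (C -> C) -> Prop,
    G_delta_dense H /\
    forall h, H h ->
      forall finv ginv hinv,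
        germ_inverse f finv -> germ_inverse g ginv -> germ_inverse h hinv ->
        forall w : list letter, w <> nil -> reduced w ->
          ~ germ_eq
              (eval_word w f finv
                 (fun z => hinv (g (h z))) (fun z => hinv (ginv (h z))))
              (fun z => z).
Proof.
  intros Hf Hg Of Og.
  pose proof Hf as (_ & _ & f' & Hf'). pose proof Hg as (_ & _ & g' & Hg').
  assert (HU : forall w, exists U : (C -> C) -> Prop, (an_open U /\ an_dense U) /\
            (w <> nil -> reduced w -> forall h, U h -> nontrivial_at f f' g g' w h)).
  { intro w. destruct (classic (w <> nil /\ reduced w)) as [[Hw Hr]|A].
    - exists (nontrivial_at f f' g g' w). split; [|auto]. split.
      + apply nontrivial_at_open; assumption.
      + apply nontrivial_at_dense; assumption.
    - exists is_diff. split; [exact (conj is_diff_open is_diff_dense)|].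
      intros Hw Hr. exfalso. auto. }
  set (U := fun w => proj1_sig (constructive_indefinite_description _ (HU w))).
  assert (HU' : forall w, (an_open (U w) /\ an_dense (U w)) /\
            (w <> nil -> reduced w -> forall h, U w h -> nontrivial_at f f' g g' w h)).
  { intro w. unfold U. apply proj2_sig. }
  (* [Pos.of_nat] sends both 0 and 1 to 1, which only repeats the set of the empty word. *)
  exists (fun h => forall n, U (decode_word (Pos.of_nat n)) h). split.
  - exists (fun n => U (decode_word (Pos.of_nat n))). split.
    + intro n. apply HU'.
    + intro h. reflexivity.
  - intros h Hh finv ginv hinv Hfi Hgi Hhi w Hw Hr E.
    destruct (decode_word_surj w) as [p Hp].
    specialize (Hh (Pos.to_nat p)). rewrite Pos2Nat.id, Hp in Hh.
    destruct (proj2 (HU' w) Hw Hr h Hh) as (Hd & k & Hk & HN). apply HN.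
    assert (E' : germ_eq (syl_eval h hinv (letter_syllables f finv g ginv w)) (fun z => z)).
    { refine (near0_impl _ _ _ E). intros z Hz. rewrite <- eval_word_syllables. exact Hz. }
    apply germ_eq_trans with (2 := E').
    (* The sets were built with fixed inverses [f'], [g'] and some [k]; uniqueness of inverse germs
       transfers nontriviality to the given ones. *)
    apply syl_eval_germ_eq.
    + apply is_diff_germ_fix0, Hd.
    + destruct Hk as (Hk & k0 & _). split; assumption.
    + apply germ_eq_refl.
    + apply (germ_inverse_unique h h); auto; [apply is_diff_germ_fix0, Hd | apply germ_eq_refl].
    + clear -Hf Hg Hf' Hg' Hfi Hgi. induction w as [|l w IH]; constructor; [|exact IH].
      split; [reflexivity|]. split.
      * apply is_diff_germ_fix0, letter_is_diff; assumption.
      * destruct l as [[] []]; simpl; try apply germ_eq_refl.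
        -- apply (germ_inverse_unique g g); auto; [apply is_diff_germ_fix0, Hg | apply germ_eq_refl].
        -- apply (germ_inverse_unique f f); auto; [apply is_diff_germ_fix0, Hf | apply germ_eq_refl].
Qed.
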